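(* Let $C>0$, $z>0$ and $$z\le\min\bigl\{Ce^{-CC_\phi};\,2Ce^{-2CC_\phi}\bigr\}.$$ Then $(\widehat L,\mathcal L_{2C})$ is a closable linear operator in $\mathcal L_C$, and its closure $(\widehat L,D(\widehat L))$ generates a strongly continuous contraction semigroup $\widehat T_t$ on $\mathcal L_C$.
   Context: $\Gamma_0$ is the set of all finite subsets of $\mathbb R^d$, with the Lebesgue–Poisson measure $\lambda$: $\int_{\Gamma_0}G\,d\lambda=G(\emptyset)+\sum_{n\ge1}\frac1{n!}\int_{(\mathbb R^d)^n}G(\{x_1,\dots,x_n\})\,dx_1\cdots dx_n$. $|\eta|$ is the cardinality; braces of one-point sets are omitted. For $c>0$, $\mathcal L_c=L^1(\Gamma_0,c^{|\cdot|}d\lambda)$ with norm $\|G\|_c=\int_{\Gamma_0}|G(\eta)|c^{|\eta|}d\lambda(\eta)$. $\phi:\mathbb R^d\setminus\{0\}\to[0,\infty)$ is a measurable even function with $C_\phi:=\int_{\mathbb R^d}(1-e^{-\phi(x)})\,dx<\infty$; $E^\phi(x,\xi)=\sum_{y\in\xi}\phi(x-y)$; $e_\lambda(f,\eta)=\prod_{x\in\eta}f(x)$, $e_\lambda(f,\emptyset)=1$. The operator $\widehat L$ in $\mathcal L_C$ with (dense) domain $\mathcal L_{2C}$ is (for $\lambda$-a.a. $\eta$) $$(\widehat LG)(\eta)=-|\eta|G(\eta)+z\sum_{\xi\subset\eta}\int_{\mathbb R^d}e^{-E^\phi(x,\xi)}G(\xi\cup x)\,e_\lambda(e^{-\phi(x-\cdot)}-1,\eta\setminus\xi)\,dx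 .$$ *)

(* Defs.v *)
From HB Require Import structures.
From mathcomp Require Import all_boot all_order all_algebra finmap.
From mathcomp Require Import all_classical all_reals all_analysis.
From mathcomp Require Import measurable_realfun ess_sup_inf.

Set Implicit Arguments.
Unset Strict Implicit.
Unset Printing Implicit Defensive.

Import Order.TTheory GRing.Theory Num.Theory numFieldNormedType.Exports.

Local Open Scope classical_set_scope.
Local Open Scope ring_scope.

(* The library's Lp space of classes of functions modulo equality almost
   everywhere, as a normed space. *)
Section Lspace_normed.
Context d (T : measurableType d) (R : realType).
Variables (mu : {measure set T -> \bar R}) (p : \bar R) (p1 : (1 <= p)%E).
Local Notation Lf := (LfunType mu p1).
Local Notation Lp := (LspaceType mu p1).
Local Notation Lq := {mfun_ mu, T >-> measurableTypeR R}.
Local Open Scope quotient_scope.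

Lemma Lnorm_ae_eq (f g : T -> R) :
  measurable_fun setT f -> measurable_fun setT g ->
  f = g %[ae mu] -> ('N[mu]_p[EFin \o f] = 'N[mu]_p[EFin \o g])%E.
Proof.
move=> mf mg fg; rewrite unlock /Lnorm.
case: p p1 => [r _|_|//]; last first.
  by case: ifP => // _; apply: eq_ess_sup; apply: filterS fg => x /= ->.
have mpow (h : T -> R) : measurable_fun setT h ->
    measurable_fun setT (fun x => (`|(h x)%:E| `^ r)%E : \bar R).
  move=> mh.
  apply: (@measurableT_comp _ _ _ _ _ _ (fun x : \bar R => x `^ r)%E).
    exact: measurable_poweR.
  by apply: measurableT_comp => //; exact/measurable_EFinP.
congr (_ `^ _)%E; apply: ae_eq_integral => //.
- exact: mpow.
- exact: mpow.
- by apply: filterS fg => x /= + Dx => ->.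
Qed.

Lemma Lspace_Lfun (G : Lp) : (G : T -> R) \in Lfun mu p.
Proof.
apply/andP; split; rewrite inE; last exact: Lebesgue_finite.
exact: (@measurable_funPT _ _ _ _ (repr (G : Lq))).
Qed.

Definition Lspace_repr (G : Lp) : Lf := Lfun_Sub p1 (Lspace_Lfun G).

Let mfun_of (f : Lf) : {mfun T >-> measurableTypeR R} :=
  @mfun_Sub _ _ T (measurableTypeR R) f (mem_set (@measurable_funPT _ _ _ _ f)).

Let cls (f : Lf) : Lq := \pi_Lq (mfun_of f).

Let cls_ae (f : Lf) : (cls f : T -> R) = f %[ae mu].
Proof. by have /eqmodP/asboolP := reprK (cls f). Qed.

Let cls_fin (f : Lf) : finite_norm mu p (cls f : T -> R).
Proof.
have mcls : measurable_fun setT (cls f : T -> R).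
  exact: (@measurable_funPT _ _ _ _ (repr (cls f))).
have -> : finite_norm mu p (cls f : T -> R) = finite_norm mu p f.
  by congr (_ < _)%E; apply: Lnorm_ae_eq.
exact: Lfunction_finite.
Qed.

Definition Lspace_class (f : Lf) : Lp :=
  @LebesgueSpace.Pack _ _ _ mu p p1 (cls f)
    (LebesgueSpace.Class (isFinLebesgue.Build _ _ _ mu p p1 (cls f) (cls_fin f))).

Lemma Lspace_classK (f : Lf) : (Lspace_class f : T -> R) = f %[ae mu].
Proof. exact: cls_ae. Qed.

Lemma Lspace_eqP (G H : Lp) : (G : T -> R) = H %[ae mu] <-> G = H.
Proof.
split=> [|->]; last exact: ae_eq_refl.
case: G => G [[GP]]; case: H => H [[HP]] /= GH.
have E : G = H by rewrite -[G]reprK -[H]reprK; apply/eqmodP/asboolP.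
by case: _ / E in HP GH *; rewrite (Prop_irrelevance GP HP).
Qed.

Lemma Lspace_classE (f : Lf) (G : Lp) :
  (f : T -> R) = G %[ae mu] -> Lspace_class f = G.
Proof.
move=> fG; apply/Lspace_eqP.
exact: ae_eq_trans (Lspace_classK f) fG.
Qed.

Let add (G H : Lp) := Lspace_class (Lspace_repr G + Lspace_repr H).
Let opp (G : Lp) := Lspace_class (- Lspace_repr G).
Let scale (a : R) (G : Lp) := Lspace_class (a *: Lspace_repr G).
Let zero : Lp := Lspace_class 0.

Let addP (G H : Lp) : (add G H : T -> R) = (fun x => (G : T -> R) x + (H : T -> R) x) %[ae mu].
Proof. exact: Lspace_classK. Qed.
Let oppP (G : Lp) : (opp G : T -> R) = (fun x => - (G : T -> R) x) %[ae mu].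
Proof. exact: Lspace_classK. Qed.
Let scaleP (a : R) (G : Lp) : (scale a G : T -> R) = (fun x => a * (G : T -> R) x) %[ae mu].
Proof. exact: Lspace_classK. Qed.
Let zeroP : (zero : T -> R) = (fun=> 0) %[ae mu].
Proof. exact: Lspace_classK. Qed.

HB.instance Definition _ := gen_eqMixin Lp.
HB.instance Definition _ := gen_choiceMixin Lp.

Let addA : associative add.
Proof.
move=> F G H; apply/Lspace_eqP; near=> x => _.
rewrite (near (addP F (add G H)))// (near (addP G H))//.
rewrite (near (addP (add F G) H))// (near (addP F G))//; exact: addrA.
Unshelve. all: by end_near. Qed.

Let addC : commutative add.
Proof.
move=> F G; apply/Lspace_eqP; near=> x => _.
rewrite (near (addP F G))// (near (addP G F))//; exact: addrC.
Unshelve. all: by end_near. Qed.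

Let add0 : left_id zero add.
Proof.
move=> F; apply/Lspace_eqP; near=> x => _.
rewrite (near (addP zero F))// (near zeroP)//; exact: add0r.
Unshelve. all: by end_near. Qed.

Let addN : left_inverse zero opp add.
Proof.
move=> F; apply/Lspace_eqP; near=> x => _.
rewrite (near (addP (opp F) F))// (near (oppP F))// (near zeroP)//.
exact: addNr.
Unshelve. all: by end_near. Qed.

HB.instance Definition _ := GRing.isZmodule.Build Lp addA addC add0 addN.

Let scaleA a b (F : Lp) : scale a (scale b F) = scale (a * b) F.
Proof.
apply/Lspace_eqP; near=> x => _.
rewrite (near (scaleP a (scale b F)))// (near (scaleP b F))//.
by rewrite (near (scaleP (a * b) F))// mulrA.
Unshelve. all: by end_near. Qed.

Let scale1 : left_id 1 scale.
Proof.
move=> F; apply/Lspace_eqP; near=> x => _.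
by rewrite (near (scaleP 1 F))// mul1r.
Unshelve. all: by end_near. Qed.

Let scaleDr : right_distributive scale +%R.
Proof.
move=> a F G; apply/Lspace_eqP; near=> x => _.
rewrite (near (scaleP a (add F G)))// (near (addP F G))//.
rewrite (near (addP (scale a F) (scale a G)))//.
by rewrite (near (scaleP a F))// (near (scaleP a G))// mulrDr.
Unshelve. all: by end_near. Qed.

Let scaleDl F : {morph scale^~ F : a b / a + b}.
Proof.
move=> a b; apply/Lspace_eqP; near=> x => _.
rewrite (near (scaleP (a + b) F))// (near (addP (scale a F) (scale b F)))//.
by rewrite (near (scaleP a F))// (near (scaleP b F))// mulrDl.
Unshelve. all: by end_near. Qed.

HB.instance Definition _ :=
  GRing.Zmodule_isLmodule.Build R Lp scaleA scale1 scaleDr scaleDl.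

Let norm (G : Lp) : R := fine ('N[mu]_p[EFin \o (G : T -> R)])%E.

Let norm_class (f : Lf) :
  norm (Lspace_class f) = fine ('N[mu]_p[EFin \o f])%E.
Proof.
congr fine; apply: Lnorm_ae_eq => //; last exact: Lspace_classK.
exact: (@measurable_funPT _ _ _ _ (Lspace_repr (Lspace_class f))).
Qed.

Let norm_add G H : norm (G + H) <= norm G + norm H.
Proof. by rewrite norm_class; exact: ler_LnormD. Qed.

Let norm_scale a G : norm (a *: G) = `|a| * norm G.
Proof.
rewrite norm_class -[RHS]/(`|a| * fine ('N[mu]_p[EFin \o (Lspace_repr G)])%E).
apply: EFin_inj; rewrite EFinM !finite_norm_fine.
exact: LnormZ.
Qed.

Let norm_eq0 G : norm G = 0 -> G = 0.
Proof.
move=> /(@fine_Lnormr_eq0 _ _ _ _ _ p1 (Lspace_repr G)) G0.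
by apply/esym/Lspace_classE/ae_eq_sym.
Qed.

HB.instance Definition _ :=
  Lmodule_isNormed.Build R Lp norm_add norm_scale norm_eq0.

Lemma Lspace_addE (G H : Lp) :
  (G + H : T -> R) = (fun x => (G : T -> R) x + (H : T -> R) x) %[ae mu].
Proof. exact: addP. Qed.

Lemma Lspace_scaleE (a : R) (G : Lp) :
  (a *: G : T -> R) = (fun x => a * (G : T -> R) x) %[ae mu].
Proof. exact: scaleP. Qed.

Lemma Lspace_normE (G : Lp) :
  `|G| = fine ('N[mu]_p[EFin \o (G : T -> R)])%E.
Proof. by []. Qed.

End Lspace_normed.
Section image_measure.
Context d1 d2 (T1 : measurableType d1) (T2 : measurableType d2) (R : realType).
Variables (m : {measure set T1 -> \bar R}) (f : {mfun T1 >-> T2}).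

Definition image_measure : set T2 -> \bar R := pushforward m f.

Let pf : {measure set T2 -> \bar R} :=
  measure_function_pushforward__canonical__measure_function_Measure m
    (@measurable_funPT _ _ _ _ f).

HB.instance Definition _ := isMeasure.Build _ _ _ image_measure
  (measure0 pf) (measure_ge0 pf) (@measure_semi_sigma_additive _ _ _ pf).

End image_measure.

Section image_measure_sigma_finite.
Context d1 d2 (T1 : measurableType d1) (T2 : measurableType d2) (R : realType).
Variables (m : {sigma_finite_measure set T1 -> \bar R}).
Variables (f : {mfun T1 >-> T2}) (g : {mfun T2 >-> T1}).

Lemma image_measure_sigma_finite :
  cancel f g -> sigma_finite setT (image_measure m f).
Proof.
move=> fK; have [F FT Fm] := sigma_finiteT m.
exists (fun k => g @^-1` F k).
  by rewrite -preimage_bigcup -FT preimage_setT.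
move=> k; have [mF mFoo] := Fm k; split.
  by rewrite -[X in measurable X]setTI; exact: measurable_funPT.
rewrite /image_measure /pushforward -comp_preimage.
by rewrite (_ : _ \o _ = id)//; apply/funext => x; exact: fK.
Qed.

End image_measure_sigma_finite.

Section product_sigma_finite_measure.
Context d1 d2 (T1 : measurableType d1) (T2 : measurableType d2) (R : realType).
Variable m1 : {sigma_finite_measure set T1 -> \bar R}.
Variable m2 : {sigma_finite_measure set T2 -> \bar R}.
Local Open Scope ereal_scope.

(* [m1 \x m2], renamed because the library's canonical s-finite structure on
   [\x] is only inferred for finite measures *)
Definition product_sfm : set (T1 * T2) -> \bar R := m1 \x m2.

HB.instance Definition _ := Measure.on product_sfm.

Lemma product_sfm_sigma_finite : sigma_finite setT product_sfm.
Proof.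
have /sigma_finiteP[F [TF ndF Foo]] := sigma_finiteT m1.
have /sigma_finiteP[G [TG ndG Goo]] := sigma_finiteT m2.
exists (fun n => F n `*` G n).
  rewrite -setXTT TF TG predeqE => -[x y]; split.
    move=> [/= [n _ Fnx] [k _ Gky]]; exists (maxn n k) => //; split.
    - by move: x Fnx; exact/subsetPset/ndF/leq_maxl.
    - by move: y Gky; exact/subsetPset/ndG/leq_maxr.
  by move=> [n _ []/= ? ?]; split; exists n.
move=> k; have [? ?] := Foo k; have [? ?] := Goo k.
split; first exact: measurableX.
by rewrite /product_sfm product_measure1E// lte_mul_pinfty// ge0_fin_numE.
Qed.

HB.instance Definition _ := Measure_isSigmaFinite.Build _ _ _ product_sfm
  product_sfm_sigma_finite.

End product_sigma_finite_measure.

Section tuple_measure.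
Context d (T : measurableType d) (R : realType).
Local Open Scope ereal_scope.

Definition cons_tuple n (xs : T * n.-tuple T) : n.+1.-tuple T :=
  [tuple of xs.1 :: xs.2].

Lemma measurable_cons_tuple n : measurable_fun setT (@cons_tuple n).
Proof. exact: measurable_cons. Qed.

HB.instance Definition _ n :=
  isMeasurableFun.Build _ _ _ _ (@cons_tuple n) (@measurable_cons_tuple n).

Definition uncons_tuple n (t : n.+1.-tuple T) : T * n.-tuple T :=
  (thead t, [tuple of behead t]).

Lemma measurable_uncons_tuple n : measurable_fun setT (@uncons_tuple n).
Proof.
apply: measurable_fun_pair; first exact: measurable_tnth.
exact: measurable_behead.
Qed.

HB.instance Definition _ n :=
  isMeasurableFun.Build _ _ _ _ (@uncons_tuple n) (@measurable_uncons_tuple n).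

Lemma cons_tupleK n : cancel (@cons_tuple n) (@uncons_tuple n).
Proof. by case=> x t; congr pair; exact/val_inj. Qed.

Lemma uncons_tupleK n : cancel (@uncons_tuple n) (@cons_tuple n).
Proof. by move=> t; rewrite [RHS]tuple_eta. Qed.

Variable m : {sigma_finite_measure set T -> \bar R}.

Section step.
Variables (n : nat) (mn : {sigma_finite_measure set n.-tuple T -> \bar R}).

Definition tuple_measureS : set (n.+1.-tuple T) -> \bar R :=
  image_measure (product_sfm m mn) (@cons_tuple n).

HB.instance Definition _ := Measure.on tuple_measureS.

Lemma tuple_measureS_sigma_finite : sigma_finite setT tuple_measureS.
Proof.
exact: (@image_measure_sigma_finite _ _ _ _ _ _ _ (@uncons_tuple n) (@cons_tupleK n)).
Qed.

HB.instance Definition _ := Measure_isSigmaFinite.Build _ _ _ tuple_measureS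
  tuple_measureS_sigma_finite.

End step.

Definition tuple_measure0 : set (0.-tuple T) -> \bar R := dirac [tuple].

HB.instance Definition _ := Measure.on tuple_measure0.

Lemma tuple_measure0_sigma_finite : sigma_finite setT tuple_measure0.
Proof.
apply: fin_num_fun_sigma_finite; first by rewrite measure0.
exact: fin_num_measure.
Qed.

HB.instance Definition _ := Measure_isSigmaFinite.Build _ _ _ tuple_measure0
  tuple_measure0_sigma_finite.

Fixpoint tuple_measure n : {sigma_finite_measure set n.-tuple T -> \bar R} :=
  if n is n'.+1 then tuple_measureS (tuple_measure n') else tuple_measure0.

End tuple_measure.

Section lebesgue_measure_rV.
Context (R : realType) (d : nat).

Definition rV_coord (i : 'I_d) (x : 'rV[R]_d) : R := x ord0 i.

Lemma rV_set0 : g_sigma_preimage rV_coord set0.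
Proof. exact: sigma_algebra0. Qed.

Lemma rV_setC A : g_sigma_preimage rV_coord A -> g_sigma_preimage rV_coord (~` A).
Proof. exact: sigma_algebraC. Qed.

Lemma rV_bigcup (F : _^nat) : (forall i, g_sigma_preimage rV_coord (F i)) ->
  g_sigma_preimage rV_coord (\bigcup_i (F i)).
Proof. exact: sigma_algebra_bigcup. Qed.

HB.instance Definition _ := @isMeasurable.Build default_measure_display 'rV[R]_d
  (g_sigma_preimage rV_coord) rV_set0 rV_setC rV_bigcup.

Lemma measurable_coord i : measurable_fun [set: 'rV[R]_d] (fun x => x ord0 i).
Proof.
move=> _ Y mY; rewrite setTI; apply: sub_sigma_algebra => /=.
rewrite -bigcup_seq/=; exists i => /=; first by rewrite mem_index_enum.
by exists Y => //; rewrite setTI.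
Qed.

Definition row_of_tuple (t : d.-tuple (measurableTypeR R)) : 'rV[R]_d := \row_i tnth t i.

Lemma measurable_row_of_tuple : measurable_fun setT row_of_tuple.
Proof.
move=> _ A mA; rewrite setTI; move: A mA; apply: smallest_sub.
  split => [|A|F] /=; first by rewrite preimage_set0.
  - by rewrite setTD preimage_setC; exact: measurableC.
  - by rewrite preimage_bigcup => mF; exact: bigcupT_measurable.
move=> A; rewrite -bigcup_seq => -[i _ [B mB <-]]; rewrite setTI.
rewrite [X in measurable X](_ : _ = (@tnth _ (measurableTypeR R) ^~ i) @^-1` B).
  by rewrite -[X in measurable X]setTI; exact: measurable_tnth.
by apply/seteqP; split=> x /=; rewrite /rV_coord mxE.
Qed.

HB.instance Definition _ :=
  isMeasurableFun.Build _ _ _ _ row_of_tuple measurable_row_of_tuple.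

Definition tuple_of_row (x : 'rV[R]_d) : d.-tuple (measurableTypeR R) :=
  [tuple x ord0 i | i < d].

Lemma measurable_tuple_of_row : measurable_fun setT tuple_of_row.
Proof.
apply/measurable_fun_tnthP => i.
rewrite (_ : _ \o _ = fun x : 'rV[R]_d => x ord0 i); first exact: measurable_coord.
by apply/funext => x /=; rewrite tnth_mktuple.
Qed.

HB.instance Definition _ :=
  isMeasurableFun.Build _ _ _ _ tuple_of_row measurable_tuple_of_row.

Lemma row_of_tupleK : cancel row_of_tuple tuple_of_row.
Proof. by move=> t; apply/eq_from_tnth => i; rewrite tnth_mktuple mxE. Qed.

(* The product structures above are on tuples; rows are used for points of
   R^d because they form a vector space. *)
Definition lebesgue_rV : set 'rV[R]_d -> \bar R :=
  image_measure (tuple_measure (@lebesgue_measure R) d) row_of_tuple.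

HB.instance Definition _ := Measure.on lebesgue_rV.

Lemma lebesgue_rV_sigma_finite : sigma_finite setT lebesgue_rV.
Proof. exact: (image_measure_sigma_finite _ row_of_tupleK). Qed.

HB.instance Definition _ := Measure_isSigmaFinite.Build _ _ _ lebesgue_rV
  lebesgue_rV_sigma_finite.

End lebesgue_measure_rV.
Arguments lebesgue_rV {R d}.

Section configurations.
Context (R : realType) (d : nat).

Definition Gamma0 : Type := {fset 'rV[R]_d}.
HB.instance Definition _ := Choice.on Gamma0.
HB.instance Definition _ := isPointed.Build Gamma0 fset0%fset.

(* Defined on all n-tuples, also those with repeated points, which form a null
   set when [0 < d]. *)
Definition config n (x : n.-tuple 'rV[R]_d) : Gamma0 := [fset y in tval x]%fset.

(* The Borel sigma-algebra of Gamma_0, i.e. of the disjoint union of the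
   symmetrizations of {x in (R^d)^n | the x_i are distinct}. Testing on all
   tuples is equivalent to testing on those with distinct entries: the tuples
   with a given pattern of repetitions form a measurable set, on which [config]
   is the composition of a coordinate projection and of [config] on the tuples
   with k < n distinct entries. *)
Definition Gamma0_measurable : set (set Gamma0) :=
  [set A | forall n, measurable (@config n @^-1` A)].

HB.instance Definition _ := @isMeasurable.Build default_measure_display Gamma0
  Gamma0_measurable
  (fun n => measurable0)
  (fun A mA n => measurableC (mA n))
  (fun F mF n => bigcupT_measurable _ (fun k => mF k n)).

Lemma measurable_config n : measurable_fun setT (@config n).
Proof. by move=> _ A mA; rewrite setTI; exact: mA. Qed.

HB.instance Definition _ n :=
  isMeasurableFun.Build _ _ _ _ (@config n) (@measurable_config n).

(* For [n = 0] the summand is the Dirac measure at the empty configuration. *)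
Definition lebesgue_poisson : set Gamma0 -> \bar R :=
  mseries (fun n => mscale ((n`!%:R)^-1)%:nng
    (image_measure (tuple_measure lebesgue_rV n) (@config n))) 0.

HB.instance Definition _ := Measure.on lebesgue_poisson.

Lemma card_config n (x : n.-tuple 'rV[R]_d) : #|` config x| = size (undup x).
Proof.
apply/perm_size/uniq_perm; rewrite ?fset_uniq ?undup_uniq// => y.
by rewrite !inE mem_undup.
Qed.

Lemma measurable_eq_coord n (i j : 'I_n) :
  measurable [set x : n.-tuple 'rV[R]_d | tnth x i = tnth x j].
Proof.
rewrite [X in measurable X](_ : _ = \bigcap_(k in [set: 'I_d])
    [set x : n.-tuple 'rV[R]_d | tnth x i ord0 k = tnth x j ord0 k]).
  apply: fin_bigcap_measurable => // k _.
  have mk l : measurable_fun [set: n.-tuple 'rV[R]_d]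
      (fun x => tnth x l ord0 k : R).
    apply: (measurableT_comp (measurable_coord k)).
    exact: (@measurable_tnth _ 'rV[R]_d).
  have := measurable_fun_eqr (mk i) (mk j).
  move=> /(_ measurableT [set true] I); rewrite setTI.
  congr measurable; apply/seteqP; split=> x /=; first by move/eqP.
  by move=> ->; exact: eqxx.
apply/seteqP; split=> [x /= xij k _ /=|x /= xij]; first by rewrite xij.
by apply/rowP => k; exact: xij.
Qed.

Lemma measurable_size_undup n : measurable_fun [set: n.-tuple 'rV[R]_d]
  (fun x => (size (undup x))%:R : R).
Proof.
elim: n => [|n IH].
  by rewrite (_ : (fun _ => _) = cst 0)//; apply/funext => x; rewrite (tuple0 x).
pose D := [set x : n.+1.-tuple 'rV[R]_d | thead x \in behead x].
have mD : measurable D.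
  rewrite (_ : D = \bigcup_(i in [set: 'I_n])
     [set x : n.+1.-tuple 'rV[R]_d | tnth x ord0 = tnth x (lift ord0 i)]).
    apply: fin_bigcup_measurable => // i _; exact: measurable_eq_coord.
  apply/seteqP; split=> x; rewrite /D /=.
    move=> /(@tnthP _ _ [tuple of behead x])[i xi]; exists i => //=.
    by rewrite [in RHS](tuple_eta x) tnthS -xi.
  move=> [i _ /= xi]; apply/(@tnthP _ _ [tuple of behead x]); exists i.
  by rewrite /thead xi [in LHS](tuple_eta x) tnthS.
have -> : (fun x : n.+1.-tuple 'rV[R]_d => (size (undup x))%:R : R) =
    (fun x : n.+1.-tuple 'rV[R]_d => \1_(~` D) x + (size (undup [tuple of behead x]))%:R).
  apply/funext => x; rewrite indicE.
  rewrite {1}(tuple_eta x) /=.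
  case: ifP => xD.
    by rewrite memNset ?add0r//= => /(_ xD).
  by rewrite mem_set /= ?xD ?natr1 1?addrC ?natr1//; rewrite /D /= xD.
apply: measurable_funD; first exact/measurable_indic/measurableC.
by apply: (measurableT_comp IH); exact: measurable_behead.
Qed.

Lemma measurable_card (g : nat -> R) :
  measurable_fun [set: Gamma0] (fun eta => g #|` eta|).
Proof.
move=> _ Y mY; rewrite setTI.
suff : Gamma0_measurable ((fun eta : Gamma0 => g #|` eta|) @^-1` Y) by [].
move=> n; rewrite -comp_preimage.
rewrite [X in measurable X](_ : _ = \bigcup_(k in [set k | Y (g k)])
  ((fun x : n.-tuple 'rV[R]_d => (size (undup x))%:R : R) @^-1` [set k%:R])).
  apply: bigcup_measurable => k _; rewrite -[X in measurable X]setTI.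
  exact: measurable_size_undup.
apply/seteqP; split=> x /=; rewrite card_config.
  by move=> Yx; exists (size (undup x)).
by move=> [k /= Yk /eqP]; rewrite eqr_nat => /eqP ->.
Qed.

(* the measure c^|eta| lambda(d eta) *)
Definition lebesgue_poisson_weight (c : {posnum R}) (A : set Gamma0) : \bar R :=
  (\int[lebesgue_poisson]_(eta in A) (c%:num ^+ #|` eta|)%:E)%E.

Section weight.
Variable c : {posnum R}.
Lemma lebesgue_poisson_weight0 :
  lebesgue_poisson_weight c set0 = 0%E.
Proof. exact: integral_set0. Qed.
Lemma lebesgue_poisson_weight_ge0 A :
  (0 <= lebesgue_poisson_weight c A)%E.
Proof. by apply: integral_ge0 => eta _; rewrite lee_fin exprn_ge0. Qed.
Lemma lebesgue_poisson_weight_sigma_additive :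
  semi_sigma_additive (lebesgue_poisson_weight c).
Proof.
apply: semi_sigma_additive_nng_induced => [|eta].
  by apply/measurable_EFinP; exact: measurable_card.
by rewrite lee_fin exprn_ge0.
Qed.
HB.instance Definition _ := isMeasure.Build _ _ _ (lebesgue_poisson_weight c)
  lebesgue_poisson_weight0 lebesgue_poisson_weight_ge0
  lebesgue_poisson_weight_sigma_additive.
End weight.

End configurations.
Arguments lebesgue_poisson : clear implicits.
Arguments lebesgue_poisson_weight : clear implicits.

Section unbounded_operators.
Context (R : realType) (X : normedModType R).
Implicit Types (A : set (X * X)) (T : R -> X -> X).

(* An unbounded linear operator is represented by its graph, so that inclusion
   is extension and the closure of an operator is the topological closure. *)
Definition is_linear_operator A :=
  [/\ A (0, 0),
      forall a x y x' y', A (x, y) -> A (x', y') ->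
        A (a *: x + x', a *: y + y')
    & forall x y y', A (x, y) -> A (x, y') -> y = y'].

Definition operator_domain A : set X := [set x | exists y, A (x, y)].

Definition closable A := is_linear_operator (closure A).

(* The values of [T] at negative times are irrelevant. *)
Definition is_C0_semigroup T :=
  [/\ forall t, 0 <= t -> linear (T t) /\ continuous (T t),
      forall x, T 0 x = x,
      forall s t x, 0 <= s -> 0 <= t -> T (s + t) x = T s (T t x)
    & forall x, T t x @[t --> 0^'+] --> x].

Definition is_C0_contraction_semigroup T :=
  is_C0_semigroup T /\ forall t x, 0 <= t -> `|T t x| <= `|x|.

Definition generator T : set (X * X) :=
  [set xy | h^-1 *: (T h xy.1 - xy.1) @[h --> 0^'+] --> xy.2].

End unbounded_operators.

Section Lhat.
Context (R : realType) (d : nat).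
Local Notation rV := 'rV[R]_d.
Local Notation Gamma0 := (Gamma0 R d).
Implicit Types (phi : rV -> R) (x : rV) (xi eta : Gamma0).

Definition Lc (C : {posnum R}) := LspaceType1 (lebesgue_poisson_weight R d C).

HB.instance Definition _ C := NormedModule.on (Lc C).

(* L_(2C) as a subspace of L_C; the two weighted measures have the same null
   sets. *)
Definition L2C (C : {posnum R}) : set (Lc C) :=
  [set G | (G : Gamma0 -> R) \in
             Lfun (lebesgue_poisson_weight R d (2 * C%:num)%:pos) 1].

(* The potential is a function on R^d minus the origin; its value at 0 is junk
   which only enters integrals over x through the null sets {x = 0} and
   {x in eta}. *)
Definition Cphi phi : \bar R := (\int[lebesgue_rV]_x (1 - expR (- phi x))%:E)%E.

Definition Ephi phi x xi : R := \sum_(y <- xi) phi (x - y).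

Definition e_lambda (f : rV -> R) eta : R := \prod_(x <- eta) f x.

Definition Lhat_integrand phi (G : Gamma0 -> R) eta xi x : R :=
  expR (- Ephi phi x xi) * G (x |` xi)%fset *
  e_lambda (fun y => expR (- phi (x - y)) - 1) (eta `\` xi)%fset.

Definition Lhat_formula phi (z : R) (G : Gamma0 -> R) eta : R :=
  - (#|` eta|%:R * G eta) +
  z * \sum_(xi <- fpowerset eta)
        (\int[lebesgue_rV]_x Lhat_integrand phi G eta xi x)%R.

(* The formula is applied to the chosen representative of [GF.1]; changing it
   on a null set alters the right-hand side on a null set only. The real-valued
   integral is 0 by convention on non-integrable functions, hence the explicit
   integrability requirement. *)
Definition Lhat phi z (C : {posnum R}) : set (Lc C * Lc C) :=
  [set GF : Lc C * Lc C | L2C GF.1 /\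
    {ae lebesgue_poisson R d, forall eta : Gamma0,
      (forall xi : Gamma0, (xi `<=` eta)%fset ->
         lebesgue_rV.-integrable setT
           (fun x => (Lhat_integrand phi GF.1 eta xi x)%:E)) /\
      (GF.2 : Gamma0 -> R) eta = Lhat_formula phi z GF.1 eta}].

End Lhat.
Arguments Lc {R} d C.
Arguments L2C {R} d C.
Arguments Cphi {R d} phi.
Arguments Lhat {R d} phi z C.

(* Main.v *)
(** Write L = -A + B, where A multiplies by |eta|. The Mayer factors split off
    of an integral over Gamma_0 as in the expansion of an exponential, so that
    ||B G||_c <= (z e^(c Cphi) / c) ||A G||_c, and the hypothesis on z makes B
    an A-contraction for both c = C and c = 2C.

    For c = C this gives dissipativity: ||(1 + h A) G - h B G|| >= ||G||. For
    c = 2C it gives dense range: K = h B (1 + h A)^-1 satisfies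
    ||K f|| + ||(1 + h A)^-1 f|| <= ||f|| in L_(2C), so the terms
    (1 + h A)^-1 K^n f tend to 0 in L_(2C), hence K^n f -> 0 in L_C because
    1 + h n <= (1 + h) 2^n, while f - K^n f is in the range of 1 - h L.

    The semigroup is the limit of J_(t/n)^n along n = 2^k, J_h being the
    resolvent (1 - h L)^-1. All estimates come from
    ||P^n x - Q^n x|| <= n ||P x - Q x|| for commuting contractions P, Q and
    ||J_(h+k) x - J_h J_k x|| <= h k ||L^2 x||. *)
From HB Require Import structures.
Require Import Defs.
From mathcomp Require Import all_boot all_order all_algebra finmap.
From mathcomp Require Import all_classical all_reals all_analysis.
From mathcomp Require Import measurable_realfun ring lra.

Import Order.TTheory GRing.Theory Num.Theory numFieldNormedType.Exports.

Local Open Scope classical_set_scope.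
Local Open Scope ring_scope.

Set Implicit Arguments.
Unset Strict Implicit.
Unset Printing Implicit Defensive.

(** The hypothesis on [z] allows the relative bound of [B] to be exactly 1, so neither a
    perturbation theorem for small bounds nor geometric decay of a Neumann series is available. They
    are replaced by the additivity of the [L^1] norm on nonnegative functions: what [K] takes away
    from the norm of [f] reappears as a separate summand, and along the iteration these summands
    have a finite total.

    The other obstacle is integrability. [Lhat] is written with real integrals, which are 0 by
    default on nonintegrable functions, and its kernel changes sign. The Mayer factors
    [expR (- phi) - 1] are nonpositive, so conjugation by [(-1) ^ |eta|] leaves minus a nonnegative
    kernel. Measurability and the bound are proved for that kernel with values in [[0, +oo]], where
    Tonelli needs no proviso. The bound itself then makes the integrals finite for almost every
    [eta], and the real formula is recovered from two nonnegative parts. *)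

(* A reflexive decision procedure [lmod] for linear identities between vectors
   with coefficients in a commutative ring. *)
Inductive lexpr (K : Type) :=
  LVar of nat | LZero | LAdd of lexpr K & lexpr K | LOpp of lexpr K
| LScale of K & lexpr K.
Arguments LVar {K}.
Arguments LZero {K}.

Section LinearReflection.
Context (K : comNzRingType) (V : lmodType K).

Fixpoint leval (s : seq V) (e : lexpr K) : V :=
  match e with
  | LVar i => s`_i | LZero => 0 | LAdd a b => leval s a + leval s b
  | LOpp a => - leval s a | LScale k a => k *: leval s a end.

Fixpoint lcoef (e : lexpr K) (j : nat) : K :=
  match e with
  | LVar i => if i == j then 1 else 0 | LZero => 0
  | LAdd a b => lcoef a j + lcoef b j
  | LOpp a => - lcoef a j | LScale k a => k * lcoef a j end.

Lemma levalE s e : leval s e = \sum_(j < size s) lcoef e j *: s`_j.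
Proof.
elim: e => [i||a IHa b IHb|a IHa|k a IHa] /=.
- have [si|si] := leqP (size s) i.
    rewrite nth_default// big1// => j _; case: eqP => [ij|]; rewrite ?scale0r//.
    by move: (ltn_ord j); rewrite -ij ltnNge si.
  rewrite (bigD1 (Ordinal si))//= eqxx scale1r big1 ?addr0// => j /eqP ji.
  by case: eqP => [ij|]; rewrite ?scale0r//; case: ji; apply/val_inj.
- by rewrite big1// => j _; rewrite scale0r.
- by rewrite IHa IHb -big_split; apply: eq_bigr => j _; rewrite scalerDl.
- by rewrite IHa -sumrN; apply: eq_bigr => j _; rewrite scaleNr.
- by rewrite IHa scaler_sumr; apply: eq_bigr => j _; rewrite scalerA.
Qed.

(** The [foldr] over [iota] computes to a finite conjunction with one scalar identity for each
    vector variable, which [ring] or [field] can prove one by one. *)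
Lemma leval_eq s e e' :
  foldr (fun j P => lcoef e j = lcoef e' j /\ P) True (iota 0 (size s)) ->
  leval s e = leval s e'.
Proof.
move=> H; rewrite !levalE; apply: eq_bigr => -[j /= js] _.
have : j \in iota 0 (size s) by rewrite mem_iota.
by elim: (iota _ _) H => //= k t IH [kk /IH {}IH]; rewrite inE => /predU1P[->|/IH->//];
  rewrite kk.
Qed.

End LinearReflection.

Ltac lmod_mem v s :=
  lazymatch s with
  | nil => constr:(false)
  | v :: _ => constr:(true)
  | _ :: ?s' => lmod_mem v s'
  end.
Ltac lmod_index v s :=
  lazymatch s with
  | v :: _ => constr:(0%N)
  | _ :: ?s' => let i := lmod_index v s' in constr:(i.+1)
  end.
Ltac lmod_vars t s :=
  lazymatch t with
  | (?a + ?b)%R => let s := lmod_vars a s in lmod_vars b s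
  | (- ?a)%R => lmod_vars a s
  | (_ *: ?a)%R => lmod_vars a s
  | 0%R => s
  | _ => lazymatch lmod_mem t s with true => s | false => constr:(t :: s) end
  end.
Ltac lmod_reify K t s :=
  lazymatch t with
  | (?a + ?b)%R =>
      let a := lmod_reify K a s in let b := lmod_reify K b s in constr:(LAdd a b)
  | (- ?a)%R => let a := lmod_reify K a s in constr:(LOpp a)
  | (?k *: ?a)%R => let a := lmod_reify K a s in constr:(@LScale K k a)
  | 0%R => constr:(@LZero K)
  | _ => let i := lmod_index t s in constr:(@LVar K i)
  end.
Ltac lmod_with K V tac :=
  lazymatch goal with |- ?a = ?b =>
    let s := lmod_vars a (@nil V) in let s := lmod_vars b s in
    let ea := lmod_reify K a s in let eb := lmod_reify K b s in
    change (@leval K V s ea = @leval K V s eb);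
    apply: leval_eq; rewrite /=; do ?[split; first by tac]; exact: I
  end.

(** * Generation of contraction semigroups by closures of dissipative graphs *)

Section HilleYosida.
Context (R : realType) (X : normedModType R).
Implicit Types (x y z u v w f : X) (h k t s e : R).

Local Ltac lmod := lmod_with R X ltac:(ring).

Lemma closure_pairP (A : set (X * X)) x y :
  closure A (x, y) <-> forall e, 0 < e ->
    exists u v, [/\ A (u, v), `|x - u| < e & `|y - v| < e].
Proof.
split=> [Axy e e0|H B].
  have /Axy[[u v] [Auv [xu yv]]] : nbhs (x, y) (ball (x, y) e) by exact: nbhsx_ballx.
  by exists u, v; split => //; move: xu yv => /=; rewrite -!ball_normE.
move=> /nbhs_ballP[e /= e0 eB]; have [u [v [Auv xu yv]]] := H e e0.
by exists (u, v); split=> //; apply: eB; split => /=; rewrite -ball_normE.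
Qed.

Lemma near0r_lt (d : R) : 0 < d -> \forall h \near (0 : R)^'+, 0 < h < d.
Proof.
move=> d0; near=> h; apply/andP; split; near: h; first exact: nbhs_right_gt.
exact: nbhs_right_lt.
Unshelve. all: by end_near. Qed.

Lemma cvg_at0rP (f : R -> X) l : (f h @[h --> 0^'+] --> l) <->
  forall e, 0 < e -> exists2 d : R, 0 < d & forall h, 0 < h < d -> `|l - f h| <= e.
Proof.
split=> [/cvgrPdist_le fl e e0|H].
  have := fl _ e0; rewrite near_withinE => /nbhs_ballP[d /= d0 dP].
  exists d => // h /andP[h0 hd]; apply: dP => //.
  by rewrite -ball_normE /= sub0r normrN gtr0_norm.
apply/cvgrPdist_le => e /H [d d0 dP]; near=> h; apply: dP.
by near: h; exact: near0r_lt.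
Unshelve. all: by end_near. Qed.

Lemma cvgn_dist_lt (u : nat -> X) l : u n @[n --> \oo] --> l ->
  forall e, 0 < e -> exists N, forall n, (N <= n)%N -> `|l - u n| < e.
Proof. by move=> /cvgrPdist_lt ul e /ul[N _ NP]; exists N => n /NP. Qed.

Lemma cvgn_norm_le (u : nat -> X) l a b : u n @[n --> \oo] --> l ->
  (forall n, `|u n - a| <= b) -> `|l - a| <= b.
Proof.
move=> ul ub; apply/ler_addgt0Pr => e e0; have [N NP] := cvgn_dist_lt ul e0.
rewrite -(subrKA (u N)) (le_trans (ler_normD _ _))// addrC lerD//.
exact: ltW (NP _ (leqnn _)).
Qed.

(** Telescoping. Commutation turns the defect [P (Q x) - Q (Q x)] at a shifted point into
    [Q (P x) - Q (Q x)], so each of the [n] defects is bounded by the one at [x] itself. *)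
Lemma iter_commute_lip (P Q : X -> X) :
  (forall x y, `|P x - P y| <= `|x - y|) -> (forall x y, `|Q x - Q y| <= `|x - y|) ->
  (forall x, P (Q x) = Q (P x)) ->
  forall n x, `|iter n P x - iter n Q x| <= n%:R * `|P x - Q x|.
Proof.
move=> cP cQ PQ; elim=> [|n IH] x; first by rewrite subrr normr0 mul0r.
rewrite !iterSr -(subrKA (iter n P (Q x))) (le_trans (ler_normD _ _))//.
rewrite -natr1 mulrDl mul1r addrC lerD//.
  by rewrite (le_trans (IH _))// ler_wpM2l// PQ.
elim: n {IH} (P x) (Q x) => [//|n IH] a b.
by rewrite !iterSr (le_trans (IH _ _)).
Qed.

Variable A : set (X * X).
Hypothesis A0 : A (0, 0).
Hypothesis AL : forall a x y x' y', A (x, y) -> A (x', y') ->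
  A (a *: x + x', a *: y + y').
Hypothesis Adis : forall h x y, 0 < h -> A (x, y) -> `|x| <= `|x - h *: y|.
Hypothesis Adens : forall x e, 0 < e -> exists u v, A (u, v) /\ `|x - u| < e.
Hypothesis Arange : forall h f e, 0 < h -> 0 < e ->
  exists u v, A (u, v) /\ `|u - h *: v - f| < e.
Hypothesis Xcomplete : forall u : nat -> X,
  (forall e, 0 < e -> exists N, forall m n, (N <= m)%N -> (N <= n)%N -> `|u m - u n| <= e) ->
  exists l : X, u n @[n --> \oo] --> l.

Let B := closure A.

Let BL a x y x' y' : B (x, y) -> B (x', y') -> B (a *: x + x', a *: y + y').
Proof.
move=> /closure_pairP H /closure_pairP H'; apply/closure_pairP => e e0.
pose d := e / (`|a| + 1); have a1 : 0 < `|a| + 1 by rewrite ltr_wpDl.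
have d0 : 0 < d / 2 by rewrite !divr_gt0.
have e20 : 0 < e / 2 by rewrite divr_gt0.
have [u [v [Auv xu yv]]] := H _ d0.
have [u' [v' [Auv' xu' yv']]] := H' _ e20.
exists (a *: u + u'), (a *: v + v'); split; first exact: AL.
- have -> : a *: x + x' - (a *: u + u') = a *: (x - u) + (x' - u').
    by lmod.
  rewrite (le_lt_trans (ler_normD _ _))// normrZ.
  have : `|a| * `|x - u| <= (`|a| + 1) * (d / 2).
    by apply: ler_pM => //; [rewrite lerDl|exact: ltW].
  have -> : (`|a| + 1) * (d / 2) = e / 2 by rewrite /d; field; rewrite gt_eqF.
  by lra.
- have -> : a *: y + y' - (a *: v + v') = a *: (y - v) + (y' - v').
    by lmod.
  rewrite (le_lt_trans (ler_normD _ _))// normrZ.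
  have : `|a| * `|y - v| <= (`|a| + 1) * (d / 2).
    by apply: ler_pM => //; [rewrite lerDl|exact: ltW].
  have -> : (`|a| + 1) * (d / 2) = e / 2 by rewrite /d; field; rewrite gt_eqF.
  by lra.
Qed.

Arguments BL a {x y x' y'} _ _.

Let B0 : B (0, 0).
Proof. exact: subset_closure. Qed.

Let BB x y x' y' : B (x, y) -> B (x', y') -> B (x - x', y - y').
Proof.
by move=> H H'; have := BL (-1) H' H; rewrite !scaleN1r addrC [X in (_, X)]addrC.
Qed.

Let Bclosed x y : (forall e, 0 < e ->
    exists u v, [/\ B (u, v), `|x - u| < e & `|y - v| < e]) -> B (x, y).
Proof.
move=> H; apply/closure_pairP => e e0; have e20 : 0 < e / 2 by rewrite divr_gt0.
have [u [v [/closure_pairP/(_ _ e20)[u' [v' [Auv uu vv]]] xu yv]]] := H _ e20.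
exists u', v'; split=> //.
- rewrite -(subrKA u) (le_lt_trans (ler_normD _ _))//; lra.
- rewrite -(subrKA v) (le_lt_trans (ler_normD _ _))//; lra.
Qed.

Let Bdis h x y : 0 <= h -> B (x, y) -> `|x| <= `|x - h *: y|.
Proof.
rewrite le_eqVlt => /predU1P[<- _|h0]; first by rewrite scale0r subr0.
move=> /closure_pairP H; apply/ler_addgt0Pr => e e0.
(* In the final sum the error [|x - u|] enters twice and [|y - v|] once, with the factor [h]. *)
pose d := e / (2 + h); have h2 : 0 < 2 + h by lra.
have d0 : 0 < d by rewrite divr_gt0.
have [u [v [Auv xu yv]]] := H _ d0.
have := Adis h0 Auv.
have : `|x| <= `|u| + `|x - u|.
  by rewrite -[X in `|X|](subrK u) addrC ler_normD.
have : `|u - h *: v| <= `|x - h *: y| + (`|x - u| + h * `|y - v|).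
  have -> : u - h *: v = (x - h *: y) - ((x - u) - h *: (y - v)).
    by lmod.
  apply: (le_trans (ler_normB _ _)); rewrite lerD2l.
  by apply: (le_trans (ler_normB _ _)); rewrite normrZ gtr0_norm.
have : h * `|y - v| <= h * d by rewrite ler_pM2l// ltW.
have : (2 + h) * d = e by rewrite /d; field; rewrite gt_eqF.
by lra.
Qed.

(* Single-valuedness: testing dissipativity on [(u + h^-1 y, ...)] as [h -> 0]
   gives [|u| <= |u - y|] for all [u] in the dense domain. *)
Let Bzero y : B (0, y) -> y = 0.
Proof.
move=> B0y; have Hu u v : A (u, v) -> `|u| <= `|u - y|.
  move=> Auv; apply/ler_addgt0Pr => e e0.
  pose h := e / (`|v| + 1); have v1 : 0 < `|v| + 1 by rewrite ltr_wpDl.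
  have h0 : 0 < h by rewrite divr_gt0.
  have := Bdis (ltW h0) (BL h^-1 B0y (subset_closure Auv)).
  rewrite scaler0 add0r scalerDr scalerA mulfV ?gt_eqF// scale1r opprD addrA.
  move=> /le_trans; apply; rewrite (le_trans (ler_normB _ _))// lerD2l.
  rewrite normrZ gtr0_norm//.
  have -> : e = h * (`|v| + 1) by rewrite /h; field; rewrite gt_eqF.
  by rewrite ler_pM2l// lerDl.
apply/eqP; rewrite -normr_eq0; apply/eqP/le_anti; rewrite normr_ge0 andbT.
apply/ler_addgt0Pr => e e0; have e20 : 0 < e / 2 by rewrite divr_gt0.
have [u [v [Auv yu]]] := Adens y e20.
have := Hu _ _ Auv; rewrite -(distrC y u).
have : `|y| <= `|u| + `|y - u| by rewrite -[X in `|X|](subrK u) addrC ler_normD.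
lra.
Qed.

Lemma is_linear_operator_closure : is_linear_operator (closure A).
Proof.
split; [exact: B0|by move=> a x y x' y'; exact: BL|move=> x y y' H H'].
apply/eqP; rewrite -subr_eq0; apply/eqP/Bzero.
by have := BB H H'; rewrite subrr.
Qed.

(** Dissipativity, applied to differences, makes approximate solutions of [x - h y = f] Cauchy in
    [x], and the equation then makes [y] converge too. Writing [y] as [h^-1 *: (x - f)] leaves a
    single unknown, so that the resolvent can be chosen by [xget]. *)
Let resolvent_ex h f : 0 < h -> exists x, B (x, h^-1 *: (x - f)).
Proof.
move=> h0.
have /choice[p pP] : forall n : nat, exists p : X * X,
    A p /\ `|p.1 - h *: p.2 - f| < n.+1%:R^-1.
  move=> n; have [|u [v [Auv uv]]] := Arange (e := n.+1%:R^-1) f h0.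
    by rewrite invr_gt0 ltr0Sn.
  by exists (u, v).
have pd m n : `|(p m).1 - (p n).1| <= m.+1%:R^-1 + n.+1%:R^-1.
  have [Am pm] := pP m; have [An pn] := pP n.
  have Bm : B ((p m).1, (p m).2) by apply: subset_closure; rewrite -surjective_pairing.
  have Bn : B ((p n).1, (p n).2) by apply: subset_closure; rewrite -surjective_pairing.
  apply: (le_trans (Bdis (ltW h0) (BB Bm Bn))).
  have -> : (p m).1 - (p n).1 - h *: ((p m).2 - (p n).2) =
    ((p m).1 - h *: (p m).2 - f) - ((p n).1 - h *: (p n).2 - f) by lmod.
  by rewrite (le_trans (ler_normB _ _))// lerD// ltW.
have small e : 0 < e -> exists N, forall m, (N <= m)%N -> m.+1%:R^-1 < e :> R.
  move=> e0; have /cvgrPdist_lt/(_ e e0)[N _ NP] := @cvg_harmonic R.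
  by exists N => m /NP; rewrite /= sub0r normrN gtr0_norm// invr_gt0 ltr0Sn.
have [x px] : exists x, (p n).1 @[n --> \oo] --> x.
  apply: Xcomplete => e e0; have e20 : 0 < e / 2 by rewrite divr_gt0.
  have [N NP] := small _ e20; exists N => m n /NP + /NP; have := pd m n.
  by set a := _.+1%:R^-1; set b := _.+1%:R^-1; lra.
exists x; apply: Bclosed => e e0.
(* The bound [e h / 2] serves the second component, whose error is a sum of two terms below [d],
   divided by [h]. *)
pose d := Num.min e (e * h / 2).
have d0 : 0 < d by rewrite lt_min e0 divr_gt0// mulr_gt0.
have [N1 N1P] := cvgn_dist_lt px d0.
have [N2 N2P] := small _ d0.
pose n := maxn N1 N2; exists (p n).1, (p n).2; have [An pn] := pP n.
have := N1P n (leq_maxl _ _); have := N2P n (leq_maxr _ _) => nd xd.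
split.
- by apply: subset_closure; rewrite -surjective_pairing.
- by apply: lt_le_trans xd _; rewrite ge_min lexx.
- have -> : h^-1 *: (x - f) - (p n).2 =
     h^-1 *: ((x - (p n).1) + ((p n).1 - h *: (p n).2 - f)).
    by lmod_with R X ltac:(field; rewrite gt_eqF).
  rewrite normrZ gtr0_norm ?invr_gt0// mulrC ltr_pdivrMr//.
  apply: le_lt_trans (ler_normD _ _) _.
  have : d <= e * h / 2 by rewrite ge_min lexx orbT.
  move: xd pn nd; rewrite /=; set a := n.+1%:R^-1; clearbody a d n; lra.
Qed.

(** The value [f] at [h = 0] is the limit of the resolvents as [h -> 0], so the laws below hold for
    all [0 <= h], and time 0 needs no separate construction. *)
Let J h f := if 0 < h then xget f [set x | B (x, h^-1 *: (x - f))] else f.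

Let JB h f : 0 < h -> B (J h f, h^-1 *: (J h f - f)).
Proof.
move=> h0; rewrite /J h0; case: xgetP => [x _ //|] H.
by have [x /H] := resolvent_ex f h0.
Qed.

Arguments JB {h} f _.

(** Dissipativity gives uniqueness of the resolvent equation. The algebraic laws of [J] rest on
    this: a point of the graph is exhibited that solves the equation. *)
Let JK h x y : 0 <= h -> B (x, y) -> J h (x - h *: y) = x.
Proof.
rewrite le_eqVlt => /predU1P[<- _|h0 Bxy].
  by rewrite scale0r subr0 /J ltxx.
have := BB (JB (x - h *: y) h0) Bxy; set u := J _ _ => Buv.
apply/eqP; rewrite -subr_eq0 -normr_eq0; apply/eqP/le_anti.
rewrite normr_ge0 andbT (le_trans (Bdis (ltW h0) Buv))//.
have -> : u - x - h *: (h^-1 *: (u - (x - h *: y)) - y) = 0.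
  by lmod_with R X ltac:(field; rewrite ?gt_eqF).
by rewrite normr0.
Qed.

Let Jlin h a f g : 0 <= h -> J h (a *: f + g) = a *: J h f + J h g.
Proof.
rewrite le_eqVlt => /predU1P[<-|h0]; first by rewrite /J ltxx.
rewrite -(JK (ltW h0) (BL a (JB f h0) (JB g h0))); congr (J h _).
by lmod_with R X ltac:(field; rewrite ?gt_eqF).
Qed.

Let JD h f g : 0 <= h -> J h (f + g) = J h f + J h g.
Proof. by move=> h0; have := Jlin 1 f g h0; rewrite !scale1r. Qed.

Let JZ h a f : 0 <= h -> J h (a *: f) = a *: J h f.
Proof.
move=> h0; have J0 : J h 0 = 0.
  by have := JK h0 B0; rewrite scaler0 subr0.
by have := Jlin a f 0 h0; rewrite J0 !addr0.
Qed.

Let Jsub h f g : 0 <= h -> J h (f - g) = J h f - J h g.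
Proof. by move=> h0; rewrite JD// -scaleN1r JZ// scaleN1r. Qed.

Let Jle h f : 0 <= h -> `|J h f| <= `|f|.
Proof.
rewrite le_eqVlt => /predU1P[<-|h0]; first by rewrite /J ltxx.
apply: (le_trans (Bdis (ltW h0) (JB f h0))).
rewrite le_eqVlt; apply/orP; left; apply/eqP; congr `|_|.
by lmod_with R X ltac:(field; rewrite ?gt_eqF).
Qed.

Let Jcontr h f g : 0 <= h -> `|J h f - J h g| <= `|f - g|.
Proof. by move=> h0; rewrite -Jsub// Jle. Qed.

Let JBB h x y : 0 <= h -> B (x, y) -> B (J h x, J h y).
Proof.
rewrite le_eqVlt => /predU1P[<-|h0 Bxy]; first by rewrite /J ltxx.
have Bv := JB y h0; set v := J h y in Bv *.
have := BL h Bv Bxy; rewrite scalerA mulfV ?gt_eqF// scale1r subrK => Bxv.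
have := JK (ltW h0) Bxv; rewrite addrAC subrr add0r => ->.
exact: Bxv.
Qed.

Let JC h k f : 0 <= h -> 0 <= k -> J h (J k f) = J k (J h f).
Proof.
move=> h0; rewrite le_eqVlt => /predU1P[<-|k0]; first by rewrite /J ltxx.
have Bp := JB f k0; have := JK (ltW k0) (JBB h0 Bp).
rewrite -JZ// -Jsub// => <-; congr (J k (J h _)).
by lmod_with R X ltac:(field; rewrite ?gt_eqF).
Qed.

Let Jstep h x y : 0 <= h -> B (x, y) -> J h x - x = h *: J h y.
Proof.
move=> h0 Bxy; rewrite -{2}(JK h0 Bxy) Jsub// JZ//.
by lmod.
Qed.

(** The product [(1 - h L) (1 - k L)] exceeds [1 - (h + k) L] by [h k L^2]. Hence [J (h + k) x] is
    [J h (J k _)] at [x + h k r] with [r = J (h + k) (L^2 x)], and resolvents are contractions. *)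
Let JJ h k x y z : 0 <= h -> 0 <= k -> B (x, y) -> B (y, z) ->
  `|J (h + k) x - J h (J k x)| <= h * k * `|z|.
Proof.
move=> h0 k0 Bxy Byz; have hk0 : 0 <= h + k by rewrite addr_ge0.
have Bpq := JBB hk0 Bxy; have Bqr := JBB hk0 Byz.
set p := J _ x in Bpq *; set q := J _ y in Bpq Bqr; set r := J _ z in Bqr.
have xE : x = p - (h + k) *: q by rewrite -(Jstep hk0 Bxy) opprB addrC subrK.
have Bhk : B (p - h *: q, q - h *: r) by rewrite addrC [X in (_, X)]addrC -!scaleNr; exact: BL.
have E : J h (J k (x + (h * k) *: r)) = p.
  rewrite -[RHS](JK h0 Bpq) -(JK k0 Bhk) xE; congr (J h (J k _)).
  by lmod.
rewrite -E -Jsub// -Jsub// addrAC subrr add0r.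
by rewrite !(le_trans (Jle _ _))// normrZ ger0_norm ?mulr_ge0// ler_wpM2l ?mulr_ge0// Jle.
Qed.

Let iterJL n h a f g : 0 <= h ->
  iter n (J h) (a *: f + g) = a *: iter n (J h) f + iter n (J h) g.
Proof. by move=> h0; elim: n => //= n ->; rewrite Jlin. Qed.

Let iterJle n h f : 0 <= h -> `|iter n (J h) f| <= `|f|.
Proof. by move=> h0; elim: n => //= n; apply: le_trans; exact: Jle. Qed.

Let iterJcontr n h f g : 0 <= h ->
  `|iter n (J h) f - iter n (J h) g| <= `|f - g|.
Proof.
move=> h0; apply: le_trans (iterJle n (f - g) h0); rewrite -scaleN1r addrC.
by rewrite -[in X in _ <= X]scaleN1r [in X in _ <= X]addrC iterJL.
Qed.

Let iterJC n m h k f : 0 <= h -> 0 <= k ->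
  iter n (J h) (iter m (J k) f) = iter m (J k) (iter n (J h) f).
Proof.
move=> h0 k0; elim: n f => //= n IH f; rewrite IH.
by elim: m {IH} (iter n _ f) => //= m IH g; rewrite JC// IH.
Qed.

Let iterJ_comp n h k f : 0 <= h -> 0 <= k ->
  iter n (J h \o J k) f = iter n (J h) (iter n (J k) f).
Proof.
move=> h0 k0; elim: n => //= n ->.
congr (J h _); exact: (iterJC 1 n _ k0 h0).
Qed.

Let pow2 n : 0 < (2 ^ n)%:R :> R.
Proof. by rewrite ltr0n expn_gt0. Qed.

Let U n t x := iter (2 ^ n) (J (t / (2 ^ n)%:R)) x.

Let tn0 n t : 0 <= t -> 0 <= t / (2 ^ n)%:R.
Proof. by move=> t0; rewrite divr_ge0// ltW. Qed.

Let Ucontr n t f g : 0 <= t -> `|U n t f - U n t g| <= `|f - g|.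
Proof. by move=> t0; apply: iterJcontr; exact: tn0. Qed.

(** Halving the step replaces each of the [2^n] factors [J (k + k)] by [J k \o J k], with a defect
    of at most [k^2 |z|] for [k = t / 2^(n + 1)]. This comparison is the reason for powers of
    two. *)
Let Ustep n t x y z : 0 <= t -> B (x, y) -> B (y, z) ->
  `|U n t x - U n.+1 t x| <= t ^+ 2 * `|z| / 4 / (2 ^ n)%:R.
Proof.
move=> t0 Bxy Byz; have k0 := tn0 n.+1 t0; rewrite /U.
set h := t / (2 ^ n)%:R; set k := t / _ in k0 *.
have hE : h = k + k by rewrite /h /k expnS natrM; field; rewrite gt_eqF.
have h0 : 0 <= h by exact: tn0.
have -> : iter (2 ^ n.+1) (J k) x = iter (2 ^ n) (J k \o J k) x.
  by rewrite iterJ_comp// -iterD expnS mul2n addnn.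
apply: (le_trans (iter_commute_lip _ _ _ _ _)).
- by move=> *; exact: Jcontr.
- by move=> a b; rewrite (le_trans (Jcontr _ _ k0))// Jcontr.
- by move=> a /=; rewrite JC// [J h (J k a)]JC.
apply: le_trans (_ : (2 ^ n)%:R * (k * k * `|z|) <= _).
  by rewrite ler_wpM2l// hE; exact: JJ Bxy Byz.
rewrite /k expnS natrM le_eqVlt; apply/orP; left; apply/eqP.
by field; rewrite gt_eqF.
Qed.

(** The bound is a difference so that the geometric increments telescope: [t^2 |z| / 4 / 2^N] is
    [t^2 |z| / 2] times [2^-N - 2^-(N + 1)]. *)
Let Ucauchy2 n m t x y z : 0 <= t -> B (x, y) -> B (y, z) ->
  `|U n t x - U (n + m) t x| <=
  t ^+ 2 * `|z| / 2 * ((2 ^ n)%:R^-1 - (2 ^ (n + m))%:R^-1).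
Proof.
move=> t0 Bxy Byz; elim: m => [|m IH]; first by rewrite addn0 !subrr normr0 mulr0.
rewrite addnS -(subrKA (U (n + m) t x)) (le_trans (ler_normD _ _))//.
have := Ustep (n + m) t0 Bxy Byz; move: IH; rewrite expnS natrM.
set Q := (2 ^ n)%:R^-1; rewrite invfM; set p := (2 ^ (n + m))%:R^-1.
set c := _ * `|z|; set a := `| _ |; set b := `|U (n + m) t x - _|.
lra.
Qed.

Let Ucauchy2' n m t x y z : 0 <= t -> B (x, y) -> B (y, z) ->
  `|U n t x - U (n + m) t x| <= t ^+ 2 * `|z| / (2 ^ n)%:R.
Proof.
move=> t0 Bxy Byz; apply: (le_trans (Ucauchy2 n m t0 Bxy Byz)).
have c0 : 0 <= t ^+ 2 * `|z| by rewrite mulr_ge0// sqr_ge0.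
rewrite -mulrA ler_wpM2l//.
have : 0 < (2 ^ (n + m))%:R^-1 :> R by rewrite invr_gt0.
have : 0 < (2 ^ n)%:R^-1 :> R by rewrite invr_gt0.
by set a := (2 ^ n)%:R^-1; set b := (2 ^ (n + m))%:R^-1; lra.
Qed.

Let B_dens x e : 0 < e -> exists u v, B (u, v) /\ `|x - u| < e.
Proof.
by move=> /(Adens x)[u [v [Auv xu]]]; exists u, v; split=> //; exact: subset_closure.
Qed.

Let B_approx x y e : B (x, y) -> 0 < e ->
  exists2 d, 0 < d & forall h, 0 <= h < d -> `|x - J h x| <= e.
Proof.
move=> Bxy e0; have y1 : 0 < `|y| + 1 by rewrite ltr_wpDl.
exists (e / (`|y| + 1)); first by rewrite divr_gt0.
move=> h /andP[h0 hd]; rewrite distrC (Jstep h0 Bxy) normrZ ger0_norm//.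
have : h * `|J h y| <= h * (`|y| + 1).
  by rewrite ler_wpM2l// (le_trans (Jle _ h0))// lerDl.
by move/le_trans; apply; rewrite -ler_pdivlMr// ltW.
Qed.

Let J_approx x e : 0 < e ->
  exists2 d, 0 < d & forall h, 0 <= h < d -> `|x - J h x| <= e.
Proof.
move=> e0; have e30 : 0 < e / 3 by rewrite divr_gt0.
have [u [v [Buv xu]]] := B_dens x e30; have [d d0 dP] := B_approx Buv e30.
exists d => // h hd; have := dP _ hd; have /andP[h0 _] := hd.
have -> : x - J h x = (x - u) + (u - J h u) + (J h u - J h x) by lmod.
have := Jcontr u x h0; rewrite (distrC u x) => Jux uJ.
apply: (le_trans (ler_normD _ _)).
have := ler_normD (x - u) (u - J h u); lra.
Qed.

(** A resolvent step sends the domain of [L] into that of [L^2] and, when it is short, moves a point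
    of the domain by little. *)
Let B2_dens x e : 0 < e -> exists u v w, [/\ B (u, v), B (v, w) & `|x - u| < e].
Proof.
move=> e0; have e20 : 0 < e / 2 by rewrite divr_gt0.
have [u [v [Buv xu]]] := B_dens x e20; have [d d0 dP] := B_approx Buv e20.
have d20 : 0 < d / 2 by rewrite divr_gt0.
exists (J (d / 2) u), (J (d / 2) v); eexists; split.
- by apply: JBB => //; exact: ltW.
- exact: JB.
- have := dP (d / 2); rewrite ltW//= ltr_pdivrMr// ltr_pMr// ltr1n => /(_ isT) uJ.
  rewrite -(subrKA u) (le_lt_trans (ler_normD _ _))//; lra.
Qed.

Let Ucvg t x : 0 <= t -> exists l : X, U n t x @[n --> \oo] --> l.
Proof.
move=> t0; apply: Xcomplete => e e0.
have e80 : 0 < e / 8 by rewrite divr_gt0.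
have [u [v [w [Buv Bvw xu]]]] := B2_dens x e80.
have [N NP] : exists N, t ^+ 2 * `|w| / (2 ^ N)%:R <= e / 8.
  pose c := t ^+ 2 * `|w| / (e / 8).
  have [N cN] : exists N : nat, c < (2 ^ N)%:R.
    exists (Num.truncn c).+1; apply: (lt_le_trans (truncnS_gt _)).
    by rewrite ler_nat ltnW// ltn_expl.
  exists N; rewrite ler_pdivrMr// [leRHS]mulrC -ler_pdivrMr//; exact: ltW.
have H n : (N <= n)%N -> `|U N t x - U n t x| <= e / 8 + e / 8 + e / 8.
  move=> Nn; have := Ucauchy2' N (n - N) t0 Buv Bvw; rewrite subnKC// => UN.
  have -> : U N t x - U n t x =
    (U N t x - U N t u) + (U N t u - U n t u) + (U n t u - U n t x) by lmod.
  apply: (le_trans (ler_normD _ _)); apply: lerD.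
    apply: (le_trans (ler_normD _ _)); apply: lerD.
      by rewrite (le_trans (Ucontr _ _ _ t0))// ltW.
    exact: le_trans UN NP.
  by rewrite (le_trans (Ucontr _ _ _ t0))// distrC ltW.
exists N => m n Nm Nn; have := H _ Nm; have := H _ Nn; rewrite distrC.
move: (U m t x) (U n t x) (U N t x) => a b c bc ca; rewrite -(subrKA c).
by rewrite (le_trans (ler_normD _ _))// (distrC a); move: bc ca; rewrite (distrC b); lra.
Qed.

Let T t x : X := lim (U n t x @[n --> \oo]).

Let Tcvg t x : 0 <= t -> U n t x @[n --> \oo] --> T t x.
Proof.
move=> t0; have [l Ul] := Ucvg x t0; rewrite /T.
by rewrite (cvg_lim _ Ul)//; exact: norm_hausdorff.
Qed.
Arguments Tcvg {t} x _.

Let Tlim t x l : U n t x @[n --> \oo] --> l -> T t x = l.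
Proof. by move=> Ul; apply: cvg_lim => //; exact: norm_hausdorff. Qed.

Let Tlin t a f g : 0 <= t -> T t (a *: f + g) = a *: T t f + T t g.
Proof.
move=> t0; apply: Tlim.
rewrite (_ : (fun n => _) = (fun n => a *: U n t f + U n t g)).
  by apply: cvgD; [apply: cvgZr|]; exact: Tcvg.
by apply/funext => n; rewrite /U iterJL// tn0.
Qed.

Let Tle t f : 0 <= t -> `|T t f| <= `|f|.
Proof.
move=> t0; rewrite -(subr0 (T t f)); apply: cvgn_norm_le (Tcvg f t0) _ => n.
by rewrite subr0 iterJle// tn0.
Qed.

Let Tsub t f g : 0 <= t -> T t (f - g) = T t f - T t g.
Proof. by move=> t0; rewrite -scaleN1r addrC Tlin// scaleN1r addrC. Qed.

Let Tcontr t f g : 0 <= t -> `|T t f - T t g| <= `|f - g|.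
Proof. by move=> t0; rewrite -Tsub// Tle. Qed.

Let T0 x : T 0 x = x.
Proof.
apply: Tlim; rewrite (_ : (fun n => _) = (fun=> x)); first exact: cvg_cst.
apply/funext => n; rewrite /U mul0r; elim: (2 ^ n)%N => //= m ->.
by rewrite /J ltxx.
Qed.

Let iterJstep n h x y : 0 <= h -> B (x, y) -> `|iter n (J h) x - x| <= n%:R * h * `|y|.
Proof.
move=> h0 Bxy; have -> : iter n (J h) x - x = iter n (J h) x - iter n id x.
  by congr (_ - _); elim: n => //= n <-.
apply: (le_trans (iter_commute_lip _ _ _ _ _)) => //.
  by move=> *; exact: Jcontr.
rewrite -mulrA ler_wpM2l// (Jstep h0 Bxy) normrZ ger0_norm// ler_wpM2l//.
exact: Jle.
Qed.

Let Tstep t x y : 0 <= t -> B (x, y) -> `|T t x - x| <= t * `|y|.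
Proof.
move=> t0 Bxy; apply: cvgn_norm_le (Tcvg x t0) _ => n.
have := iterJstep (2 ^ n) (tn0 n t0) Bxy.
by rewrite [_ * (t / _)]mulrC divfK// gt_eqF.
Qed.

(** [U 0 t] is [J t], so the Cauchy estimate from level 0 compares the limit with one resolvent
    step, to second order in [t]. *)
Let TJ t x y z : 0 <= t -> B (x, y) -> B (y, z) -> `|T t x - J t x| <= t ^+ 2 * `|z|.
Proof.
move=> t0 Bxy Byz; apply: cvgn_norm_le (Tcvg x t0) _ => n.
have := Ucauchy2' 0 n t0 Bxy Byz.
by rewrite add0n /U expn0 /= !divr1 distrC.
Qed.

(** With [N = 2^n], the powers of [J ((s + t) / N)] are compared with those of
    [J (s / N) \o J (t / N)]: the defect is at most [N (s / N) (t / N) |z|], which tends to 0. *)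
Let Tsemi2 s t x y z : 0 <= s -> 0 <= t -> B (x, y) -> B (y, z) ->
  T (s + t) x = T s (T t x).
Proof.
move=> s0 t0 Bxy Byz; apply: Tlim; apply/cvgrPdist_le => e e0.
have e20 : 0 < e / 2 by rewrite divr_gt0.
have [N1 N1P] := cvgn_dist_lt (Tcvg (T t x) s0) e20.
have e40 : 0 < e / 4 by rewrite divr_gt0.
have [N2 N2P] := cvgn_dist_lt (Tcvg x t0) e40.
pose c := s * t * `|z| / (e / 4).
exists (maxn (maxn N1 N2) (Num.truncn c).+1) => // n /=.
rewrite !geq_max => /andP[/andP[nN1 nN2] cn].
have cn' : c <= (2 ^ n)%:R.
  apply: ltW; apply: (lt_le_trans (truncnS_gt _)).
  by rewrite ler_nat (leq_trans cn)// ltnW// ltn_expl.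
have H3 : `|U n (s + t) x - U n s (U n t x)| <= e / 4.
  have sn0 := tn0 n s0; have tn0' := tn0 n t0; rewrite /U mulrDl.
  rewrite -iterJ_comp//; apply: (le_trans (iter_commute_lip _ _ _ _ _)).
  - by move=> *; apply: Jcontr; rewrite addr_ge0.
  - by move=> a b /=; rewrite (le_trans (Jcontr _ _ sn0))// Jcontr.
  - by move=> a /=; rewrite JC ?addr_ge0// [J (_ + _) (J _ a)]JC ?addr_ge0.
  apply: le_trans (_ : (2 ^ n)%:R * (s / (2 ^ n)%:R * (t / (2 ^ n)%:R) * `|z|) <= _).
    by rewrite ler_wpM2l//; exact: JJ Bxy Byz.
  have -> : (2 ^ n)%:R * (s / (2 ^ n)%:R * (t / (2 ^ n)%:R) * `|z|) =
    s * t * `|z| / (2 ^ n)%:R by field; rewrite gt_eqF.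
  by rewrite ler_pdivrMr// [leRHS]mulrC -ler_pdivrMr.
have H2 := le_trans (Ucontr n (T t x) (U n t x) s0) (ltW (N2P _ nN2)).
have H1 := ltW (N1P _ nN1).
move: H3; rewrite distrC => H3.
have -> : T s (T t x) - U n (s + t) x = (T s (T t x) - U n s (T t x)) +
  (U n s (T t x) - U n s (U n t x)) + (U n s (U n t x) - U n (s + t) x) by lmod.
apply: (le_trans (ler_normD _ _)).
have := ler_normD (T s (T t x) - U n s (T t x)) (U n s (T t x) - U n s (U n t x)).
lra.
Qed.

Let Tsemi s t x : 0 <= s -> 0 <= t -> T (s + t) x = T s (T t x).
Proof.
move=> s0 t0; have st0 : 0 <= s + t by rewrite addr_ge0.
apply/eqP; rewrite -subr_eq0 -normr_eq0; apply/eqP/le_anti.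
rewrite normr_ge0 andbT; apply/ler_addgt0Pr => e e0.
have e20 : 0 < e / 2 by rewrite divr_gt0.
have [u [v [w [Buv Bvw xu]]]] := B2_dens x e20.
have H1 := Tcontr x u st0.
have H2 := le_trans (Tcontr (T t u) (T t x) s0) (Tcontr u x t0).
move: H2; rewrite (distrC u) => H2.
have -> : T (s + t) x - T s (T t x) = (T (s + t) x - T (s + t) u) +
   (T s (T t u) - T s (T t x)) by rewrite -(Tsemi2 s0 t0 Buv Bvw) subrKA.
apply: (le_trans (ler_normD _ _)); lra.
Qed.

Let Tcont x : T t x @[t --> 0^'+] --> x.
Proof.
apply/cvg_at0rP => e e0; have e30 : 0 < e / 3 by rewrite divr_gt0.
have [u [v [Buv xu]]] := B_dens x e30; have v1 : 0 < `|v| + 1 by rewrite ltr_wpDl.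
exists (e / 3 / (`|v| + 1)); first by rewrite divr_gt0.
move=> t /andP[/ltW t0 td].
have H1 := Tcontr u x t0; have H2 := Tstep t0 Buv.
have H3 : t * `|v| <= e / 3.
  apply: le_trans (_ : t * (`|v| + 1) <= _); first by rewrite ler_wpM2l// lerDl.
  by rewrite -ler_pdivlMr// ltW.
move: H1; rewrite (distrC u x) => H1; move: H2; rewrite (distrC (T t u)) => H2.
have -> : x - T t x = (x - u) + (u - T t u) + (T t u - T t x) by lmod.
apply: (le_trans (ler_normD _ _)); have := ler_normD (x - u) (u - T t u); lra.
Qed.

Let T_semigroup : is_C0_contraction_semigroup T.
Proof.
split; last by move=> t x t0; exact: Tle.
split=> // t t0.
split; first by move=> a x y; exact: Tlin.
move=> x; apply/cvgrPdist_lt => e e0; near=> y.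
apply: (le_lt_trans (Tcontr x y t0)); near: y.
exact: (@cvgr_dist_lt _ _ _ (nbhs x) _ id x).
Unshelve. all: by end_near. Qed.

(** A second order expansion needs [L^2 x]. So [x] is replaced by [x' = J (m / 2) x], for which
    [T h x' - J h x'] is of order [h^2], while [x - x'] contributes at most [h |y - y'|] by [Tstep].
    The number [m] is fixed before [h], because [z = L^2 x'] depends on it. *)
Let gen_sub x y : B (x, y) -> generator T (x, y).
Proof.
move=> Bxy; rewrite /generator /=; apply/cvg_at0rP => e e0.
have e40 : 0 < e / 4 by rewrite divr_gt0.
have [m m0 mP] := J_approx y e40.
have m20 : 0 < m / 2 by rewrite divr_gt0.
have := mP (m / 2); rewrite ltW//= ltr_pdivrMr// ltr_pMr// ltr1n => /(_ isT).
have Bx'y' := JBB (ltW m20) Bxy; have By'z := JB y m20.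
set x' := J _ x in Bx'y'; set y' := J _ y in Bx'y' By'z * => yy'.
set z := _ *: _ in By'z; have z1 : 0 < `|z| + 1 by rewrite ltr_wpDl.
exists (e / 4 / (`|z| + 1)); first by rewrite divr_gt0.
move=> h /andP[h0 hd]; have h0' := ltW h0.
have hz : h * `|z| <= e / 4.
  apply: le_trans (_ : h * (`|z| + 1) <= _); first by rewrite ler_wpM2l// lerDl.
  by rewrite -ler_pdivlMr// ltW.
have H1 := Tstep h0' (BB Bxy Bx'y').
have H2 := TJ h0' Bx'y' By'z.
have H3 := Jstep h0' Bx'y'.
have H4 := Jstep h0' By'z.
rewrite -(ler_pM2l h0) -{1}(gtr0_norm h0) -normrZ.
have -> : h *: (y - h^-1 *: (T h x - x)) =
  h *: (y - y') - (T h (x - x') - (x - x')) - (T h x' - J h x') - h *: (J h y' - y').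
  have -> : h *: (J h y' - y') = (J h x' - x') - h *: y'.
    by rewrite H3 scalerBr.
  by rewrite Tsub//; lmod_with R X ltac:(field; rewrite ?gt_eqF).
rewrite H4.
have H5 : `|h *: (h *: J h z)| <= h * (e / 4).
  rewrite !normrZ gtr0_norm// ler_wpM2l// (le_trans _ hz)// ler_wpM2l//; exact: Jle.
have H6 : `|h *: (y - y')| <= h * (e / 4) by rewrite normrZ gtr0_norm// ler_wpM2l.
have H7 : h ^+ 2 * `|z| <= h * (e / 4) by rewrite expr2 -mulrA ler_wpM2l.
have H8 : h * `|y - y'| <= h * (e / 4) by rewrite ler_wpM2l.
move: H1 H2 H5 H6; set c := h *: (h *: _); set a := h *: (y - y').
set b := T h (x - x') - _; set b' := T h x' - _ => H1 H2 H5 H6.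
have := ler_normB (a - b - b') c; have := ler_normB (a - b) b'.
have := ler_normB a b; lra.
Qed.

Lemma hille_yosida : exists T' : R -> X -> X,
  is_C0_contraction_semigroup T' /\ generator T' = closure A.
Proof.
exists T; split=> //; apply/seteqP; split=> -[x y]; last exact: gen_sub.
move=> Gxy.
(* For the generator [G] the map [1 - G] is injective and its restriction to the closure is already
   onto, so [G] is no proper extension: [u] solves [u - L u = x - y], and [p = x - u] satisfies
   [G p = p]. *)
have := JB (x - y) ltr01; set u := J _ _; rewrite invr1 scale1r => Bu.
have Gu := gen_sub Bu.
suff xu : x = u by move: Bu; rewrite -xu opprB addrC subrK.
pose p := x - u.
have Gp : h^-1 *: (T h p - p) @[h --> 0^'+] --> p.
  have H := proj1 (cvg_at0rP _ _) (cvgB Gxy Gu); apply/cvg_at0rP => e /H[d d0 dP]; exists d => // h hd.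
  have := dP h hd; congr (`| _ | <= _); rewrite /= opprfctE Tsub; last by case/andP: hd => /ltW.
  by rewrite /p; lmod.
apply/eqP; rewrite -subr_eq0 -normr_eq0; apply/eqP/le_anti; rewrite normr_ge0 andbT.
move: Gp => /(proj1 (cvg_at0rP _ _)) Gp; apply/ler_addgt0Pr => e /Gp[d d0 dP].
have d20 : 0 < d / 2 by rewrite divr_gt0.
have := dP (d / 2); rewrite d20 ltr_pdivrMr// ltr_pMr// ltr1n => /(_ isT).
rewrite add0r; apply: le_trans; rewrite -/p.
(* Contractivity excludes [G p = p] unless [p = 0]: with [h = d / 2] the norm of [(1 + h) p - T h p]
   is at least [h |p|], although [p] minus the difference quotient is small. *)
have pE : (d / 2) *: (p - (d / 2)^-1 *: (T (d / 2) p - p)) = (1 + d / 2) *: p - T (d / 2) p.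
  rewrite scalerBr scalerA mulfV ?gt_eqF// scale1r; by lmod.
have : d / 2 * `|p| <= d / 2 * `|p - (d / 2)^-1 *: (T (d / 2) p - p)|.
  rewrite -{2}(gtr0_norm d20) -normrZ pE; apply: le_trans (lerB_dist _ _).
  rewrite normrZ ger0_norm ?addr_ge0 ?(ltW d20)//.
  have := Tle p (ltW d20); rewrite mulrDl mul1r.
  lra.
by rewrite ler_pM2l.
Qed.

End HilleYosida.

(** * Norm and completeness of [L^1] as a space of classes *)

Section L1.
Context d (T : measurableType d) (R : realType) (mu : {measure set T -> \bar R}).
Local Notation L1 := (LspaceType1 mu).
Implicit Types (G H : L1) (f g : T -> R).

Lemma measurable_Lspace G : measurable_fun setT (G : T -> R).
Proof. exact: (@measurable_funPT _ _ _ _ (repr (G : {mfun_ mu, T >-> measurableTypeR R}))). Qed.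

Lemma L1_normE G : `|G|%:E = (\int[mu]_x `|(G : T -> R) x|%:E)%E.
Proof.
have fin : ('N[mu]_1[EFin \o (G : T -> R)])%E \is a fin_num.
  by rewrite ge0_fin_numE ?Lnorm_ge0//; exact: (@Lebesgue_finite _ _ _ mu 1%E _ G).
by rewrite Lspace_normE fineK// Lnorm1.
Qed.

Lemma L1_norm_ae G f : measurable_fun setT f -> (G : T -> R) = f %[ae mu] ->
  `|G|%:E = (\int[mu]_x `|f x|%:E)%E.
Proof.
move=> mf Gf; rewrite L1_normE; apply: ae_eq_integral => //.
- by apply/measurable_EFinP/measurableT_comp => //; exact: measurable_Lspace.
- by apply/measurable_EFinP/measurableT_comp.
- by apply: filterS Gf => x /= + xT => ->.
Qed.

Lemma Lfun1P f : (f \in Lfun mu 1) <->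
  measurable_fun setT f /\ (\int[mu]_x `|f x|%:E < +oo)%E.
Proof.
have E : ('N[mu]_1[EFin \o f] = \int[mu]_x `|f x|%:E)%E.
  by rewrite Lnorm1; apply: eq_integral.
split=> [/andP[]|[mf f_fin]].
  by rewrite !inE /finite_norm /= E.
by apply/andP; split; rewrite inE//= /finite_norm E.
Qed.

Lemma L1_class_ex f : measurable_fun setT f -> (\int[mu]_x `|f x|%:E < +oo)%E ->
  exists G, (G : T -> R) = f %[ae mu].
Proof.
move=> mf f_fin; have f1 : f \in Lfun mu 1 by apply/Lfun1P.
exists (Lspace_class (@Lfun_Sub _ _ _ _ _ _ f f1)).
exact: Lspace_classK.
Qed.

Lemma L1_subE G H : (G - H : T -> R) =
  (fun x => (G : T -> R) x - (H : T -> R) x) %[ae mu].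
Proof.
rewrite -scaleN1r; near=> x => _.
rewrite (near (Lspace_addE G (-1 *: H)))// (near (Lspace_scaleE (-1) H))//.
by rewrite mulN1r.
Unshelve. all: by end_near. Qed.

(* The limit of a sequence with summable increments is the sum of the series of
   its increments, which converges absolutely almost everywhere. *)
Lemma L1_summable_cvg (v : nat -> L1) (a : nat -> R) :
  (forall k, `|v k.+1 - v k| <= a k) -> (\sum_(0 <= k <oo) (a k)%:E < +oo)%E ->
  exists G, forall N, (`|G - v N|%:E <= \sum_(N <= k <oo) (a k)%:E)%E.
Proof.
move=> va a_fin.
pose D k x := (v k.+1 : T -> R) x - (v k : T -> R) x.
have mD k : measurable_fun setT (D k).
  by apply: measurable_funB; exact: measurable_Lspace.
have intD k : (\int[mu]_x `|D k x|%:E <= (a k)%:E)%E.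
  by rewrite -(L1_norm_ae (mD k) (L1_subE _ _)) lee_fin.
have a0 k : (0 <= (a k)%:E)%E by rewrite lee_fin (le_trans _ (va k)).
pose S N x := (\sum_(0 <= k <oo) `|D (k + N)%N x|%:E)%E.
have mabsD k : measurable_fun setT (fun x => `|D k x|%:E).
  by apply/measurable_EFinP/measurableT_comp.
have mS N : measurable_fun setT (S N).
  by apply: ge0_emeasurable_sum => // k x _ _; rewrite lee_fin.
have intS N : (\int[mu]_x S N x <= \sum_(N <= k <oo) (a k)%:E)%E.
  rewrite integral_nneseries// -nneseries_addn//.
  by apply: lee_nneseries => // k _ _; apply: integral_ge0.
(* Two nonnegative series make [f] measurable without a convergence argument. Where one of them
   diverges [fine] gives a default value; there [S 0] is infinite, which happens on a null set
   only. *)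
pose Dp k x := Num.max (D k x) 0; pose Dm k x := Num.max (- D k x) 0.
have Dp0 k x : 0 <= Dp k x by rewrite le_max lexx orbT.
have Dm0 k x : 0 <= Dm k x by rewrite le_max lexx orbT.
have DpE k x : `|D k x| = Dp k x + Dm k x.
  rewrite /Dp /Dm; have /orP[D0|D0] := le_total 0 (D k x).
    by rewrite ger0_norm// max_l// max_r ?addr0// oppr_le0.
  by rewrite ler0_norm// max_r// max_l ?add0r// oppr_ge0.
have DmE k x : D k x = Dp k x - Dm k x.
  rewrite /Dp /Dm; have /orP[D0|D0] := le_total 0 (D k x).
    by rewrite max_l// max_r ?subr0// oppr_le0.
  by rewrite max_r// max_l ?sub0r ?opprK// oppr_ge0.
have mDp k : measurable_fun setT (Dp k) by exact: measurable_maxr.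
have mDm k : measurable_fun setT (Dm k).
  by apply: measurable_maxr => //; exact: measurableT_comp.
pose f x := (v 0%N : T -> R) x + (fine (\sum_(0 <= k <oo) (Dp k x)%:E)%E -
   fine (\sum_(0 <= k <oo) (Dm k x)%:E)%E).
have mf : measurable_fun setT f.
  apply: measurable_funD; first exact: measurable_Lspace.
  apply: measurable_funB; apply: measurableT_comp => //;
    apply: ge0_emeasurable_sum => [k x _ _|k _]; rewrite ?lee_fin//;
    exact/measurable_EFinP.
have mfv N : measurable_fun setT (fun x => `|f x - (v N : T -> R) x|%:E).
  apply/measurable_EFinP/measurableT_comp => //.
  by apply: measurable_funB => //; exact: measurable_Lspace.
have mv0 : measurable_fun setT (fun x => `|(v 0%N : T -> R) x|%:E).
  by apply/measurable_EFinP/measurableT_comp => //; exact: measurable_Lspace.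
have fS N x : (S 0%N x < +oo -> `|f x - (v N : T -> R) x|%:E <= S N x)%E.
  move=> S0.
  have split0 (g : nat -> T -> R) : (forall k, 0 <= g k x) -> (forall k, g k x <= `|D k x|) ->
      exists r, [/\ 0 <= r, fine (\sum_(0 <= k <oo) (g k x)%:E)%E =
        \sum_(0 <= k < N) g k x + r & (\sum_(N <= k <oo) (g k x)%:E)%E = r%:E].
    move=> g0 gD; have g0' k : (0 <= (g k x)%:E)%E by rewrite lee_fin.
    have gN0 : (0 <= \sum_(N <= k <oo) (g k x)%:E)%E by apply: nneseries_ge0.
    have gsplit := @nneseries_split R (fun k => (g k x)%:E) 0 N (fun k _ => g0' k).
    have gfin : (\sum_(0 <= k <oo) (g k x)%:E < +oo)%E.
      apply: le_lt_trans S0; apply: lee_nneseries => // k _.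
      by rewrite addn0 lee_fin.
    have gNfin : (\sum_(N <= k <oo) (g k x)%:E)%E \is a fin_num.
      rewrite ge0_fin_numE//; apply: le_lt_trans gfin; rewrite gsplit add0n.
      by rewrite leeDr// sume_ge0.
    exists (fine (\sum_(N <= k <oo) (g k x)%:E)%E); split.
    - by rewrite fine_ge0.
    - by rewrite gsplit add0n sumEFin fineD.
    - by rewrite fineK.
  have [||p [p0 pE pN]] := split0 Dp; [by []|by move=> k; rewrite DpE lerDl|].
  have [||m [m0 mE mN]] := split0 Dm; [by []|by move=> k; rewrite DpE lerDr|].
  have vN : (v N : T -> R) x = (v 0%N : T -> R) x +
      (\sum_(0 <= k < N) Dp k x - \sum_(0 <= k < N) Dm k x).
    rewrite -sumrB (eq_bigr (fun k => (v k.+1 : T -> R) x - (v k : T -> R) x)).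
      by rewrite telescope_sumr// addrC subrK.
    by move=> k _; rewrite -DmE.
  rewrite /S (@nneseries_addn _ (fun k => `|D k x|%:E))//.
  rewrite (eq_eseriesr (g := fun k => (Dp k x)%:E + (Dm k x)%:E)%E); last first.
    by move=> k _; rewrite DpE.
  rewrite nneseriesD; [|by move=> *; rewrite lee_fin..].
  rewrite pN mN -EFinD lee_fin /f pE mE vN.
  have -> : forall b s s', b + (s + p - (s' + m)) - (b + (s - s')) = p - m.
    by move=> b s s'; ring.
  by rewrite ler_norml; lra.
have S0fin : mu.-integrable setT (S 0%N).
  apply/integrableP; split=> //; under eq_integral => x _ do
    rewrite gee0_abs ?nneseries_ge0//.
  exact: le_lt_trans (intS 0%N) a_fin.
have aeS : {ae mu, forall x, (S 0%N x < +oo)%E}.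
  have := integrable_ae measurableT S0fin; apply: filterS => x /(_ I).
  by rewrite ge0_fin_numE// nneseries_ge0.
have fN N : (\int[mu]_x `|f x - (v N : T -> R) x|%:E <= \sum_(N <= k <oo) (a k)%:E)%E.
  apply: le_trans (intS N); apply: ae_ge0_le_integral => //.
  - by move=> x _; rewrite nneseries_ge0.
  - by apply: filterS aeS => x S0x _; exact: fS.
have [G Gf] : exists G : L1, (G : T -> R) = f %[ae mu].
  apply: L1_class_ex => //.
  apply: (@le_lt_trans _ _ (\int[mu]_x (`|f x - (v 0%N : T -> R) x|%:E + `|(v 0%N : T -> R) x|%:E))%E).
    apply: ge0_le_integral => //.
    - by apply/measurable_EFinP/measurableT_comp.
    - exact: emeasurable_funD.
    - by move=> x _; rewrite -EFinD lee_fin -{1}(subrK ((v 0%N : T -> R) x) (f x)) ler_normD.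
  rewrite ge0_integralD//.
  - by rewrite lte_add_pinfty ?(le_lt_trans (fN _))// -L1_normE ltry.
exists G => N; apply: le_trans (fN N).
rewrite (@L1_norm_ae (G - v N) (fun x => f x - (v N : T -> R) x))//.
  by apply: measurable_funB => //; exact: measurable_Lspace.
apply: ae_eq_trans (L1_subE _ _) _.
by apply: filterS Gf => x /= H xT; rewrite H.
Qed.

Lemma L1_complete (u : nat -> L1) :
  (forall e : R, 0 < e -> exists N, forall m n, (N <= m)%N -> (N <= n)%N -> `|u m - u n| <= e) ->
  exists G : L1, u n @[n --> \oo] --> G.
Proof.
move=> uC; pose a k : R := 1 / (2 ^ k.+1)%:R.
have a0 k : 0 < a k by rewrite divr_gt0// ltr0n expn_gt0.
have /choice[N NP] k : exists N, forall m n, (N <= m)%N -> (N <= n)%N -> `|u m - u n| <= a k.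
  exact: uC.
pose M k := (\max_(j < k.+1) N j)%N.
have NM k n : (M k <= n)%N -> (N k <= n)%N.
  by apply: leq_trans; exact: (leq_bigmax (ord_max : 'I_k.+1)).
have MM k : (M k <= M k.+1)%N by rewrite /M [in X in (_ <= X)%N]big_ord_recr leq_maxl.
have a_fin : (\sum_(0 <= k <oo) (a k)%:E < +oo)%E.
  exact: le_lt_trans (epsilon_trick0 xpredT ler01) (ltry _).
have va k : `|u (M k.+1) - u (M k)| <= a k by apply: NP; apply: NM.
have [G GP] := L1_summable_cvg va a_fin.
exists G; apply/cvgrPdist_le => e e0.
have e20 : (0 < e / 2)%R by rewrite divr_gt0.
have : (\sum_(n <= k <oo) (a k)%:E)%E @[n --> \oo] --> 0%E.
  by apply: nneseries_tail_cvg => // k _; rewrite lee_fin ltW.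
move=> /fine_cvgP[tfin /cvgrPdist_lt/(_ _ e20) tsmall].
have [k [tf ts]] : exists k, (\sum_(k <= i <oo) (a i)%:E)%E \is a fin_num /\
    `|0 - fine (\sum_(k <= i <oo) (a i)%:E)%E| < e / 2.
  have [k _ kP] := filterI tfin tsmall; exists k; exact: (kP k (leqnn _)).
have tle : (\sum_(k <= i <oo) (a i)%:E <= (e / 2)%:E)%E.
  rewrite -(fineK tf) lee_fin.
  by move: ts; rewrite sub0r normrN => /ltW; apply: le_trans; rewrite ler_norm.
have ak : a k <= e / 2.
  rewrite -lee_fin; apply: le_trans tle; rewrite (nneseries_split _ 1); last first.
    by move=> i _; rewrite lee_fin ltW.
  rewrite addn1 big_nat1 leeDl// nneseries_ge0// => i _ _.
  by rewrite lee_fin ltW.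
exists (M k) => // n /= /NM Nn; rewrite -(subrKA (u (M k))) (splitr e).
apply: (le_trans (ler_normD _ _)); apply: lerD.
  by rewrite -lee_fin (le_trans (GP k)).
by apply: le_trans ak; apply: NP => //; exact: NM.
Qed.

End L1.

(** * Iterated integrals over tuples *)

Section TupleIntegral.
Context d (T : measurableType d) (R : realType).
Variable m : {sigma_finite_measure set T -> \bar R}.
Local Notation tm := (tuple_measure m).
Local Open Scope ereal_scope.

Lemma tuple_integral0 (f : 0.-tuple T -> \bar R) :
  measurable_fun setT f -> \int[tm 0]_t f t = f [tuple].
Proof. by move=> mf; rewrite integral_dirac// diracT mul1e. Qed.

Lemma tuple_integralS1 n (f : n.+1.-tuple T -> \bar R) :
  measurable_fun setT f -> (forall t, 0 <= f t) ->
  \int[tm n.+1]_t f t = \int[m]_x \int[tm n]_t f [tuple of x :: t].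
Proof.
move=> mf f0; have mcons := @Defs.measurable_cons_tuple _ T n.
rewrite ge0_integral_pushforward// preimage_setT.
rewrite -(fubini_tonelli1 (f \o @Defs.cons_tuple _ T n))//.
  exact: measurableT_comp.
by move=> x /=.
Qed.

Lemma tuple_integralS2 n (f : n.+1.-tuple T -> \bar R) :
  measurable_fun setT f -> (forall t, 0 <= f t) ->
  \int[tm n.+1]_t f t = \int[tm n]_t \int[m]_x f [tuple of x :: t].
Proof.
move=> mf f0; have mcons := @Defs.measurable_cons_tuple _ T n.
rewrite ge0_integral_pushforward// preimage_setT.
rewrite -(fubini_tonelli2 (f \o @Defs.cons_tuple _ T n))//.
  exact: measurableT_comp.
by move=> x /=.
Qed.

Lemma measurable_consx n (x : T) :
  measurable_fun setT (fun t : n.-tuple T => [tuple of x :: t]).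
Proof. exact: measurable_cons. Qed.

Lemma measurable_xcons n (t : n.-tuple T) :
  measurable_fun setT (fun x : T => [tuple of x :: t]).
Proof. exact: measurable_cons. Qed.

Lemma measurable_tuple_integral n (f : n.+1.-tuple T -> \bar R) :
  measurable_fun setT f -> (forall t, 0 <= f t) ->
  measurable_fun setT (fun x => \int[tm n]_t f [tuple of x :: t]).
Proof.
move=> mf f0; have mcons := @Defs.measurable_cons_tuple _ T n.
apply: (@measurable_fun_fubini_tonelli_F _ _ _ _ _ (tm n) (f \o @Defs.cons_tuple _ T n)) => //.
  exact: measurableT_comp.
by move=> x /=.
Qed.

End TupleIntegral.

(** * Sums over subsequences and their integrals *)

Section SubsetSum.
Context d (T : measurableType d) (R : realType).
Local Open Scope ereal_scope.
Implicit Types (w : T -> R) (g : seq T -> \bar R).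

(* [subset_sum w g s] is the sum over the subsequences [s'] of [s] of [g s']
   times the product of [w] over the remaining entries. *)
Fixpoint subset_sum w g (s : seq T) : \bar R :=
  if s is a :: s' then
    subset_sum w (fun l => g (a :: l)) s' + (w a)%:E * subset_sum w g s'
  else g [::].

Lemma subset_sum_ge0 w g s : (forall x, 0 <= w x)%R -> (forall l, 0 <= g l) ->
  0 <= subset_sum w g s.
Proof.
move=> w0; elim: s g => [|a s IH] g g0 /=; first exact: g0.
by rewrite adde_ge0 ?mule_ge0 ?lee_fin ?IH.
Qed.

Lemma le_subset_sum w g g' s : (forall x, 0 <= w x)%R -> (forall l, g l <= g' l) ->
  subset_sum w g s <= subset_sum w g' s.
Proof.
move=> w0; elim: s g g' => [|a s IH] g g' gg' /=; first exact: gg'.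
by rewrite leeD ?lee_wpmul2l ?lee_fin ?IH.
Qed.

(** The parameter space varies because the recursion feeds the head of the list to [g]: in the
    induction the head becomes a further parameter, in [S * T]. *)
Lemma measurable_subset_sum d' (S : measurableType d') (w : S * T -> R)
    (g : S -> seq T -> \bar R) :
  measurable_fun setT w ->
  (forall n, measurable_fun setT (fun p : S * n.-tuple T => g p.1 p.2)) ->
  forall n, measurable_fun setT
    (fun p : S * n.-tuple T => subset_sum (fun x => w (p.1, x)) (g p.1) p.2).
Proof.
move=> mw mg n; elim: n d' S w g mw mg => [|n IH] d' S w g mw mg.
  rewrite (_ : (fun _ => _) = (fun p : S * 0.-tuple T => g p.1 p.2))//.
  by apply/funext => -[s t] /=; rewrite (tuple0 t).
pose q (p : S * n.+1.-tuple T) : (S * T) * n.-tuple T :=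
  ((p.1, thead p.2), [tuple of behead p.2]).
have mth : measurable_fun setT (fun p : S * n.+1.-tuple T => (p.1, thead p.2)).
  apply: measurable_fun_pair => //.
  apply: (@measurableT_comp _ _ _ _ _ _ (fun t : n.+1.-tuple T => thead t)) => //.
  exact: measurable_tnth.
have mbe : measurable_fun setT (fun p : S * n.+1.-tuple T => [tuple of behead p.2]).
  apply: (@measurableT_comp _ _ _ _ _ _ (fun t : n.+1.-tuple T => [tuple of behead t])) => //.
  exact: measurable_behead.
rewrite (_ : (fun _ => _) = (fun p : S * n.+1.-tuple T =>
    subset_sum (fun x => w (p.1, x)) (fun l => g p.1 (thead p.2 :: l)) (behead p.2)
  + (w (p.1, thead p.2))%:E * subset_sum (fun x => w (p.1, x)) (g p.1) (behead p.2))); last first.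
  by apply/funext => -[s t] /=; rewrite {1}(tuple_eta t).
apply: emeasurable_funD.
  apply: (@measurableT_comp _ _ _ _ _ _ (fun p : (S * T) * n.-tuple T =>
     subset_sum (fun x => w (p.1.1, x)) (fun l => g p.1.1 (p.1.2 :: l)) p.2) _ q); last first.
    exact: measurable_fun_pair.
  apply: (IH _ (S * T)%type (fun p => w (p.1.1, p.2)) (fun p l => g p.1 (p.2 :: l))).
    apply: measurableT_comp => //; apply: measurable_fun_pair => //.
    exact: measurableT_comp.
  move=> k; apply: (@measurableT_comp _ _ _ _ _ _ (fun p : S * k.+1.-tuple T => g p.1 p.2) _
    (fun p : (S * T) * k.-tuple T => (p.1.1, [tuple of p.1.2 :: p.2]))) => //.
    exact: mg k.+1.
  apply: measurable_fun_pair; first exact: measurableT_comp.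
  by apply: measurable_cons => //; exact: measurableT_comp.
apply: emeasurable_funM.
  by apply/measurable_EFinP; exact: measurableT_comp.
apply: (@measurableT_comp _ _ _ _ _ _ (fun p : S * n.-tuple T =>
     subset_sum (fun x => w (p.1, x)) (g p.1) p.2) _
  (fun p : S * n.+1.-tuple T => (p.1, [tuple of behead p.2]))).
  exact: IH.
exact: measurable_fun_pair.
Qed.

Variable m : {sigma_finite_measure set T -> \bar R}.
Local Notation tm := (tuple_measure m).

Variables (w : T -> R) (M : R).
Hypotheses (mw : measurable_fun setT w) (w0 : forall x, (0 <= w x)%R).
Hypothesis wM : \int[m]_x (w x)%:E = M%:E.

Let measurable_ss g : (forall n, measurable_fun setT (fun t : n.-tuple T => g t)) ->
  forall n, measurable_fun setT (fun t : n.-tuple T => subset_sum w g t).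
Proof.
move=> mg n.
have := @measurable_subset_sum _ unit (fun p => w p.2) (fun _ l => g l) _ _ n.
move=> /(_ (measurableT_comp mw measurable_snd) (fun k => measurableT_comp (mg k) measurable_snd)).
by move=> H; apply: (measurableT_comp H (measurable_pair1 tt)).
Qed.

Arguments measurable_ss {g} _ n.

(** The first coordinate is either kept in the argument of [g] or integrates to a factor [M]. All
    coordinates of a kept subsequence are integrated, so only its length [k] counts, and Pascal's
    rule closes the induction. *)
Lemma integral_subset_sum n g :
  (forall n, measurable_fun setT (fun t : n.-tuple T => g t)) -> (forall l, 0 <= g l) ->
  \int[tm n]_t subset_sum w g t =
  \sum_(k < n.+1) ('C(n, k)%:R * M ^+ (n - k))%:E * \int[tm k]_t g t.
Proof.
have M0 : (0 <= M)%R by rewrite -lee_fin -wM integral_ge0// => x _; rewrite lee_fin.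
elim: n g => [|n IH] g mg g0.
  rewrite big_ord1 /= bin0 expr0 mulr1 mul1e !tuple_integral0//.
  exact: (measurable_ss mg 0%N).
pose b n k : R := ('C(n, k)%:R * M ^+ (n - k))%R.
pose I k := \int[tm k]_t g t.
have b0 i k : (0 <= b i k)%R by rewrite mulr_ge0// exprn_ge0.
have I0 k : 0 <= I k by exact: integral_ge0.
have mgx x k : measurable_fun setT (fun t : k.-tuple T => g (x :: t)).
  by apply: (measurableT_comp (mg k.+1)); exact: measurable_consx.
rewrite tuple_integralS1//=; last 2 first.
  exact: measurable_ss mg n.+1.
  by move=> t; exact: subset_sum_ge0.
transitivity (\int[m]_x (\sum_(k < n.+1) (b n k)%:E * (\int[tm k]_t g (x :: t)) +
    (w x)%:E * \int[tm n]_t subset_sum w g t)).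
  apply: eq_integral => x _; rewrite ge0_integralD//.
  - congr (_ + _); first by rewrite IH.
    rewrite ge0_integralZl_EFin//; last exact: measurable_ss.
    by move=> t _; exact: subset_sum_ge0.
  - by move=> t _; exact: subset_sum_ge0.
  - exact: measurable_ss.
  - by move=> t _; rewrite mule_ge0 ?lee_fin// subset_sum_ge0.
  - by apply: measurable_funeM; exact: measurable_ss.
have mI k : measurable_fun setT (fun x => \int[tm k]_t g (x :: t)).
  exact: (@measurable_tuple_integral _ _ _ m k (fun t => g t)).
have I1 k : 0 <= \int[tm k]_t subset_sum w g t.
  by apply: integral_ge0 => t _; exact: subset_sum_ge0.
rewrite ge0_integralD//; last 4 first.
  - by move=> x _; rewrite sume_ge0// => k _; rewrite mule_ge0 ?lee_fin// integral_ge0.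
  - by apply: emeasurable_sum => k; exact: measurable_funeM.
  - by move=> x _; rewrite mule_ge0 ?lee_fin.
  - by apply: emeasurable_funM => //; exact/measurable_EFinP.
rewrite ge0_integral_sum//; last 2 first.
  - by move=> k; exact: measurable_funeM.
  - by move=> k x _; rewrite mule_ge0 ?lee_fin// integral_ge0.
rewrite ge0_integralZr//; last 2 first.
  - exact/measurable_EFinP.
  - by move=> x _; rewrite lee_fin.
rewrite wM IH//.
rewrite (eq_bigr (fun k : 'I_n.+1 => (b n k)%:E * I k.+1)); last first.
  move=> k _; rewrite ge0_integralZl_EFin//.
    by rewrite /I tuple_integralS1//; exact: mg k.+1.
  by move=> x _; exact: integral_ge0.
rewrite -/(b _ _).
(* The added term [k = n.+1] has coefficient ['C(n, n.+1) = 0]; it aligns this sum with the one from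
   the kept coordinate, so that [binS] can combine them. *)
have -> : M%:E * \sum_(k < n.+1) (b n k)%:E * I k =
    \sum_(k < n.+2) (M * b n k)%:E * I k.
  rewrite [RHS]big_ord_recr/= /b bin_small// mul0r mulr0 mul0e adde0.
  rewrite ge0_sume_distrr; last by move=> k _; apply: mule_ge0; [rewrite lee_fin; exact: b0|exact: I0].
  by apply: eq_bigr => k _; rewrite EFinM muleA.
rewrite -[RHS]/(\sum_(k < n.+2) (b n.+1 k)%:E * I k).
clearbody I; rewrite [X in _ + X = _]big_ord_recl [in RHS]big_ord_recl addeCA -big_split/=.
congr (_ + _); first by rewrite /b !bin0 !mul1r !subn0 exprS.
apply: eq_bigr => k _; rewrite /bump add1n -ge0_muleDl ?lee_fin//; last by rewrite mulr_ge0.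
rewrite -EFinD; congr (_%:E * _).
rewrite /b binS natrD mulrDl subSS addrC; congr (_ + _)%R.
have [kn|nk] := ltnP k n; last by rewrite bin_small// !mul0r mulr0.
by rewrite mulrCA -exprS subnSK.
Qed.

End SubsetSum.

(** * Binomial and exponential series in the extended reals *)

Section ExponentialSeries.
Context (R : realType).
Local Open Scope ereal_scope.

Lemma nneseries_exp (x : R) : (0 <= x)%R ->
  \sum_(0 <= n <oo) (x ^+ n / n`!%:R)%:E = (expR x)%:E.
Proof.
move=> x0; rewrite /expR -EFin_lim; last exact: is_cvg_series_exp_coeff.
by congr (limn _); apply/funext => n; rewrite /= /series /= -sumEFin.
Qed.

Lemma nneseries_finite (f : nat -> \bar R) N : (forall k, 0 <= f k) ->
  (forall k, (N <= k)%N -> f k = 0) -> \sum_(0 <= k <oo) f k = \sum_(k < N) f k.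
Proof.
move=> f0 fN; rewrite (nneseries_split _ N)// add0n big_mkord.
by rewrite -nneseries_addn// eseries0 ?adde0// => i _ _; rewrite fN// leq_addl.
Qed.

Lemma nneseriesZr (a : nat -> R) (J : \bar R) : (forall n, (0 <= a n)%R) -> 0 <= J ->
  \sum_(0 <= n <oo) (a n)%:E * J = (\sum_(0 <= n <oo) (a n)%:E) * J.
Proof.
move=> a0 J0; rewrite -(ge0_integral_count (a := fun n => (a n)%:E * J)); last first.
  by move=> n; rewrite mule_ge0 ?lee_fin.
rewrite -ge0_integral_count; last by move=> n; rewrite lee_fin.
by rewrite ge0_integralZr// => n _; rewrite lee_fin.
Qed.

(** For [k <= n] the coefficient is [c^k / k!] times [(c M)^(n - k) / (n - k)!], so summing over [n]
    first gives an exponential. This is how the Mayer factors split off. *)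
Lemma nneseries_binomial_exp (c M : R) (I : nat -> \bar R) :
  (0 <= c)%R -> (0 <= M)%R -> (forall k, 0 <= I k) ->
  \sum_(0 <= n <oo) (c ^+ n / n`!%:R)%:E *
    (\sum_(k < n.+1) ('C(n, k)%:R * M ^+ (n - k))%:E * I k) =
  (expR (c * M))%:E * \sum_(0 <= k <oo) (c ^+ k / k`!%:R)%:E * I k.
Proof.
move=> c0 M0 I0; pose b n k : R := ('C(n, k)%:R * M ^+ (n - k))%R.
have b0 n k : (0 <= b n k)%R by rewrite mulr_ge0// exprn_ge0.
have f0 n : (0 <= c ^+ n / n`!%:R)%R by rewrite divr_ge0// exprn_ge0.
have fb0 n k : (0 <= c ^+ n / n`!%:R * b n k)%R by rewrite mulr_ge0.
transitivity (\sum_(0 <= n <oo) \sum_(0 <= k <oo) (c ^+ n / n`!%:R * b n k)%:E * I k).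
  apply: eq_eseriesr => n _.
  rewrite (nneseries_finite (N := n.+1)); last 2 first.
  - by move=> k; rewrite mule_ge0// lee_fin.
  - by move=> k nk; rewrite /b bin_small// mul0r mulr0 mul0e.
  rewrite ge0_sume_distrr; last by move=> k _; rewrite mule_ge0// lee_fin; exact: b0.
  by apply: eq_bigr => k _; rewrite EFinM muleA.
rewrite nneseries_interchange; last by move=> n k; rewrite mule_ge0// lee_fin.
rewrite -nneseriesZl; last by move=> k _; rewrite mule_ge0// lee_fin.
apply: eq_eseriesr => k _; rewrite nneseriesZr// muleA; congr (_ * _).
rewrite (nneseries_split _ k); last by move=> n _; rewrite lee_fin.
rewrite add0n big_mkord big1 ?add0e; last first.
  by move=> n _; rewrite /b bin_small// mul0r mulr0.
rewrite -nneseries_addn; last by move=> n; rewrite lee_fin.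
rewrite -nneseries_exp ?mulr_ge0// muleC -nneseriesZl; last first.
  by move=> n _; rewrite lee_fin divr_ge0// exprn_ge0// mulr_ge0.
apply: eq_eseriesr => n _; rewrite -EFinM; congr _%:E.
have nk0 : (n + k)`!%:R != 0%R :> R by rewrite pnatr_eq0 -lt0n fact_gt0.
have n0 : n`!%:R != 0%R :> R by rewrite pnatr_eq0 -lt0n fact_gt0.
have k0 : k`!%:R != 0%R :> R by rewrite pnatr_eq0 -lt0n fact_gt0.
have C0 : ('C(n + k, k)%:R = (n + k)`!%:R / (n`!%:R * k`!%:R) :> R)%R.
  apply: (@mulIf _ (n`!%:R * k`!%:R)); first by rewrite mulf_neq0.
  rewrite divfK ?mulf_neq0// -!natrM; congr _%:R.
  by rewrite -(bin_fact (leq_addl n k)) addnK [(k`! * _)%N]mulnC.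
rewrite /b addnK exprD exprMn C0.
by field; rewrite nk0 n0 k0.
Qed.

End ExponentialSeries.

(** * Translation invariance and null points of Lebesgue measure *)

Section LebesgueTranslation.
Context (R : realType).
Local Open Scope ereal_scope.
Local Notation RT := (measurableTypeR R).

(** The image of Lebesgue measure under the shift agrees with it on half-open intervals, which
    determine the measure. *)
Lemma lebesgue_integral_shift (f : RT -> \bar R) (a : R) :
  measurable_fun setT f -> (forall x, 0 <= f x) ->
  \int[@lebesgue_measure R]_x f (x - a)%R = \int[@lebesgue_measure R]_x f x.
Proof.
move=> mf f0.
have ms : measurable_fun [set: RT] (fun x : RT => (x - a)%R : RT).
  exact: measurable_funB.
pose s : {mfun RT >-> RT} := HB.pack (fun x : RT => (x - a)%R : RT)
  (isMeasurableFun.Build _ _ _ _ _ ms).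
rewrite [RHS](eq_measure_integral (image_measure (@lebesgue_measure R) s)).
  by rewrite ge0_integral_pushforward.
move=> A mA _; apply: lebesgue_measure_unique mA => X [[x y] _ <-] /=.
rewrite /image_measure /pushforward.
rewrite (_ : s @^-1` _ = `](x + a)%R, (y + a)%R]%classic); last first.
  by apply/seteqP; split => t /=; rewrite !in_itv/= ltrBrDr lerBlDr.
rewrite !lebesgue_measure_itv/= !lte_fin ltrD2r; case: ifP => // _.
by rewrite -!EFinB; congr _%:E; ring.
Qed.

Local Notation tm := (tuple_measure (@lebesgue_measure R)).

Definition shift_tuple n (a t : n.-tuple RT) : n.-tuple RT :=
  [tuple (tnth t i - tnth a i)%R | i < n].

Lemma measurable_shift_tuple n (a : n.-tuple RT) : measurable_fun setT (shift_tuple a).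
Proof.
apply/measurable_fun_tnthP => i.
rewrite (_ : _ \o _ = fun t : n.-tuple RT => (tnth t i - tnth a i)%R).
  apply: measurable_funB => //; exact: measurable_tnth.
by apply/funext => t /=; rewrite tnth_mktuple.
Qed.

Lemma shift_tuple_cons n (a : n.+1.-tuple RT) x (t : n.-tuple RT) :
  shift_tuple a [tuple of x :: t] =
  [tuple of (x - thead a)%R :: shift_tuple [tuple of behead a] t].
Proof.
apply/eq_from_tnth => i; rewrite tnth_mktuple; case: (unliftP ord0 i) => [j|] ->.
  by rewrite !tnthS tnth_mktuple; congr (_ - _)%R; rewrite [in LHS](tuple_eta a) tnthS.
by [].
Qed.

Lemma tuple_integral_shift n (f : n.-tuple RT -> \bar R) (a : n.-tuple RT) :
  measurable_fun setT f -> (forall x, 0 <= f x) ->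
  \int[tm n]_t f (shift_tuple a t) = \int[tm n]_t f t.
Proof.
elim: n f a => [|n IH] f a mf f0.
  by apply: eq_integral => t _; rewrite (tuple0 t) (tuple0 (shift_tuple _ _)).
have mfs : measurable_fun setT (fun t => f (shift_tuple a t)).
  by apply: measurableT_comp => //; exact: measurable_shift_tuple.
have mfx x : measurable_fun setT (fun t : n.-tuple RT => f [tuple of x :: t]).
  by apply: measurableT_comp => //; exact: measurable_consx.
rewrite !tuple_integralS1//.
pose F x := \int[tm n]_t f [tuple of x :: t].
rewrite -(@lebesgue_integral_shift F (thead a)).
- apply: eq_integral => x _; under eq_integral do rewrite shift_tuple_cons.
  exact: (IH (fun t => f [tuple of (x - thead a)%R :: t])).
- exact: measurable_tuple_integral.
- by move=> x; exact: integral_ge0.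
Qed.

Variable d : nat.
Local Notation leb := (@lebesgue_rV R d).

Lemma lebesgue_rV_integral_shift (f : 'rV[R]_d -> \bar R) (a : 'rV[R]_d) :
  measurable_fun setT f -> (forall x, 0 <= f x) ->
  \int[leb]_x f (x - a)%R = \int[leb]_x f x.
Proof.
move=> mf f0; have mrow := @measurable_row_of_tuple R d.
have mfr : measurable_fun setT (f \o @row_of_tuple R d) by exact: measurableT_comp.
have E (t : d.-tuple RT) : (row_of_tuple t - a)%R = row_of_tuple (shift_tuple (tuple_of_row a) t).
  by apply/rowP => i; rewrite !mxE !tnth_mktuple.
have msh : measurable_fun setT (fun x : 'rV[R]_d => (x - a)%R).
  rewrite (_ : (fun x => _) = (fun x => row_of_tuple (shift_tuple (tuple_of_row a) (tuple_of_row x)))).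
    apply: measurableT_comp => //; apply: measurableT_comp.
      exact: measurable_shift_tuple.
    exact: measurable_tuple_of_row.
  by apply/funext => x; rewrite -E; congr (_ - _)%R; apply/rowP => i; rewrite mxE tnth_mktuple.
rewrite ge0_integral_pushforward//; last exact: measurableT_comp.
rewrite [RHS]ge0_integral_pushforward// preimage_setT.
under eq_integral do rewrite /= E.
apply: (@tuple_integral_shift d (f \o @row_of_tuple R d) (tuple_of_row a)) => // t.
exact: f0.
Qed.

Lemma measurable_set1_rV (a : 'rV[R]_d) : measurable [set a].
Proof.
rewrite (_ : [set a] = \bigcap_(i in [set: 'I_d])
    [set x : 'rV[R]_d | x ord0 i = a ord0 i]); last first.
  apply/seteqP; split=> [x -> //|x /= xa].
  by apply/rowP => i; exact: xa.
apply: fin_bigcap_measurable => // i _.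
have := @measurable_coord R d i measurableT [set a ord0 i] (measurable_set1 _).
by rewrite setTI.
Qed.

End LebesgueTranslation.

(** The preimage of a point lies over a single value of the first coordinate. For [d = 0] the only
    point would have mass 1. *)
Lemma lebesgue_rV_set1 (R : realType) (d : nat) (a : 'rV[R]_d) : (0 < d)%N ->
  @lebesgue_rV R d [set a] = 0%E.
Proof.
case: d a => // d a _; apply/eqP; rewrite eq_le measure_ge0 andbT.
rewrite /lebesgue_rV /image_measure /pushforward /=.
rewrite /tuple_measureS /image_measure /pushforward /product_sfm.
set A := _ @^-1` _; have mA : measurable A.
  rewrite -[A]setTI; apply: measurable_funPT => //.
  rewrite -[X in measurable X]setTI; apply: measurable_funPT => //.
  exact: measurable_set1_rV.
apply: (@le_trans _ _ ((@lebesgue_measure R \x tuple_measure (@lebesgue_measure R) d)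
    ([set a ord0 ord0] `*` setT))%E).
  apply: le_measure; rewrite ?inE//.
    exact: measurableX.
  move=> [x t] /= /rowP/(_ ord0); rewrite mxE => xa; split=> //=.
rewrite product_measure1E// [X in (X * _)%E](_ : _ = 0%E) ?mul0e//.
exact: lebesgue_measure_set1.
Qed.

(** * The Lebesgue-Poisson measure through tuples of distinct points *)

Section ConfigurationMeasure.
Context (R : realType) (d : nat).
Hypothesis d_gt0 : (0 < d)%N.
Local Notation rV := 'rV[R]_d.
Local Notation leb := (@lebesgue_rV R d).
Local Notation tm := (tuple_measure leb).
Local Notation G0 := (Gamma0 R d).
Local Notation lp := (lebesgue_poisson R d).
Local Notation lw := (lebesgue_poisson_weight R d).
Local Open Scope ereal_scope.

Lemma uniq_size_undup (T : eqType) (s : seq T) : uniq s = (size (undup s) == size s).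
Proof.
apply/idP/eqP => [/undup_id->//|/eqP]; rewrite eq_sym; apply: contraTT => ns.
by rewrite gtn_eqF// ltn_size_undup.
Qed.

Lemma measurable_uniq n : measurable [set t : n.-tuple rV | uniq t].
Proof.
have := @measurable_size_undup R d n measurableT [set n%:R] (measurable_set1 _).
rewrite setTI; congr measurable; apply/seteqP; split=> t /=.
  by move/eqP; rewrite eqr_nat uniq_size_undup size_tuple.
by rewrite uniq_size_undup size_tuple => /eqP ->.
Qed.

Lemma seq_null (s : seq rV) : measurable [set x | x \in s] /\ leb [set x | x \in s] = 0.
Proof.
elim: s => [|a s [ms s0]].
  by rewrite (_ : [set x | _] = set0) ?measure0//; apply/seteqP; split.
rewrite (_ : [set x | _] = [set a] `|` [set x | x \in s]); last first.
  apply/seteqP; split=> x /=; rewrite inE.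
    by case/predU1P => [->|]; [left|right].
  by case=> [->|->]; rewrite ?eqxx ?orbT.
have ma := measurable_set1_rV a.
split; first exact: measurableU.
by rewrite measureU0//; exact: lebesgue_rV_set1.
Qed.

(** Over a tail without repetition the head must hit one of finitely many points, a null set; the
    other tails are null by induction. Hence the tail is taken as the outer variable, by
    [tuple_integralS2]. *)
Lemma not_uniq_null n : tm n (~` [set t : n.-tuple rV | uniq t]) = 0.
Proof.
elim: n => [|n IH].
  rewrite (_ : ~` _ = set0) ?measure0//; apply/seteqP; split=> // t /=.
  by rewrite (tuple0 t).
have mN k : measurable (~` [set t : k.-tuple rV | uniq t]) by apply: measurableC; exact: measurable_uniq.
transitivity (\int[tm n.+1]_t (\1_(~` [set t : n.+1.-tuple rV | uniq t]) t)%:E).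
  by rewrite integral_indic ?setIT//; exact: mN.
have mI : measurable_fun setT (fun t : n.+1.-tuple rV =>
    (\1_(~` [set t : n.+1.-tuple rV | uniq t]) t)%:E : \bar R).
  by apply/measurable_EFinP; apply: measurable_indic; exact: mN.
rewrite tuple_integralS2//.
transitivity (\int[tm n]_t (cst 0) t); last exact: integral0.
apply: ae_eq_integral => //.
- apply: (@measurable_fun_fubini_tonelli_G _ _ _ _ _ leb
   (fun p : rV * n.-tuple rV => (\1_(~` [set t : n.+1.-tuple rV | uniq t]) (Defs.cons_tuple p))%:E)).
    apply: (measurableT_comp mI); exact: Defs.measurable_cons_tuple.
  by move=> x; rewrite lee_fin.
- exists (~` [set t : n.-tuple rV | uniq t]); split; [exact: mN|exact: IH|].
  move=> t /=; apply: contra_not => ut _.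
  have [ms s0] := seq_null t.
  transitivity (\int[leb]_x (\1_[set x | x \in tval t] x)%:E); last first.
    by rewrite integral_indic ?setIT//; exact: mN.
  apply: eq_integral => x _; rewrite !indicE; congr (_%:R)%:E.
  rewrite in_setC; congr nat_of_bool.
  apply/idP/idP.
    move=> /negP H; rewrite inE/=; apply: contrapT => xt; apply: H.
    by rewrite inE /= ut andbT; exact/negP.
  by rewrite inE /= => xt; apply/negP; rewrite inE/= xt.
Qed.

Lemma tuple_integral_uniq n (D : set (n.-tuple rV)) (f g : n.-tuple rV -> \bar R) :
  measurable D -> measurable_fun setT f -> measurable_fun setT g ->
  (forall t : n.-tuple rV, uniq t -> f t = g t) ->
  \int[tm n]_(t in D) f t = \int[tm n]_(t in D) g t.
Proof.
move=> mD mf mg fg; apply: ae_eq_integral => //.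
- exact: measurable_funTS.
- exact: measurable_funTS.
- exists (~` [set t : n.-tuple rV | uniq t]); split.
  + by apply: measurableC; exact: measurable_uniq.
  + exact: not_uniq_null.
  + by move=> t /=; apply: contra_not => ut _; exact: fg.
Qed.

(** A tuple with a repeated entry has the same configuration as the tuple with that entry deleted,
    and deletion is measurable. Induction on the length reduces everything to distinct entries. *)
Lemma config_measurable_uniq (A : set G0) :
  (forall n, measurable ([set t : n.-tuple rV | uniq t] `&` @config R d n @^-1` A)) ->
  measurable A.
Proof.
move=> mA; suff : Gamma0_measurable A by [].
elim=> [|n IH].
  have := mA 0%N; congr measurable; apply/seteqP; split=> t /=; first by case.
  by move=> At; split=> //; rewrite (tuple0 t).
pose del (i : 'I_n.+1) (t : n.+1.-tuple rV) : n.-tuple rV := [tuple tnth t (lift i j) | j < n].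
have mdel i : measurable_fun setT (del i).
  apply/measurable_fun_tnthP => j.
  rewrite (_ : _ \o _ = fun t : n.+1.-tuple rV => tnth t (lift i j)).
    exact: (@measurable_tnth _ rV n.+1 (lift i j)).
  by apply/funext => t /=; rewrite tnth_mktuple.
have E : config (n:=n.+1) @^-1` A = ([set t : n.+1.-tuple rV | uniq t] `&` config (n:=n.+1) @^-1` A) `|`
   \bigcup_(ij in [set: 'I_n.+1 * 'I_n])
     ([set t : n.+1.-tuple rV | tnth t ij.1 = tnth t (lift ij.1 ij.2)] `&`
      (del ij.1 @^-1` (config (n:=n) @^-1` A))).
  have delE (t : n.+1.-tuple rV) (i : 'I_n.+1) (j : 'I_n) : tnth t i = tnth t (lift i j) ->
      config (del i t) = config t.
    move=> tij; apply/fsetP => y; rewrite !inE; apply/tnthP/tnthP => -[k ->].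
      by exists (lift i k); rewrite tnth_mktuple.
    have [l ->|->] := unliftP i k; first by exists l; rewrite tnth_mktuple.
    by exists j; rewrite tnth_mktuple.
  apply/seteqP; split=> t /=.
    move=> At; have [ut|] := boolP (uniq t); [by left|move=> nut; right].
    have /(uniqPn 0%R)[i [j [ij jn tij]]] := nut.
    rewrite size_tuple in jn; have i_n : (i < n.+1)%N by apply: ltn_trans jn.
    have [k jk|ji] := unliftP (Ordinal i_n) (Ordinal jn); last first.
      by move: ij; have /= -> := congr1 val ji; rewrite ltnn.
    have e : tnth t (Ordinal i_n) = tnth t (lift (Ordinal i_n) k).
      by rewrite -jk !(tnth_nth 0%R).
    by exists (Ordinal i_n, k) => //=; split=> //; rewrite (delE _ _ _ e).
  by case=> [[]//|[[i j] _ /= [tij]]]; rewrite (delE _ _ _ tij).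
rewrite E; apply: measurableU; first exact: mA.
apply: fin_bigcup_measurable => //.
move=> [i j] _ /=; apply: measurableI; first exact: measurable_eq_coord.
by rewrite -[X in measurable X]setTI; exact: mdel.
Qed.

Lemma measurable_fun_config d' (Y : measurableType d') (f : G0 -> Y) :
  (forall n, exists2 g : n.-tuple rV -> Y, measurable_fun setT g &
    forall t : n.-tuple rV, uniq t -> f (config t) = g t) -> measurable_fun setT f.
Proof.
move=> H _ B mB; rewrite setTI; apply: config_measurable_uniq => n.
have [g mg fg] := H n.
rewrite (_ : _ `&` _ = [set t : n.-tuple rV | uniq t] `&` (g @^-1` B)).
  apply: measurableI; first exact: measurable_uniq.
  by rewrite -[X in measurable X]setTI; exact: mg.
by apply/seteqP; split=> t /= [ut]; rewrite fg.
Qed.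

Lemma card_config_uniq n (t : n.-tuple rV) : uniq t -> #|` config t| = n.
Proof. by move=> ut; rewrite card_config undup_id// size_tuple. Qed.

Lemma lebesgue_poisson_weightE (c : {posnum R}) (A : set G0) : measurable A ->
  lw c A = \sum_(0 <= n <oo) (c%:num ^+ n / n`!%:R)%:E * tm n (@config R d n @^-1` A).
Proof.
move=> mA; have mc := @measurable_config R d.
have mcard : measurable_fun [set: G0] (fun eta : G0 => (c%:num ^+ #|` eta|)%:E).
  by apply/measurable_EFinP; exact: (@measurable_card R d (fun n => c%:num ^+ n)%R).
have cge0 (eta : G0) : 0 <= (c%:num ^+ #|` eta|)%:E by rewrite lee_fin exprn_ge0.
rewrite /lebesgue_poisson_weight ge0_integral_measure_series//; last exact: measurable_funTS.
apply: eq_eseriesr => n _; rewrite ge0_integral_mscale//; last exact: measurable_funTS.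
rewrite ge0_integral_pushforward//; last exact: measurable_funTS.
have mD : measurable (config (n:=n) @^-1` A) by rewrite -[X in measurable X]setTI; exact: mc.
rewrite (@tuple_integral_uniq n _ _ (cst (c%:num ^+ n)%:E))//.
- by rewrite integral_cst//= muleA -EFinM mulrC.
- exact: measurableT_comp.
- by move=> t ut /=; rewrite card_config_uniq.
Qed.

(** On configurations of [n] distinct points the density is the constant [c^n], so the weighted
    measure is again a series of images of tuple measures, now with coefficients [c^n / n!]. *)
Lemma integral_weight (c : {posnum R}) (u : G0 -> \bar R) :
  measurable_fun setT u -> (forall eta, 0 <= u eta) ->
  \int[lw c]_eta u eta =
  \sum_(0 <= n <oo) (c%:num ^+ n / n`!%:R)%:E * \int[tm n]_t u (config t).
Proof.
move=> mu u0; have mc := @measurable_config R d.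
have k0 n : (0 <= c%:num ^+ n / n`!%:R)%R by rewrite divr_ge0// exprn_ge0.
pose k n := NngNum (k0 n).
rewrite (eq_measure_integral (mseries (fun n => mscale (k n)
    (image_measure (tm n) (@config R d n))) 0)); last first.
  by move=> A mA _; exact: lebesgue_poisson_weightE.
rewrite ge0_integral_measure_series//; apply: eq_eseriesr => n _.
by rewrite ge0_integral_mscale// ge0_integral_pushforward.
Qed.

End ConfigurationMeasure.

(** * Sums over the subsets of a finite set *)

Section FinsetSums.
Local Open Scope fset_scope.
Local Open Scope ring_scope.

Lemma big_fpowersetU1 (K : choiceType) (V : nmodType) (a : K) (A : {fset K}) (F : {fset K} -> V) :
  a \notin A -> \sum_(xi <- fpowerset (a |` A)) F xi =
    \sum_(xi <- fpowerset A) F xi + \sum_(xi <- fpowerset A) F (a |` xi).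
Proof.
move=> aA; rewrite -[X in _ = _ + X](big_map (fun xi => a |` xi) xpredT F) -big_cat.
apply: perm_big; apply: uniq_perm; rewrite ?fset_uniq//.
  rewrite cat_uniq fset_uniq map_inj_in_uniq ?fset_uniq ?andbT /=.
    apply/hasPn => _ /mapP[xi _ ->]; apply/negP; rewrite /= fpowersetE => /fsubsetP/(_ a).
    by rewrite !inE eqxx => /(_ isT); apply/negP.
  move=> xi zeta; rewrite !fpowersetE => /fsubsetP xA /fsubsetP zA /fsetP E.
  apply/fsetP => y; have := E y; rewrite !inE; have [->|//] := eqVneq y a.
  by move=> _; rewrite (contraNF (xA a) aA) (contraNF (zA a) aA).
move=> xi; rewrite mem_cat fpowersetE; apply/idP/orP.
  move=> xA; have [axi|axi] := boolP (a \in xi); [right|left].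
    apply/mapP; exists (xi `\ a); last by rewrite fsetD1K.
    by rewrite fpowersetE fsubDset.
  rewrite fpowersetE; apply/fsubsetP => y yxi; have := fsubsetP xA y yxi.
  by rewrite !inE => /predU1P[ya|//]; rewrite -ya yxi in axi.
case=> [|/mapP[zeta]]; rewrite fpowersetE.
  by move/fsubset_trans; apply; exact: fsubsetU1.
by move=> zA ->; exact: fsetUS.
Qed.

End FinsetSums.

Section SubsetSumFinset.
Context d (T : measurableType d) (R : realType).
Local Open Scope ereal_scope.

Lemma eq_subset_sum (w : T -> R) (g g' : seq T -> \bar R) s :
  (forall l, subseq l s -> g l = g' l) -> subset_sum w g s = subset_sum w g' s.
Proof.
elim: s g g' => [|a s IH] g g' gg' /=; first exact: gg'.
congr (_ + _ * _); apply: IH => l ls; apply: gg'; first by rewrite /= eqxx.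
exact: subseq_trans ls (subseq_cons _ _).
Qed.

(** Carries the sum over subsets in the operator to the list recursion, which can be integrated
    coordinate by coordinate. Without repetitions the subsequences of [s] correspond to the
    subsets. *)
Lemma sum_fpowerset_subset_sum (w : T -> R) (G : {fset T} -> \bar R) s :
  (forall x, (0 <= w x)%R) -> (forall xi, 0 <= G xi) -> uniq s ->
  \sum_(xi <- fpowerset [fset x in s]%fset)
     (\prod_(a <- ([fset x in s] `\` xi)%fset) w a)%R%:E * G xi =
  subset_sum w (fun l => G [fset x in l]%fset) s.
Proof.
move=> w0; elim: s G => [|a s IH] G G0 /=.
  move=> _; have -> : [fset x in [::]]%fset = fset0 :> {fset T}.
    by apply/fsetP => y; rewrite !inE.
  by rewrite fpowerset0 big_seq_fset1 fsetD0 big_seq_fset0 mul1e.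
move=> /andP[aS us].
have E l : [fset x in a :: l]%fset = (a |` [fset x in l])%fset :> {fset T}.
  by apply/fsetP => y; rewrite !inE.
have aA : a \notin [fset x in s]%fset by rewrite inE.
rewrite E big_fpowersetU1// addeC; congr (_ + _).
  under [RHS]eq_subset_sum do rewrite E.
  rewrite -(IH (fun xi => G (a |` xi)%fset))//.
  apply: eq_big_seq => xi; rewrite fpowersetE => /fsubsetP xA.
  congr ((\prod_(_ <- enum_fset _) _)%:E * _); apply/fsetP => y; rewrite !inE.
  have [->|] := eqVneq y a; last by [].
  by rewrite (negbTE aS) andbF.
rewrite -IH// ge0_sume_distrr; last first.
  by move=> xi _; rewrite mule_ge0// lee_fin prodr_ge0.
apply: eq_big_seq => xi; rewrite fpowersetE => /fsubsetP xA; rewrite muleA -EFinM.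
congr (_%:E * _).
have -> : ((a |` [fset x in s]) `\` xi = a |` ([fset x in s] `\` xi))%fset.
  apply/fsetP => y; rewrite !inE; have [->|//] := eqVneq y a.
  by rewrite orTb andbT /=; apply: contraNN aA => /xA.
by rewrite big_fsetU1//= !inE (negbTE aS) andbF.
Qed.

End SubsetSumFinset.

(** * The operator with nonnegative kernel and its relative bound *)

Section PositiveOperator.
Context (R : realType) (d : nat).
Hypothesis d_gt0 : (0 < d)%N.
Local Notation rV := 'rV[R]_d.
Local Notation leb := (@lebesgue_rV R d).
Local Notation tm := (tuple_measure leb).
Local Notation G0 := (Gamma0 R d).
Local Notation lw := (lebesgue_poisson_weight R d).
Local Open Scope ereal_scope.

Lemma measurable_rV_sub : measurable_fun setT (fun p : rV * rV => (p.1 - p.2)%R).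
Proof.
rewrite (_ : (fun p => _) = (fun p : rV * rV => row_of_tuple
   ([tuple (p.1 ord0 i - p.2 ord0 i)%R | i < d] : d.-tuple (measurableTypeR R)))); last first.
  by apply/funext => p; apply/rowP => i; rewrite !mxE tnth_mktuple.
apply: measurableT_comp; first exact: measurable_row_of_tuple.
apply/measurable_fun_tnthP => i.
rewrite (_ : _ \o _ = fun p : rV * rV => (p.1 ord0 i - p.2 ord0 i)%R); last first.
  by apply/funext => p /=; rewrite tnth_mktuple.
by apply: measurable_funB; apply: (measurableT_comp (measurable_coord i)).
Qed.

Variables (phi : rV -> R) (M : R).
Hypotheses (mphi : measurable_fun setT phi) (phi_ge0 : forall x, (0 <= phi x)%R).
Hypothesis phi_even : forall x, phi (- x)%R = phi x.
Hypothesis phiM : \int[leb]_x (1 - expR (- phi x))%:E = M%:E.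

Definition mayer y a : R := (1 - expR (- phi (y - a)))%R.

Let mayer_ge0 y a : (0 <= mayer y a)%R.
Proof. by rewrite /mayer subr_ge0 -expR0 ler_expR oppr_le0. Qed.

Let M_ge0 : (0 <= M)%R.
Proof.
rewrite -lee_fin -phiM; apply: integral_ge0 => x _.
by rewrite lee_fin subr_ge0 -expR0 ler_expR oppr_le0.
Qed.

Lemma measurable_phi_sub : measurable_fun setT (fun p : rV * rV => phi (p.1 - p.2)).
Proof. by apply: (measurableT_comp mphi); exact: measurable_rV_sub. Qed.

Let measurable_mayer : measurable_fun setT (fun p : rV * rV => mayer p.1 p.2).
Proof.
apply: measurable_funB => //; apply: measurableT_comp => //.
by apply: measurableT_comp => //; exact: measurable_phi_sub.
Qed.

(** Evenness turns [y - a] into [a - y], after which the integral over [a] is a translate of the one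
    defining [M]. *)
Let integral_mayer y : \int[leb]_a (mayer y a)%:E = M%:E.
Proof.
rewrite -phiM -(@lebesgue_rV_integral_shift _ _ (fun x => (1 - expR (- phi x))%:E) y).
- apply: eq_integral => a _; rewrite /mayer; congr (1 - expR (- _))%:E.
  by rewrite -phi_even opprB.
- apply/measurable_EFinP; apply: measurable_funB => //; apply: measurableT_comp => //.
  exact: measurableT_comp.
- by move=> x; rewrite lee_fin subr_ge0 -expR0 ler_expR oppr_le0.
Qed.

Definition pos_kernel (eta xi : G0) (y : rV) : R :=
  (expR (- Ephi phi y xi) * \prod_(a <- (eta `\` xi)%fset) mayer y a)%R.

(** [B] with the absolute value of its kernel and without [z]. Values in [\bar R] make it meaningful
    for all measurable nonnegative functions, before any integrability is known. *)
Definition pos_op (u : G0 -> \bar R) (eta : G0) : \bar R :=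
  \sum_(xi <- fpowerset eta) \int[leb]_y ((pos_kernel eta xi y)%:E * u (y |` xi)%fset).

Lemma pos_kernel_ge0 eta xi y : (0 <= pos_kernel eta xi y)%R.
Proof. by rewrite mulr_ge0// ?expR_ge0// prodr_ge0. Qed.

Lemma measurable_phi_subl (a : rV) : measurable_fun setT (fun y : rV => phi (y - a)).
Proof. by have := measurable_fun_pair1 a measurable_phi_sub. Qed.

Lemma measurable_pos_kernel eta xi : measurable_fun setT (pos_kernel eta xi).
Proof.
apply: measurable_funM.
  apply: measurableT_comp => //; apply: measurableT_comp => //.
  by apply: measurable_sum => a; exact: measurable_phi_subl.
apply: measurable_prod => a _.
exact: (measurable_fun_pair1 a measurable_mayer).
Qed.

Lemma measurable_fsetU1 d' (Y : measurableType d') (u : G0 -> Y) (xi : G0) :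
  measurable_fun setT u -> measurable_fun setT (fun y : rV => u (y |` xi)%fset).
Proof.
move=> mu; pose t := in_tuple (xi : seq rV).
rewrite (_ : (fun y => _) = (fun y => u (config [tuple of y :: t]))).
  apply: (measurableT_comp mu); apply: measurableT_comp; first exact: measurable_config.
  exact: measurable_xcons.
by apply/funext => y; congr u; apply/fsetP => z; rewrite !inE.
Qed.

(** The energy is summed over the list itself, which makes it measurable in the tuple; it equals the
    energy of the configuration as soon as the list has no repetition. *)
Let gk (u : G0 -> \bar R) (y : rV) (l : seq rV) : \bar R :=
  (expR (- \sum_(a <- l) phi (y - a)))%:E * u [fset z in y :: l]%fset.

Variable u : G0 -> \bar R.
Hypotheses (mu : measurable_fun setT u) (u0 : forall eta, 0 <= u eta).

Lemma pos_op_ge0 eta : 0 <= pos_op u eta.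
Proof.
apply: sume_ge0 => xi _; apply: integral_ge0 => y _.
by rewrite mule_ge0// lee_fin pos_kernel_ge0.
Qed.

Let pos_op_config n (t : n.-tuple rV) : uniq t ->
  pos_op u (config t) = \int[leb]_y subset_sum (mayer y) (gk u y) t.
Proof.
move=> ut; rewrite /pos_op -ge0_integral_sum//; last 2 first.
- move=> xi; apply: emeasurable_funM; last exact: measurable_fsetU1.
  by apply/measurable_EFinP; exact: measurable_pos_kernel.
- by move=> xi y _; rewrite mule_ge0// lee_fin pos_kernel_ge0.
apply: eq_integral => y _.
rewrite -(@eq_subset_sum _ _ _ _ (fun l => (expR (- Ephi phi y [fset x in l]%fset))%:E *
   u (y |` [fset x in l])%fset)); last first.
  move=> l lt; have ul := subseq_uniq lt ut; congr ((expR (- _))%:E * u _).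
    rewrite /Ephi; apply: perm_big; apply: uniq_perm; rewrite ?fset_uniq// => z.
    by rewrite !inE.
  by apply/fsetP => z; rewrite !inE.
rewrite -(@sum_fpowerset_subset_sum _ _ _ _ (fun xi => (expR (- Ephi phi y xi))%:E *
   u (y |` xi)%fset))//; last by move=> xi; rewrite mule_ge0// lee_fin expR_ge0.
by apply: eq_bigr => xi _; rewrite /pos_kernel muleA -EFinM mulrC.
Qed.

Let measurable_ucons n : measurable_fun setT
  (fun p : rV * n.-tuple rV => u [fset z in p.1 :: p.2]%fset).
Proof.
apply: (@measurableT_comp _ _ _ _ _ _ u _ (fun p : rV * n.-tuple rV => config [tuple of p.1 :: p.2])) => //.
apply: measurableT_comp; first exact: measurable_config.
exact: measurable_cons.
Qed.

Let measurable_gk n : measurable_fun setT (fun p : rV * n.-tuple rV => gk u p.1 p.2).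
Proof.
apply: emeasurable_funM; last exact: measurable_ucons.
apply/measurable_EFinP; apply: measurableT_comp => //; apply: measurableT_comp => //.
rewrite (_ : (fun p => _) = (fun p : rV * n.-tuple rV => \sum_(i < n) phi (p.1 - tnth p.2 i)))%R.
  apply: measurable_sum => i.
  apply: (@measurableT_comp _ _ _ _ _ _ (fun p : rV * rV => phi (p.1 - p.2)%R) _
    (fun p : rV * n.-tuple rV => (p.1, tnth p.2 i))); first exact: measurable_phi_sub.
  apply: measurable_fun_pair => //.
  by apply: (@measurableT_comp _ _ _ _ _ _ (fun t : n.-tuple rV => tnth t i)) => //; exact: measurable_tnth.
by apply/funext => p; rewrite big_tuple.
Qed.

Let measurable_ssgk n : measurable_fun setT
  (fun p : rV * n.-tuple rV => subset_sum (mayer p.1) (gk u p.1) p.2).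
Proof.
by apply: (@measurable_subset_sum _ _ R _ _ (fun p => mayer p.1 p.2)).
Qed.

Let gk_ge0 y l : 0 <= gk u y l.
Proof. by rewrite mule_ge0// lee_fin expR_ge0. Qed.

Lemma measurable_pos_op : measurable_fun setT (pos_op u).
Proof.
apply: measurable_fun_config => // n.
exists (fun t : n.-tuple rV => \int[leb]_y subset_sum (mayer y) (gk u y) t); last exact: pos_op_config.
apply: (@measurable_fun_fubini_tonelli_G _ _ _ _ _ leb
  (fun p : rV * n.-tuple rV => subset_sum (mayer p.1) (gk u p.1) p.2)).
  exact: measurable_ssgk.
by move=> p; exact: subset_sum_ge0.
Qed.

(** Tonelli makes [y] the outer variable. For fixed [y] every Mayer factor integrates to [M], so
    [integral_subset_sum] applies, and [y] joins the remaining [k] points in a tuple of length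
    [k.+1]. *)
Let tuple_pos_op n :
  \int[tm n]_t pos_op u (config t) <=
  \sum_(k < n.+1) ('C(n, k)%:R * M ^+ (n - k))%:E * \int[tm k.+1]_t u (config t).
Proof.
have mc := @measurable_config R d.
have muc k : measurable_fun setT (fun t : k.-tuple rV => u (config t)) by exact: measurableT_comp.
have mss y k (g : seq rV -> \bar R) : (forall n, measurable_fun setT (fun t : n.-tuple rV => g t)) ->
    measurable_fun setT (fun t : k.-tuple rV => subset_sum (mayer y) g t).
  move=> mg; apply: (@measurable_fun_pair2 _ _ _ _ _ _ (fun p : rV * k.-tuple rV =>
     subset_sum (mayer p.1) g p.2) y).
  apply: (@measurable_subset_sum _ _ R _ _ (fun p => mayer p.1 p.2) (fun _ => g)) => // j.
  by apply: (@measurableT_comp _ _ _ _ _ _ (fun t : j.-tuple rV => g t)) => //; exact: mg.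
have mgy y k : measurable_fun setT (fun t : k.-tuple rV => u [fset z in y :: t]%fset).
  apply: (@measurable_fun_pair2 _ _ _ _ _ _ (fun p : rV * k.-tuple rV => u [fset z in p.1 :: p.2]%fset) y).
  exact: measurable_ucons.
have mgky y k : measurable_fun setT (fun t : k.-tuple rV => gk u y t).
  apply: (@measurable_fun_pair2 _ _ _ _ _ _ (fun p : rV * k.-tuple rV => gk u p.1 p.2) y).
  exact: measurable_gk.
have mI k : measurable_fun setT (fun y => \int[tm k]_t u [fset z in y :: t]%fset).
  by apply: (@measurable_tuple_integral _ _ _ leb k (fun t => u (config t))).
pose h t := \int[leb]_y subset_sum (mayer y) (gk u y) t.
have mh : measurable_fun setT (fun t : n.-tuple rV => h t).
  apply: (@measurable_fun_fubini_tonelli_G _ _ _ _ _ leb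
    (fun p : rV * n.-tuple rV => subset_sum (mayer p.1) (gk u p.1) p.2)).
  exact: measurable_ssgk.
  by move=> p; exact: subset_sum_ge0.
rewrite (@tuple_integral_uniq _ _ _ _ _ _ h)//; last 2 first.
- by apply: measurableT_comp => //; exact: measurable_pos_op.
- exact: pos_op_config.
rewrite -(@fubini_tonelli _ _ _ _ _ leb (tm n)
  (fun p : rV * n.-tuple rV => subset_sum (mayer p.1) (gk u p.1) p.2)); last 2 first.
- exact: measurable_ssgk.
- by move=> p; exact: subset_sum_ge0.
apply: (@le_trans _ _ (\int[leb]_y \sum_(k < n.+1) ('C(n, k)%:R * M ^+ (n - k))%:E *
    \int[tm k]_t u [fset z in y :: t]%fset)).
  apply: ge0_le_integral => //.
  - by move=> y _; apply: integral_ge0 => t _; exact: subset_sum_ge0.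
  - apply: (@measurable_fun_fubini_tonelli_F _ _ _ _ _ (tm n)
      (fun p : rV * n.-tuple rV => subset_sum (mayer p.1) (gk u p.1) p.2)).
    exact: measurable_ssgk.
    by move=> p; exact: subset_sum_ge0.
  - by apply: emeasurable_sum => k; exact: measurable_funeM.
  - move=> y _.
    rewrite -(@integral_subset_sum _ _ _ _ (mayer y) M _ _ _ n
      (fun l => u [fset z in y :: l]%fset))//; last first.
      exact: (@measurable_fun_pair2 _ _ _ _ _ _ (fun p : rV * rV => mayer p.1 p.2) y).
    apply: ge0_le_integral => //.
    + by move=> t _; exact: subset_sum_ge0.
    + by apply: (mss y n (gk u y)) => j; exact: mgky.
    + by apply: (mss y n (fun l => u [fset z in y :: l]%fset)) => j; exact: mgy.
    (* The only loss in this computation: since [phi] is nonnegative, the Boltzmann factor is at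
       most 1. *)
    + move=> t _; apply: le_subset_sum => // l.
      rewrite /gk -[leRHS]mul1e lee_wpmul2r// lee_fin -expR0 ler_expR oppr_le0.
      by rewrite sumr_ge0.
rewrite ge0_integral_sum//; last 2 first.
- by move=> k; exact: measurable_funeM.
- move=> k y _; rewrite mule_ge0 ?integral_ge0//.
  by rewrite lee_fin mulr_ge0// exprn_ge0.
apply: lee_sum => k _; rewrite ge0_integralZl_EFin//; last 2 first.
- by move=> y _; exact: integral_ge0.
- by rewrite mulr_ge0// exprn_ge0.
by rewrite tuple_integralS1.
Qed.

(** The integrated point [y] gives [u] one point more than the [k] kept ones. Now [c^k / k!] is
    [c^-1 (k + 1)] times the coefficient [c^(k + 1) / (k + 1)!] of that larger configuration, whence
    the factors [c^-1] and [|eta|]; the points not kept contribute [expR (c M)]. *)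
Lemma pos_op_bound (c : {posnum R}) :
  \int[lw c]_eta pos_op u eta <=
  (expR (c%:num * M) / c%:num)%:E * \int[lw c]_eta (#|` eta|%:R%:E * u eta).
Proof.
have mc := @measurable_config R d.
have mcard : measurable_fun [set: G0] (fun eta : G0 => (#|` eta|%:R : R)%:E).
  by apply/measurable_EFinP; exact: (@measurable_card R d (fun n => n%:R)).
have mcu : measurable_fun [set: G0] (fun eta : G0 => #|` eta|%:R%:E * u eta).
  exact: emeasurable_funM.
pose I k := \int[tm k]_t u (config t).
have I0 k : 0 <= I k by exact: integral_ge0.
have c0 n : (0 <= c%:num ^+ n / n`!%:R)%R by rewrite divr_ge0// exprn_ge0.
have cu0 eta : 0 <= #|` eta|%:R%:E * u eta by rewrite mule_ge0// lee_fin.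
rewrite [leLHS]integral_weight//; last 2 first.
- exact: measurable_pos_op.
- exact: pos_op_ge0.
rewrite integral_weight//.
apply: (@le_trans _ _ (\sum_(0 <= n <oo) (c%:num ^+ n / n`!%:R)%:E *
   \sum_(k < n.+1) ('C(n, k)%:R * M ^+ (n - k))%:E * I k.+1)).
  apply: lee_nneseries => n _.
    by move=> _; rewrite mule_ge0 ?lee_fin ?integral_ge0// => t _; exact: pos_op_ge0.
  by rewrite lee_wpmul2l ?lee_fin//; exact: tuple_pos_op.
rewrite (@nneseries_binomial_exp _ _ _ (fun k => I k.+1))// EFinM -muleA lee_wpmul2l ?lee_fin ?expR_ge0//.
have J0 k : 0 <= (c%:num ^+ k / k`!%:R)%:E *
    \int[tm k]_t (#|` config t|%:R%:E * u (config t)).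
  by rewrite mule_ge0 ?lee_fin// integral_ge0.
rewrite -nneseriesZl; last by move=> k _; exact: J0.
have cJ0 k : 0 <= c%:num^-1%:E * ((c%:num ^+ k / k`!%:R)%:E *
    \int[tm k]_t (#|` config t|%:R%:E * u (config t))).
  by rewrite mule_ge0 ?lee_fin.
rewrite [leRHS](nneseries_split _ 1); last by move=> k _; exact: cJ0.
rewrite add0n big_nat1 -nneseries_addn//.
rewrite -[leLHS]add0e leeD//.
apply: lee_nneseries => k _; first by move=> _; rewrite mule_ge0 ?lee_fin.
rewrite addn1 (@tuple_integral_uniq _ _ _ _ _ _ (fun t => k.+1%:R%:E * u (config t)))//; last 3 first.
- exact: (measurableT_comp mcu (mc k.+1)).
- by apply: measurable_funeM; exact: (measurableT_comp mu (mc k.+1)).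
- by move=> t ut; rewrite card_config_uniq.
rewrite ge0_integralZl_EFin//; last exact: (measurableT_comp mu (mc k.+1)).
rewrite !muleA -!EFinM le_eqVlt; apply/orP; left; apply/eqP; congr (_%:E * _).
rewrite factS natrM exprS.
have k0 : k`!%:R != 0%R :> R by rewrite pnatr_eq0 -lt0n fact_gt0.
have k1 : k.+1%:R != 0%R :> R by rewrite pnatr_eq0.
move: k0 k1; move: (k`!%:R) (k.+1%:R) => q p q0 p0.
by field; rewrite p0 q0 gt_eqF.
Qed.

End PositiveOperator.

(** * The signed operator recovered from positive parts *)

Section SignedOperator.
Context (R : realType) (d : nat).
Hypothesis d_gt0 : (0 < d)%N.
Local Notation rV := 'rV[R]_d.
Local Notation leb := (@lebesgue_rV R d).
Local Notation G0 := (Gamma0 R d).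
Implicit Types (G : G0 -> R) (eta xi : G0).

Variable phi : rV -> R.
Hypotheses (mphi : measurable_fun setT phi) (phi_ge0 : forall x, 0 <= phi x).
Local Notation kern := (pos_kernel phi).

Lemma prodr_opp_seq (I : Type) (s : seq I) (F : I -> R) :
  \prod_(i <- s) - F i = (-1) ^+ size s * \prod_(i <- s) F i.
Proof.
elim: s => [|i s IH]; first by rewrite !big_nil mulr1.
by rewrite !big_cons IH exprS; ring.
Qed.

Definition csign eta : R := (-1) ^+ #|` eta|.

Lemma measurable_csign : measurable_fun setT csign.
Proof. exact: (@measurable_card R d (fun n => (-1) ^+ n)). Qed.

(** Parts of the conjugated function, not of [G]: after conjugation the kernel has one sign, so each
    part can be treated in [[0, +oo]] by [pos_op]. *)
Definition pos_part G eta : R := Num.max (csign eta * G eta) 0.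
Definition neg_part G eta : R := Num.max (- (csign eta * G eta)) 0.

Lemma pos_part_ge0 G eta : 0 <= pos_part G eta.
Proof. by rewrite le_max lexx orbT. Qed.

Lemma neg_part_ge0 G eta : 0 <= neg_part G eta.
Proof. by rewrite le_max lexx orbT. Qed.

Lemma sub_pos_neg_part G eta : pos_part G eta - neg_part G eta = csign eta * G eta.
Proof.
rewrite /pos_part /neg_part; set a := _ * _; have /orP[a0|a0] := le_total 0 a.
  by rewrite max_l// max_r ?subr0// oppr_le0.
by rewrite max_r// max_l ?sub0r ?opprK// oppr_ge0.
Qed.

Lemma add_pos_neg_part G eta : pos_part G eta + neg_part G eta = `|G eta|.
Proof.
have -> : `|G eta| = `|csign eta * G eta| by rewrite normrM normrX normrN1 expr1n mul1r.
rewrite /pos_part /neg_part; set a := _ * _; have /orP[a0|a0] := le_total 0 a.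
  by rewrite max_l// max_r ?addr0 ?ger0_norm// oppr_le0.
by rewrite max_r// max_l ?add0r ?ler0_norm// oppr_ge0.
Qed.

Lemma measurable_pos_part G : measurable_fun setT G -> measurable_fun setT (pos_part G).
Proof.
move=> mG; apply: measurable_maxr => //.
by apply: measurable_funM => //; exact: measurable_csign.
Qed.

Lemma measurable_neg_part G : measurable_fun setT G -> measurable_fun setT (neg_part G).
Proof.
move=> mG; apply: measurable_maxr => //; apply: measurableT_comp => //.
by apply: measurable_funM => //; exact: measurable_csign.
Qed.

(* Every new point contributes a factor [-1] to the Mayer product, so
   conjugation by [(-1) ^ |eta|] turns the operator into minus a positive one. *)
Lemma Lhat_integrandE G eta xi y : (xi `<=` eta)%fset -> y \notin xi ->
  Lhat_integrand phi G eta xi y =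
  - csign eta * (kern eta xi y * pos_part G (y |` xi)%fset -
                 kern eta xi y * neg_part G (y |` xi)%fset).
Proof.
move=> xe yx; rewrite -mulrBr sub_pos_neg_part /Lhat_integrand /pos_kernel /e_lambda.
rewrite (eq_bigr (fun a => - mayer phi y a)); last by move=> a _; rewrite /mayer opprB.
rewrite prodr_opp_seq cardfsDS// /csign cardfsU1 yx exprD expr1 -{2}(subnK (fsubset_leq_card xe)).
rewrite exprD; set n := (_ - _)%N; set m := #|` xi|.
have := sqrr_sign R m; rewrite expr2 => mm.
transitivity (((-1) ^+ m * (-1) ^+ m) * (expR (- Ephi phi y xi) * G (y |` xi)%fset *
  ((-1) ^+ n * \prod_(a <- (eta `\` xi)%fset) mayer phi y a))); first by rewrite mm mul1r.
by ring.
Qed.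

Lemma normr_Lhat_integrand G eta xi y :
  `|Lhat_integrand phi G eta xi y| = kern eta xi y * `|G (y |` xi)%fset|.
Proof.
rewrite /Lhat_integrand !normrM ger0_norm ?expR_ge0// /pos_kernel /e_lambda.
rewrite normr_prod (eq_bigr (mayer phi y)); first by ring.
move=> a _; rewrite distrC ger0_norm// subr_ge0 -expR0 ler_expR oppr_le0.
exact: phi_ge0.
Qed.

Lemma measurable_Lhat_integrand G eta xi : measurable_fun setT G ->
  measurable_fun setT (Lhat_integrand phi G eta xi).
Proof.
move=> mG; apply: measurable_funM; last first.
  apply: measurable_prod => a _; apply: measurable_funB => //.
  apply: measurableT_comp => //; apply: measurableT_comp => //.
  exact: measurable_phi_subl.
apply: measurable_funM; last exact: measurable_fsetU1.
apply: measurableT_comp => //; apply: measurableT_comp => //.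
by apply: measurable_sum => a; exact: measurable_phi_subl.
Qed.

Definition abs_op G : G0 -> \bar R := pos_op phi (fun eta => `|G eta|%:E).

Lemma abs_op_ge0 G eta : (0 <= abs_op G eta)%E.
Proof. by apply: pos_op_ge0 => // zeta; rewrite lee_fin. Qed.

Lemma measurable_abs_op G : measurable_fun setT G -> measurable_fun setT (abs_op G).
Proof.
move=> mG; apply: measurable_pos_op => //.
by apply/measurable_EFinP; exact: measurableT_comp.
Qed.

Lemma integrable_Lhat_integrand G eta xi : measurable_fun setT G ->
  (abs_op G eta < +oo)%E -> (xi `<=` eta)%fset ->
  leb.-integrable setT (fun y => (Lhat_integrand phi G eta xi y)%:E).
Proof.
move=> mG Gfin xe; apply/integrableP; split.
  by apply/measurable_EFinP; exact: measurable_Lhat_integrand.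
apply: le_lt_trans Gfin; rewrite /abs_op /pos_op (big_rem xi) ?fpowersetE//=.
under eq_integral do rewrite normr_Lhat_integrand EFinM.
rewrite leeDl// sume_ge0// => zeta _; apply: integral_ge0 => y _.
by rewrite -EFinM lee_fin mulr_ge0// pos_kernel_ge0.
Qed.

Variable z : R.

(** Defined at every [eta] and measurable for every measurable [G]: [fine] gives 0 where a part is
    infinite. Where [abs_op] is finite, [signed_opE] identifies it with the formula in real
    integrals. *)
Definition signed_op G eta : R := - csign eta * z *
  (fine (pos_op phi (EFin \o pos_part G) eta) - fine (pos_op phi (EFin \o neg_part G) eta)).

Let mpos G : measurable_fun setT G -> measurable_fun setT (EFin \o pos_part G).
Proof. by move=> mG; apply/measurable_EFinP; exact: measurable_pos_part. Qed.
Let mneg G : measurable_fun setT G -> measurable_fun setT (EFin \o neg_part G).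
Proof. by move=> mG; apply/measurable_EFinP; exact: measurable_neg_part. Qed.
Let pos0 G eta : (0 <= (EFin \o pos_part G) eta)%E.
Proof. by rewrite lee_fin pos_part_ge0. Qed.
Let neg0 G eta : (0 <= (EFin \o neg_part G) eta)%E.
Proof. by rewrite lee_fin neg_part_ge0. Qed.

Lemma measurable_signed_op G : measurable_fun setT G -> measurable_fun setT (signed_op G).
Proof.
move=> mG; apply: measurable_funM.
  apply: measurable_funM => //; apply: measurableT_comp => //; exact: measurable_csign.
by apply: measurable_funB; apply: measurableT_comp => //; apply: measurable_pos_op => //;
  [exact: mpos|exact: mneg].
Qed.

Lemma pos_op_add_parts G eta : measurable_fun setT G ->
  (abs_op G eta = pos_op phi (EFin \o pos_part G) eta + pos_op phi (EFin \o neg_part G) eta)%E.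
Proof.
move=> mG; rewrite /abs_op /pos_op -big_split /=; apply: eq_bigr => xi _.
have mk : measurable_fun setT (fun y => (kern eta xi y)%:E).
  by apply/measurable_EFinP; exact: measurable_pos_kernel.
have k0 y : (0 <= (kern eta xi y)%:E)%E by rewrite lee_fin pos_kernel_ge0.
rewrite -ge0_integralD//.
- by apply: eq_integral => y _; rewrite -add_pos_neg_part -!EFinM -EFinD mulrDr.
- by move=> y _; rewrite mule_ge0// lee_fin pos_part_ge0.
- by apply: emeasurable_funM => //; exact: (measurable_fsetU1 xi (mpos mG)).
- by move=> y _; rewrite mule_ge0// lee_fin neg_part_ge0.
- by apply: emeasurable_funM => //; exact: (measurable_fsetU1 xi (mneg mG)).
Qed.

Lemma normr_signed_op_le G eta : 0 < z -> measurable_fun setT G ->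
  (`|signed_op G eta|%:E <= z%:E * abs_op G eta)%E.
Proof.
move=> z0 mG; have [absfin|] := ltP (abs_op G eta) +oo%E; last first.
  by rewrite leye_eq => /eqP ->; rewrite gt0_muley ?lte_fin// leey.
have p0 := pos_op_ge0 phi_ge0 (pos0 G) eta; have n0 := pos_op_ge0 phi_ge0 (neg0 G) eta.
have E := pos_op_add_parts eta mG.
have pfin : pos_op phi (EFin \o pos_part G) eta \is a fin_num.
  by rewrite ge0_fin_numE//; apply: le_lt_trans absfin; rewrite E leeDl.
have nfin : pos_op phi (EFin \o neg_part G) eta \is a fin_num.
  by rewrite ge0_fin_numE//; apply: le_lt_trans absfin; rewrite E leeDr.
rewrite E -(fineK pfin) -(fineK nfin) -EFinD -EFinM lee_fin /signed_op.
rewrite !normrM normrN normrX normrN1 expr1n mul1r gtr0_norm// ler_wpM2l ?(ltW z0)//.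
have := fine_ge0 p0; have := fine_ge0 n0; rewrite ler_norml; lra.
Qed.

Lemma signed_opE G eta : measurable_fun setT G -> (abs_op G eta < +oo)%E ->
  signed_op G eta = z * \sum_(xi <- fpowerset eta)
    (\int[leb]_y Lhat_integrand phi G eta xi y)%R.
Proof.
move=> mG absfin.
have part xi (h : G0 -> R) : measurable_fun setT h -> (forall zeta, 0 <= h zeta) ->
    (forall zeta, h zeta <= `|G zeta|) -> (xi `<=` eta)%fset ->
    leb.-integrable setT (fun y => (kern eta xi y * h (y |` xi)%fset)%:E).
  move=> mh h0 hG xe; have := integrable_Lhat_integrand mG absfin xe.
  apply: le_integrable => //.
    apply/measurable_EFinP; apply: measurable_funM; first exact: measurable_pos_kernel.
    exact: measurable_fsetU1.
  move=> y _; rewrite /= lee_fin normr_Lhat_integrand.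
  have k0 : 0 <= kern eta xi y by exact: pos_kernel_ge0.
  by rewrite ger0_norm; [exact: ler_wpM2l|exact: mulr_ge0].
have pG zeta : pos_part G zeta <= `|G zeta|.
  by rewrite -add_pos_neg_part lerDl neg_part_ge0.
have nG zeta : neg_part G zeta <= `|G zeta|.
  by rewrite -add_pos_neg_part lerDr pos_part_ge0.
have ip xi := part xi _ (measurable_pos_part mG) (pos_part_ge0 G) pG.
have iN xi := part xi _ (measurable_neg_part mG) (neg_part_ge0 G) nG.
rewrite /signed_op /pos_op [in LHS]big_seq [X in _ - fine X]big_seq.
rewrite -!sum_fine; last 2 first.
- move=> xi; rewrite fpowersetE => /iN /(integrable_fin_num measurableT).
  by under eq_integral do rewrite EFinM.
- move=> xi; rewrite fpowersetE => /ip /(integrable_fin_num measurableT).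
  by under eq_integral do rewrite EFinM.
rewrite -sumrB [- _ * z]mulrC -mulrA; congr (_ * _).
rewrite mulr_sumr [RHS]big_seq; apply: eq_bigr => xi; rewrite fpowersetE => xe.
rewrite -[fine _ - _]/(Rintegral leb setT (fun y => kern eta xi y * pos_part G (y |` xi)%fset) -
  Rintegral leb setT (fun y => kern eta xi y * neg_part G (y |` xi)%fset)).
rewrite -RintegralB//; [|exact: ip|exact: iN].
rewrite -RintegralZl//; last first.
  have := integrableB measurableT (ip xi xe) (iN xi xe).
  by apply: eq_integrable.
rewrite /Rintegral; congr fine; apply: ae_eq_integral => //.
- apply/measurable_EFinP; apply: measurable_funM => //; apply: measurable_funB.
    by apply/measurable_EFinP; exact: measurable_int (ip xi xe).
  by apply/measurable_EFinP; exact: measurable_int (iN xi xe).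
- by apply/measurable_EFinP; exact: measurable_Lhat_integrand.
(* The sign in [Lhat_integrandE] counts [y] as a new point beside [xi]. The exceptional [y] belong
   to the finite set [xi], which is null. *)
- have [ms s0] := @seq_null R d d_gt0 xi.
  exists [set y | y \in (xi : seq rV)]; split=> // y /=; apply: contraPP => yx.
  by case=> _; rewrite Lhat_integrandE//; exact/negP.
Qed.

End SignedOperator.

(** * Comparison of the weighted measures *)

Section WeightedMeasures.
Context (R : realType) (d : nat).
Hypothesis d_gt0 : (0 < d)%N.
Local Notation rV := 'rV[R]_d.
Local Notation tm := (tuple_measure (@lebesgue_rV R d)).
Local Notation G0 := (Gamma0 R d).
Local Notation lp := (lebesgue_poisson R d).
Local Notation lw := (lebesgue_poisson_weight R d).
Local Open Scope ereal_scope.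

Lemma ae_eqE d' (T : measurableType d') (mu : {measure set T -> \bar R}) (f g : T -> R) :
  f = g %[ae mu] <-> {ae mu, forall x, f x = g x}.
Proof. by split; apply: filterS => x H; [exact: H|move=> _]. Qed.

Lemma ae_and d' (T : measurableType d') (mu : {measure set T -> \bar R}) (P Q : T -> Prop) :
  {ae mu, forall x, P x} -> {ae mu, forall x, Q x} -> {ae mu, forall x, P x /\ Q x}.
Proof. exact: filterI. Qed.

Lemma nneseries_weighted_eq0 (a : nat -> R) (m : nat -> \bar R) :
  (forall n, (0 < a n)%R) -> (forall n, 0 <= m n) ->
  \sum_(0 <= n <oo) (a n)%:E * m n = 0 <-> forall n, m n = 0.
Proof.
move=> a0 m0; have am0 n : 0 <= (a n)%:E * m n by rewrite mule_ge0// lee_fin ltW.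
split=> [S0 n|m00]; last by rewrite eseries0// => n _ _; rewrite m00 mule0.
have : (a n)%:E * m n <= 0.
  rewrite -S0 (nneseries_split _ n)// (nneseries_split _ 1)// add0n addn1 big_nat1 addeCA.
  by rewrite leeDl// adde_ge0 ?nneseries_ge0// sume_ge0.
have := m0 n; case: (m n) => [r| |].
- rewrite lee_fin -EFinM lee_fin => r0; rewrite pmulr_rle0// => r0'; congr _%:E.
  by apply/le_anti; rewrite r0 r0'.
- by rewrite gt0_muley ?lte_fin// leye_eq.
- by rewrite leeNy_eq.
Qed.

(** Both measures are series of the same terms with strictly positive coefficients, so each vanishes
    exactly when all terms do. Almost everywhere thus means the same in all weights. *)
Lemma lebesgue_poisson_weight_null (c : {posnum R}) (A : set G0) : measurable A ->
  lw c A = 0 <-> lp A = 0.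
Proof.
move=> mA; rewrite lebesgue_poisson_weightE//.
have -> : lp A = \sum_(0 <= n <oo) (n`!%:R^-1)%:E * tm n (@config R d n @^-1` A) by [].
apply: (@iff_trans _ (forall n, tm n (@config R d n @^-1` A) = 0)).
  by apply: nneseries_weighted_eq0 => // n; rewrite divr_gt0// ?exprn_gt0// ltr0n fact_gt0.
by apply: iff_sym; apply: nneseries_weighted_eq0 => // n; rewrite invr_gt0 ltr0n fact_gt0.
Qed.

Lemma ae_weight (c : {posnum R}) (P : G0 -> Prop) :
  {ae lw c, forall eta, P eta} <-> {ae lp, forall eta, P eta}.
Proof.
split=> -[N [mN N0 PN]]; exists N; split=> //.
  exact/(lebesgue_poisson_weight_null c mN).
exact/(lebesgue_poisson_weight_null c mN).
Qed.

Lemma le_tuple_integral_uniq n (f g : n.-tuple rV -> \bar R) :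
  measurable_fun setT f -> measurable_fun setT g ->
  (forall t, 0 <= f t) -> (forall t, 0 <= g t) ->
  (forall t : n.-tuple rV, uniq t -> f t <= g t) ->
  \int[tm n]_t f t <= \int[tm n]_t g t.
Proof.
move=> mf mg f0 g0 fg; apply: ae_ge0_le_integral => //.
exists (~` [set t : n.-tuple rV | uniq t]); split.
- by apply: measurableC; exact: measurable_uniq.
- exact: not_uniq_null.
- by move=> t /=; apply: contra_not => ut _; exact: fg.
Qed.

(** The weighted measures have densities with respect to one measure, so a pointwise inequality with
    the powers of [c1] and [c2] written into it compares integrals in different weights. *)
Lemma le_integral_weight (c1 c2 : {posnum R}) (K : R) (u v : G0 -> \bar R) :
  (0 <= K)%R -> measurable_fun setT u -> measurable_fun setT v ->
  (forall eta, 0 <= u eta) -> (forall eta, 0 <= v eta) ->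
  (forall eta, (c1%:num ^+ #|` eta|)%:E * u eta <= (K * c2%:num ^+ #|` eta|)%:E * v eta) ->
  \int[lw c1]_eta u eta <= K%:E * \int[lw c2]_eta v eta.
Proof.
move=> K0 mu mv u0 v0 uv; have mc := @measurable_config R d.
rewrite !integral_weight// -nneseriesZl; last first.
  by move=> n _; rewrite mule_ge0 ?integral_ge0// lee_fin divr_ge0// exprn_ge0.
apply: lee_nneseries => n _.
  by move=> _; rewrite mule_ge0 ?integral_ge0// lee_fin divr_ge0// exprn_ge0.
have f0 : (0 <= n`!%:R^-1 :> R)%R by rewrite invr_ge0.
rewrite -!ge0_integralZl_EFin ?divr_ge0 ?exprn_ge0//; last 4 first.
- by move=> t _; rewrite mule_ge0// lee_fin divr_ge0// exprn_ge0.
- by apply: measurable_funeM; exact: measurableT_comp.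
- exact: measurableT_comp.
- exact: measurableT_comp.
apply: le_tuple_integral_uniq.
- by apply: measurable_funeM; exact: measurableT_comp.
- by apply: measurable_funeM; apply: measurable_funeM; exact: measurableT_comp.
- by move=> t; rewrite mule_ge0// lee_fin divr_ge0// exprn_ge0.
- by move=> t; rewrite !mule_ge0// lee_fin divr_ge0// exprn_ge0.
- move=> t ut; have := uv (config t); rewrite card_config_uniq// => uvt.
  have f0e : 0 <= (n`!%:R^-1 : R)%:E by rewrite lee_fin.
  have := lee_wpmul2l f0e uvt.
  rewrite !muleA -!EFinM; congr (_%:E * _ <= _%:E * _); first by rewrite mulrC.
  by ring.
Qed.

End WeightedMeasures.

(** * Relative bound, dissipativity and dense range of the operator *)

Section GlauberOperator.
Context (R : realType) (d : nat).
Hypothesis d_gt0 : (0 < d)%N.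
Local Notation rV := 'rV[R]_d.
Local Notation leb := (@lebesgue_rV R d).
Local Notation G0 := (Gamma0 R d).
Local Notation lp := (lebesgue_poisson R d).
Local Notation lw := (lebesgue_poisson_weight R d).
Implicit Types (eta xi : G0).

Variables (phi : rV -> R) (M z : R) (C : {posnum R}).
Hypotheses (mphi : measurable_fun setT phi) (phi_ge0 : forall x, 0 <= phi x).
Hypothesis phi_even : forall x, phi (- x) = phi x.
Hypothesis phiM : (\int[leb]_x (1 - expR (- phi x))%:E = M%:E)%E.
Hypothesis z_gt0 : 0 < z.
Let C2 := (2 * C%:num)%:pos.
Hypothesis zC : z * (expR (C%:num * M) / C%:num) <= 1.
Hypothesis zC2 : z * (expR (C2%:num * M) / C2%:num) <= 1.

Local Notation X := (Lc d C).
Local Notation B := (signed_op phi z).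
Local Notation A := (Lhat phi z C).
Local Notation card eta := (#|` eta|%:R : R).

(** An extended-valued norm on functions instead of classes: one function is measured in both
    weights [C] and [2C], and before it is known to be integrable. *)
Let N c (f : G0 -> R) : \bar R := (\int[lw c]_eta `|f eta|%:E)%E.

Let NA c (f : G0 -> R) : \bar R := N c (fun eta => card eta * f eta).

Let mcard : measurable_fun [set: G0] (fun eta => card eta).
Proof. exact: (@measurable_card R d (fun n => n%:R)). Qed.

Let mabs (f : G0 -> R) : measurable_fun setT f ->
  measurable_fun setT (fun eta => `|f eta|%:E).
Proof. by move=> mf; apply/measurable_EFinP; exact: measurableT_comp. Qed.

Let mcardM (f : G0 -> R) : measurable_fun setT f ->
  measurable_fun setT (fun eta => card eta * f eta).
Proof. exact: measurable_funM. Qed.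

Let N_card c f : NA c f =
  (\int[lw c]_eta ((card eta)%:E * `|f eta|%:E))%E.
Proof. by rewrite /NA; apply: eq_integral => eta _; rewrite normrM ger0_norm. Qed.

Let N_abs_op c f : measurable_fun setT f -> z * (expR (c%:num * M) / c%:num) <= 1 ->
  (z%:E * \int[lw c]_eta abs_op phi f eta <= NA c f)%E.
Proof.
move=> mf zc; have := pos_op_bound d_gt0 mphi phi_ge0 phi_even phiM (mabs mf) (fun eta => _) c.
move=> H; have {}H := H (fun eta => normr_ge0 (f eta)).
have I0 : (0 <= NA c f)%E by apply: integral_ge0.
rewrite N_card in I0 *; apply: le_trans (_ : (z%:E * (_ * _) <= _)%E).
  by apply: lee_wpmul2l; [rewrite lee_fin ltW|exact: H].
rewrite muleA -EFinM -[leRHS]mul1e lee_wpmul2r//.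
Qed.

Let N_signed_op c f : measurable_fun setT f -> z * (expR (c%:num * M) / c%:num) <= 1 ->
  (N c (B f) <= NA c f)%E.
Proof.
move=> mf zc; apply: le_trans (N_abs_op mf zc).
rewrite -ge0_integralZl_EFin ?(ltW z_gt0)//; last 2 first.
- by move=> eta _; exact: abs_op_ge0.
- exact: measurable_abs_op.
apply: ge0_le_integral => //.
- by apply: mabs; exact: measurable_signed_op.
- by apply: measurable_funeM; exact: measurable_abs_op.
- by move=> eta _; exact: normr_signed_op_le.
Qed.

(** By [n <= 2^n], doubling the weight absorbs the factor [|eta|]; this is why [L_(2C)] lies in the
    domain of [A]. *)
Let N_card_C2 f : measurable_fun setT f -> (NA C f <= N C2 f)%E.
Proof.
move=> mf; rewrite -[leRHS]mul1e; apply: le_integral_weight => //.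
- exact: mabs (mcardM mf).
- exact: mabs.
- move=> eta; rewrite -!EFinM lee_fin mul1r normrM ger0_norm// exprMn mulrA ler_wpM2r//.
  by rewrite mulrC ler_wpM2r ?exprn_ge0// -natrX ler_nat ltnW// ltn_expl.
Qed.

(** The relative bound makes the integral of [abs_op phi f] finite. This yields the integrability
    clause of [Lhat] and lets [signed_opE] apply almost everywhere. *)
Let abs_op_fin f : measurable_fun setT f -> (NA C f < +oo)%E ->
  {ae lp, forall eta, (abs_op phi f eta < +oo)%E}.
Proof.
move=> mf f_fin; apply/(ae_weight d_gt0 C).
have mop : measurable_fun setT (abs_op phi f) by exact: measurable_abs_op.
have : (lw C).-integrable setT (abs_op phi f).
  apply/integrableP; split=> //.
  under eq_integral => eta _ do rewrite gee0_abs ?abs_op_ge0//.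
  have := le_lt_trans (N_abs_op mf zC) f_fin.
  have : (0 <= \int[lw C]_eta abs_op phi f eta)%E.
    by apply: integral_ge0 => eta _; exact: abs_op_ge0.
  case: (\int[lw C]_eta abs_op phi f eta)%E => [r _ _| |]//; first exact: ltry.
  by rewrite gt0_muley ?lte_fin.
move=> /(integrable_ae measurableT); apply: filterS => eta /(_ I).
by rewrite ge0_fin_numE// abs_op_ge0.
Qed.

(** Here [h] is any representative of the combination. The defect [D] has norm 0, so [abs_op phi D]
    vanishes almost everywhere by the relative bound; for almost every [eta] the kernel times [|D|]
    then vanishes for almost every [y]. Independence of the representative is included. *)
Let signed_op_linear a f g h : measurable_fun setT f -> measurable_fun setT g ->
  measurable_fun setT h ->
  (NA C f < +oo)%E ->
  (NA C g < +oo)%E ->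
  (NA C h < +oo)%E ->
  {ae lp, forall eta, h eta = a * f eta + g eta} ->
  {ae lp, forall eta, B h eta = a * B f eta + B g eta}.
Proof.
move=> mf mg mh ff gf hf hE.
pose D eta := h eta - (a * f eta + g eta).
have mD : measurable_fun setT D.
  by apply: measurable_funB => //; apply: measurable_funD => //; exact: measurable_funM.
have D0 : NA C D = 0%E.
  transitivity (\int[lw C]_(eta in setT) (cst 0 eta))%E; last by rewrite integral0.
  apply: ae_eq_integral => //; first by apply: mabs; exact: mcardM.
  move/(ae_weight d_gt0 C): hE; apply: filterS => eta hE _.
  by rewrite /D hE subrr mulr0 normr0.
have absD : {ae lp, forall eta, abs_op phi D eta = 0%E}.
  apply/(ae_weight d_gt0 C).
  have mop : measurable_fun setT (abs_op phi D) by exact: measurable_abs_op.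
  have op0 : (\int[lw C]_eta `|abs_op phi D eta| = 0)%E.
    under eq_integral => eta _ do rewrite gee0_abs ?abs_op_ge0//.
    have := N_abs_op mD zC; rewrite D0.
    have : (0 <= \int[lw C]_eta abs_op phi D eta)%E.
      by apply: integral_ge0 => eta _; exact: abs_op_ge0.
    case: (\int[lw C]_eta abs_op phi D eta)%E => [r| |]//.
      rewrite -EFinM !lee_fin => r0; rewrite pmulr_rle0// => r0'.
      by congr _%:E; apply/le_anti; rewrite r0 r0'.
    by rewrite gt0_muley ?lte_fin.
  have [/(_ op0) H _] := ae_eq_integral_abs (lw C) measurableT mop.
  by apply: filterS H => eta /(_ I).
have H : {ae lp, forall eta, ((abs_op phi f eta < +oo)%E /\ (abs_op phi g eta < +oo)%E) /\
    ((abs_op phi h eta < +oo)%E /\ abs_op phi D eta = 0%E)}.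
  by apply: filterI; apply: filterI => //; exact: abs_op_fin.
apply: filterS H => eta [[fo go] [ho Do]].
rewrite !signed_opE//.
rewrite mulrCA -mulrDr; congr (_ * _).
rewrite mulr_sumr -big_split /= [LHS]big_seq [RHS]big_seq; apply: eq_bigr => xi.
rewrite fpowersetE => xe.
have fi := integrable_Lhat_integrand mphi phi_ge0 mf fo xe.
have gi := integrable_Lhat_integrand mphi phi_ge0 mg go xe.
have afi : leb.-integrable setT (EFin \o (fun y => a * Lhat_integrand phi f eta xi y)).
  by have := integrableZl measurableT a fi; apply: eq_integrable.
rewrite -RintegralZl// -RintegralD//.
rewrite /Rintegral; congr fine; apply: ae_eq_integral => //.
- by apply/measurable_EFinP; apply: measurable_Lhat_integrand.
- apply/measurable_EFinP; apply: measurable_funD; last by apply: measurable_Lhat_integrand.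
  by apply: measurable_funM => //; apply: measurable_Lhat_integrand.
- have mk : measurable_fun setT (fun y => (pos_kernel phi eta xi y)%:E * `|D (y |` xi)%fset|%:E)%E.
    apply: emeasurable_funM; last exact: (measurable_fsetU1 xi (mabs mD)).
    by apply/measurable_EFinP; exact: measurable_pos_kernel.
  have k0 y : (0 <= (pos_kernel phi eta xi y)%:E * `|D (y |` xi)%fset|%:E)%E.
    by rewrite mule_ge0// lee_fin pos_kernel_ge0.
  have kD : (\int[leb]_y `|(pos_kernel phi eta xi y)%:E * `|D (y |` xi)%fset|%:E| = 0)%E.
    under eq_integral do rewrite gee0_abs//.
    apply/eqP; rewrite eq_le integral_ge0// andbT -Do /abs_op /pos_op.
    rewrite (big_rem xi) ?fpowersetE//= leeDl// sume_ge0// => zeta _.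
    by apply: integral_ge0 => y _; rewrite mule_ge0// lee_fin pos_kernel_ge0.
  have [/(_ kD) H _] := ae_eq_integral_abs leb measurableT mk.
  apply: filterS H => y /(_ I) /= H _; congr _%:E.
  apply/eqP; rewrite -subr_eq0 -normr_eq0; apply/eqP.
  move: H; rewrite -EFinM => -[H]; rewrite -[RHS]H.
  rewrite -normr_Lhat_integrand//; congr `|_|.
  by rewrite /Lhat_integrand /D; ring.
Qed.

Let L2CP (G : X) : L2C d C G <-> (N C2 (G : G0 -> R) < +oo)%E.
Proof.
split=> [/Lfun1P[]//|Gf]; apply/Lfun1P; split=> //; exact: measurable_Lspace.
Qed.

Let card_fin (G : X) : L2C d C G -> (NA C G < +oo)%E.
Proof.
by move=> /L2CP; apply: le_lt_trans; apply: N_card_C2; exact: measurable_Lspace.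
Qed.

Let Lf (f : G0 -> R) eta := - (card eta * f eta) + B f eta.

Let mLf f : measurable_fun setT f -> measurable_fun setT (Lf f).
Proof.
move=> mf; apply: measurable_funD; last exact: measurable_signed_op.
by apply: measurableT_comp => //; exact: mcardM.
Qed.

Let LhatP (G F : X) : A (G, F) <->
  L2C d C G /\ {ae lp, forall eta, (F : G0 -> R) eta = Lf G eta}.
Proof.
have mG := measurable_Lspace G.
split=> -[GL H]; split=> //; have ao := abs_op_fin mG (card_fin GL).
  apply: filterS2 H ao => eta [_ ->] aoe; rewrite /Lhat_formula /Lf signed_opE//.
apply: filterS2 H ao => eta FE aoe; split; last by rewrite FE /Lf signed_opE.
by move=> xi xe; exact: integrable_Lhat_integrand.
Qed.

Let class_ex f : measurable_fun setT f -> (N C2 f < +oo)%E ->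
  exists2 G : X, L2C d C G & {ae lp, forall eta, (G : G0 -> R) eta = f eta}.
Proof.
move=> mf ff.
have [G Gf] : exists G : X, (G : G0 -> R) = f %[ae lw C].
  apply: L1_class_ex => //; apply: le_lt_trans ff.
  rewrite -[leRHS]mul1e; apply: le_integral_weight => //; try exact: mabs.
  move=> eta; rewrite -!EFinM lee_fin mul1r ler_wpM2r// exprMn ler_peMl ?exprn_ge0//.
  by rewrite exprn_ege1// ler1n.
have Gf' : {ae lp, forall eta, (G : G0 -> R) eta = f eta}.
  by apply/(ae_weight d_gt0 C)/ae_eqE.
exists G => //; apply/L2CP; rewrite (_ : N C2 (G : G0 -> R) = N C2 f)//.
apply: ae_eq_integral => //; try exact: mabs.
- by apply: mabs; exact: measurable_Lspace.
- by move/(ae_weight d_gt0 C2): Gf'; apply: filterS => eta -> _.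
Qed.

Let mBf (f : G0 -> R) : measurable_fun setT f -> measurable_fun setT (B f).
Proof. by move=> mf; exact: measurable_signed_op. Qed.

Let N_comb c a (f g : G0 -> R) : measurable_fun setT f -> measurable_fun setT g ->
  (N c (fun eta => a * f eta + g eta)%R <= `|a|%:E * N c f + N c g)%E.
Proof.
move=> mf mg; rewrite -ge0_integralZl_EFin//; last exact: mabs.
have maf : measurable_fun setT (fun eta => `|a|%:E * `|f eta|%:E)%E.
  by apply: measurable_funeM; exact: mabs.
rewrite -ge0_integralD//; last exact: mabs.
apply: ge0_le_integral => //.
- apply: mabs; apply: measurable_funD => //; exact: measurable_funM.
- by apply: emeasurable_funD => //; exact: mabs.
- by move=> eta _; rewrite -EFinM -EFinD lee_fin -normrM ler_normD.
Qed.

Let normE (G : X) (f : G0 -> R) : measurable_fun setT f ->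
  {ae lp, forall eta, (G : G0 -> R) eta = f eta} -> (`|G|%:E = N C f)%E.
Proof.
by move=> mf Gf; apply: L1_norm_ae => //; apply/ae_eqE/(ae_weight d_gt0 C).
Qed.

Let combE a (G H : X) : {ae lp, forall eta,
  (a *: G + H : G0 -> R) eta = a * (G : G0 -> R) eta + (H : G0 -> R) eta}.
Proof.
have /ae_eqE H1 := Lspace_addE (a *: G) H; have /ae_eqE H2 := Lspace_scaleE a G.
apply/(ae_weight d_gt0 C); apply: filterS2 H1 H2 => eta -> ->.
by [].
Qed.

Let subE (G H : X) : {ae lp, forall eta,
  (G - H : G0 -> R) eta = (G : G0 -> R) eta - (H : G0 -> R) eta}.
Proof. by apply/(ae_weight d_gt0 C); apply/ae_eqE; exact: L1_subE. Qed.

Let L2C_ae (G : X) (f : G0 -> R) : measurable_fun setT f -> (N C2 f < +oo)%E ->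
  {ae lp, forall eta, (G : G0 -> R) eta = f eta} -> L2C d C G.
Proof.
move=> mf ff Gf; apply/L2CP; rewrite (_ : N C2 (G : G0 -> R) = N C2 f)//.
apply: ae_eq_integral => //; try exact: mabs.
- by apply: mabs; exact: measurable_Lspace.
- by move/(ae_weight d_gt0 C2): Gf; apply: filterS => eta -> _.
Qed.

Let L2C_comb a (G H : X) : L2C d C G -> L2C d C H -> L2C d C (a *: G + H).
Proof.
have mG := measurable_Lspace G; have mH := measurable_Lspace H.
move=> /L2CP Gf /L2CP Hf; apply: L2C_ae (combE a G H).
  by apply: measurable_funD => //; exact: measurable_funM.
apply: le_lt_trans (N_comb _ _ mG mH) _.
rewrite lte_add_pinfty// lte_mul_pinfty//.
Qed.

Let Lhat_ex (G : X) : L2C d C G -> exists F, A (G, F).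
Proof.
move=> GL; have mG := measurable_Lspace G.
have [F Ff] : exists F : X, (F : G0 -> R) = Lf G %[ae lw C].
  apply: L1_class_ex; first exact: mLf.
  have := N_comb C (-1) (mcardM mG) (mBf mG).
  rewrite (_ : (fun eta => _) = Lf G); last by apply/funext => eta; rewrite /Lf mulN1r.
  move=> /le_lt_trans; apply; rewrite normrN1 mul1e lte_add_pinfty//.
    exact: card_fin.
  by apply: le_lt_trans (N_signed_op mG zC) _; exact: card_fin.
by exists F; apply/LhatP; split=> //; apply/(ae_weight d_gt0 C)/ae_eqE.
Qed.

Let Lhat_comb a (x y x' y' : X) : A (x, y) -> A (x', y') ->
  A (a *: x + x', a *: y + y').
Proof.
have mx := measurable_Lspace x; have mx' := measurable_Lspace x'.
move=> /LhatP[xL yE] /LhatP[xL' yE'].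
have cL := L2C_comb a xL xL'; apply/LhatP; split=> //.
have Blin := signed_op_linear mx mx' (measurable_Lspace _) (card_fin xL) (card_fin xL')
  (card_fin cL) (combE a x x').
have H := ae_and yE yE'.
have H' := ae_and (combE a y y') (combE a x x').
apply: filterS3 H H' Blin => eta [y1 y2] [y3 x3] B3.
rewrite y3 y1 y2 /Lf B3 x3; ring.
Qed.

Let Lhat_zero : A (0, 0).
Proof.
have [G GL _] : exists2 G : X, L2C d C G & {ae lp, forall eta, (G : G0 -> R) eta = 0}.
  apply: class_ex => //; rewrite /N.
  by under eq_integral do rewrite normr0; rewrite integral0 ltry.
have [F GF] := Lhat_ex GL.
by have := Lhat_comb (-1) GF GF; rewrite !scaleN1r !addNr.
Qed.

Lemma Lhat_linear : is_linear_operator A.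
Proof.
split; [exact: Lhat_zero|exact: Lhat_comb|].
move=> x y y' /LhatP[_ yE] /LhatP[_ yE']; apply/Lspace_eqP/ae_eqE/(ae_weight d_gt0 C).
by apply: filterS2 yE yE' => eta -> ->.
Qed.

Lemma Lhat_domain : operator_domain A = L2C d C.
Proof.
apply/seteqP; split=> [G [F /LhatP[]//]|G GL]; exact: Lhat_ex.
Qed.

(** As [1 + h |eta|] is positive, [||(1 + h A) x|| = ||x|| + h ||A x||] exactly. The norm of [h B x]
    is at most the second summand, which is finite on [L_(2C)] and therefore cancels. *)
Lemma Lhat_dissipative h (x y : X) : 0 < h -> A (x, y) -> `|x| <= `|x - h *: y|.
Proof.
move=> h0 /LhatP[xL yE]; have mx := measurable_Lspace x.
have mB := mBf mx.
pose W eta := (x : G0 -> R) eta + h * (card eta * (x : G0 -> R) eta) - h * B x eta.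
have mW : measurable_fun setT W.
  apply: measurable_funB; last exact: measurable_funM.
  by apply: measurable_funD => //; apply: measurable_funM => //; exact: mcardM.
have WE : {ae lp, forall eta, (x - h *: y : G0 -> R) eta = W eta}.
  rewrite -scaleNr addrC; apply: filterS2 (combE (- h) y x) yE => eta -> ->.
  by rewrite /Lf /W; ring.
have xfin := card_fin xL; have NA0 : (0 <= NA C x)%E by exact: integral_ge0.
have NAr : NA C x \is a fin_num by rewrite ge0_fin_numE.
have : (`|x|%:E + h%:E * NA C x <= `|x - h *: y|%:E + h%:E * NA C x)%E.
  have NB := N_signed_op mx zC.
  apply: (@le_trans _ _ (N C W + h%:E * N C (B x))%E); last first.
    by rewrite (normE mW WE) leeD2l// lee_wpmul2l// lee_fin ltW.
  rewrite (@normE x x)//; last by apply: filterE.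
  rewrite -!ge0_integralZl_EFin ?(ltW h0)//; try exact: mabs; last exact: mabs (mcardM mx).
  have m1 := mabs mx; have m2 := mabs (mcardM mx); have m3 := mabs mW; have m4 := mabs mB.
  rewrite -!ge0_integralD//; try by [move=> eta _; rewrite mule_ge0// lee_fin ltW|exact: measurable_funeM].
  apply: ge0_le_integral => //.
  - by move=> eta _; rewrite adde_ge0// mule_ge0// lee_fin ltW.
  - by apply: emeasurable_funD => //; exact: measurable_funeM.
  - by apply: emeasurable_funD => //; exact: measurable_funeM.
  - move=> eta _; rewrite -!EFinM -!EFinD lee_fin normrM (ger0_norm (ler0n _ _)).
    have -> : `|(x : G0 -> R) eta| + h * (card eta * `|(x : G0 -> R) eta|) =
        `|W eta + h * B x eta|.
      have -> : W eta + h * B x eta = (1 + h * card eta) * (x : G0 -> R) eta by rewrite /W; ring.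
      by rewrite normrM ger0_norm ?addr_ge0 ?mulr_ge0 ?(ltW h0)//; ring.
    by apply: (le_trans (ler_normD _ _)); rewrite normrM (gtr0_norm h0).
by rewrite -(fineK NAr) -EFinM -!EFinD lee_fin lerD2r.
Qed.

(** The part on large configurations is small in [L_C], as the tail of a convergent series; on the
    rest [|eta| <= n], and there the two weights differ at most by the factor [2^n]. *)
Let cut (n : nat) (f : G0 -> R) eta : R := (if (n < #|` eta|)%N then 1 else 0) * f eta.

Let mcut n f : measurable_fun setT f -> measurable_fun setT (cut n f).
Proof.
move=> mf; apply: measurable_funM => //.
exact: (@measurable_card R d (fun k => if (n < k)%N then 1 else 0)).
Qed.

Let N_cut (f : G0 -> R) e : measurable_fun setT f -> (N C f < +oo)%E -> 0 < e ->
  exists n : nat, (N C (cut n f) < e%:E)%E.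
Proof.
move=> mf ff e0; have mc := @measurable_config R d.
have mabsf := mabs mf.
pose a k : \bar R := ((C%:num ^+ k / k`!%:R)%:E *
   \int[tuple_measure leb k]_t `|f (config t)|%:E)%E.
have C0 k : 0 <= C%:num ^+ k / k`!%:R by rewrite divr_ge0// exprn_ge0.
have a0 k : (0 <= a k)%E by rewrite mule_ge0 ?lee_fin// integral_ge0.
have aE : N C f = (\sum_(0 <= k <oo) a k)%E by rewrite /N integral_weight.
have : (\sum_(n <= k <oo) a k)%E @[n --> \oo] --> 0%E.
  by apply: nneseries_tail_cvg => //; rewrite -aE.
move=> /fine_cvgP[tfin /cvgrPdist_lt/(_ _ e0) tsmall].
have [n [tf ts]] : exists n, (\sum_(n <= i <oo) a i)%E \is a fin_num /\
    `|0 - fine (\sum_(n <= i <oo) a i)%E| < e.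
  have [k _ kP] := filterI tfin tsmall; exists k; exact: (kP k (leqnn _)).
exists n; apply: (@le_lt_trans _ _ (\sum_(n <= i <oo) a i)%E); last first.
  rewrite -(fineK tf) lte_fin; apply: le_lt_trans ts.
  by rewrite sub0r normrN ler_norm.
have mg := mabs (mcut n mf).
rewrite /N integral_weight//.
rewrite [leLHS](nneseries_split _ n); last by move=> k _; rewrite mule_ge0 ?lee_fin// integral_ge0.
rewrite add0n big_mkord big1 ?add0e; last first.
  move=> [k /= kn] _; rewrite [X in (_ * X)%E](_ : _ = 0%E) ?mule0//.
  transitivity (\int[tuple_measure leb k]_(t in setT) (cst 0 t : \bar R))%E.
    apply: (tuple_integral_uniq d_gt0) => //; first exact: (measurableT_comp mg (mc k)).
    by move=> t ut; rewrite /cut card_config_uniq// ltnNge (ltnW kn) /= mul0r normr0.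
  exact: integral0.
apply: lee_nneseries => k _; first by move=> _; rewrite mule_ge0 ?lee_fin// integral_ge0.
rewrite lee_wpmul2l ?lee_fin//; apply: ge0_le_integral => //.
- exact: (measurableT_comp mg (mc k)).
- exact: (measurableT_comp mabsf (mc k)).
- by move=> t _; rewrite lee_fin /cut; case: ifP => _; rewrite ?mul1r// mul0r normr0.
Qed.

Let N_uncut n (f : G0 -> R) : measurable_fun setT f -> (N C f < +oo)%E ->
  (N C2 (fun eta => f eta - cut n f eta)%R < +oo)%E.
Proof.
move=> mf ff; have mfc : measurable_fun setT (fun eta => f eta - cut n f eta).
  by apply: measurable_funB => //; exact: mcut.
apply: (@le_lt_trans _ _ ((2 ^+ n)%:E * N C f)%E); last by rewrite lte_mul_pinfty.
apply: le_integral_weight => //; try exact: mabs.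
move=> eta; rewrite -!EFinM lee_fin /cut; case: ltnP => k_n.
  by rewrite mul1r subrr normr0 mulr0 !mulr_ge0// exprn_ge0.
rewrite mul0r subr0 ler_wpM2r// exprMn ler_wpM2r ?exprn_ge0//.
by rewrite ler_weXn2l// ler1n.
Qed.

Lemma L2C_dense (x : X) e : 0 < e -> exists2 G : X, L2C d C G & `|x - G| < e.
Proof.
move=> e0; have mx := measurable_Lspace x.
have xfin : (N C x < +oo)%E by rewrite -(@normE x x)// ?ltry//; exact: filterE.
have [n ne] := N_cut mx xfin e0.
have mxc : measurable_fun setT (fun eta => (x : G0 -> R) eta - cut n x eta).
  by apply: measurable_funB => //; exact: mcut.
have [G GL Gx] := class_ex mxc (N_uncut n mx xfin).
exists G => //; rewrite -lte_fin (@normE _ (cut n x))//; first exact: mcut.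
by apply: filterS2 (subE x G) Gx => eta -> ->; rewrite opprB addrC subrK.
Qed.

Let Lhat_dense (x : X) e : 0 < e -> exists u v : X, A (u, v) /\ `|x - u| < e.
Proof.
by move=> /(L2C_dense x)[G /Lhat_ex[F GF] xG]; exists G, F.
Qed.

(* With [K f = h B (f / (1 + h |.|))] one has
   [N (K f) + N (f / (1 + h |.|)) <= N f] in the weight [2C], so that the
   summands [K^n f / (1 + h |.|)] of the Neumann series tend to 0; and
   [1 + h |.| <= (1 + h) 2 ^ |.|] makes the remainder [K^n f] small in the
   weight [C]. *)
Let res h (f : G0 -> R) eta := f eta / (1 + h * card eta).
Let K h (f : G0 -> R) eta := h * B (res h f) eta.

Let res_den h eta : 0 < h -> 0 < 1 + h * card eta.
Proof. by move=> h0; rewrite ltr_pwDl// mulr_ge0// ltW. Qed.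

Let mres h f : 0 < h -> measurable_fun setT f -> measurable_fun setT (res h f).
Proof.
move=> h0 mf; apply: measurable_funM => //.
exact: (@measurable_card R d (fun k => (1 + h * k%:R)^-1)).
Qed.

Let mK h f : 0 < h -> measurable_fun setT f -> measurable_fun setT (K h f).
Proof.
move=> h0 mf; apply: measurable_funM => //.
by apply: measurable_signed_op => //; exact: mres.
Qed.

Let N_K h f : 0 < h -> measurable_fun setT f ->
  (N C2 (K h f) + N C2 (res h f) <= N C2 f)%E.
Proof.
move=> h0 mf; have mr := mres h0 mf; have mk := mK h0 mf.
apply: (@le_trans _ _ (h%:E * NA C2 (res h f) + N C2 (res h f))%E).
  rewrite leeD2r//; apply: (@le_trans _ _ (h%:E * N C2 (B (res h f)))%E).
    rewrite -ge0_integralZl_EFin ?(ltW h0)//; last exact: mabs (mBf mr).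
    rewrite le_eqVlt; apply/orP; left; apply/eqP; apply: eq_integral => eta _.
    by rewrite /K normrM gtr0_norm.
  by rewrite lee_wpmul2l ?lee_fin ?(ltW h0)//; exact: N_signed_op.
have m1 := mabs (mcardM mr); have m2 := mabs mr.
rewrite -ge0_integralZl_EFin ?(ltW h0)// -ge0_integralD//; last 2 first.
- by move=> eta _; rewrite mule_ge0// lee_fin ltW.
- exact: measurable_funeM.
rewrite le_eqVlt; apply/orP; left; apply/eqP; apply: eq_integral => eta _.
rewrite -EFinM -EFinD; congr _%:E.
have d0 := res_den eta h0.
rewrite -[in RHS](@divfK _ (1 + h * card eta) _ (f eta)) ?gt_eqF//.
rewrite -/(res h f eta) !normrM (gtr0_norm d0) (ger0_norm (ler0n _ _)); ring.
Qed.

Let N_res h f : 0 < h -> measurable_fun setT f -> (N C f <= (1 + h)%:E * N C2 (res h f))%E.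
Proof.
move=> h0 mf; have h1 : 0 <= 1 + h by rewrite addr_ge0// ltW.
apply: le_integral_weight => //; try exact: mabs; first exact: mabs (mres h0 mf).
move=> eta; rewrite -!EFinM lee_fin; have d0 := res_den eta h0.
rewrite -{1}(@divfK _ (1 + h * card eta) _ (f eta)) ?gt_eqF// -/(res h f eta).
rewrite normrM (gtr0_norm d0) [X in _ * X <= _]mulrC mulrA ler_wpM2r//.
rewrite exprMn mulrA mulrC ler_wpM2r ?exprn_ge0//.
have k2 : card eta <= 2 ^+ #|` eta| by rewrite -natrX ler_nat ltnW// ltn_expl.
have one2 : 1 <= 2 ^+ #|` eta| :> R by rewrite exprn_ege1// ler1n.
rewrite mulrDl mul1r lerD// ler_wpM2l// ltW//.
Qed.

Let Lhat_range h (f : X) e : 0 < h -> 0 < e ->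
  exists u v : X, A (u, v) /\ `|u - h *: v - f| < e.
Proof.
move=> h0 e0; have e20 : 0 < e / 2 by rewrite divr_gt0.
have [F FL fF] := L2C_dense f e20; have mF := measurable_Lspace F.
pose H n := iter n (K h) (F : G0 -> R).
have mH n : measurable_fun setT (H n) by elim: n => //= n; exact: mK.
have NF : (N C2 F < +oo)%E by exact/L2CP.
have Hsum n : (N C2 (H n) + \sum_(i < n) N C2 (res h (H i)) <= N C2 F)%E.
  elim: n => [|n IH]; first by rewrite big_ord0 adde0.
  apply: le_trans IH; rewrite big_ord_recr/= addeA addeAC leeD2r//.
  by have := N_K h0 (mH n); rewrite addeC.
have Nge0 c g : (0 <= N c g)%E by exact: integral_ge0.
have resfin n : (N C2 (res h (H n)) < +oo)%E.
  apply: le_lt_trans NF; apply: le_trans (Hsum n.+1).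
  by rewrite big_ord_recr/= addeA leeDr// adde_ge0// sume_ge0.
(* Chosen so that [N_res] turns a bound [del] on [res h (H n)] in weight [2C] into a bound [e / 2]
   on [H n] in weight [C]. *)
pose del := e / 2 / (1 + h); have del0 : 0 < del by rewrite !divr_gt0// addr_gt0.
(* One small term is enough. If all were at least [del], more than [N C2 F / del] of them would
   exceed the total allowed by [Hsum]. *)
have [n nsmall] : exists n, (N C2 (res h (H n)) < del%:E)%E.
  apply: contrapT => /forallNP big.
  have NFr : N C2 F \is a fin_num by rewrite ge0_fin_numE.
  pose n := (Num.truncn (fine (N C2 F) / del)).+1.
  have : (\sum_(i < n) del%:E <= N C2 F)%E.
    apply: le_trans (Hsum n); rewrite -[leLHS]add0e leeD//; apply: lee_sum => i _.
    by rewrite leNgt; apply/negP; exact: big.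
  rewrite sumEFin sumr_const card_ord -(fineK NFr) lee_fin -mulr_natl.
  by rewrite -ler_pdivlMr// leNgt truncnS_gt.
(* [1 - h L] sends [res h (H n)] to [H n - H n.+1], so the partial sums of the Neumann series have
   the image [F - H n]. *)
have [u [v [Auv uvE]]] : exists u v : X, A (u, v) /\
    {ae lp, forall eta, (u - h *: v : G0 -> R) eta = (F : G0 -> R) eta - H n eta}.
  elim: n {nsmall} => [|n [u [v [Auv uvE]]]].
    exists 0, 0; split; first exact: Lhat_zero.
    by rewrite scaler0; apply: filterS (subE F F) => eta; rewrite !subrr.
  have [G GL GE] := class_ex (mres h0 (mH n)) (resfin n).
  have [Y GY] := Lhat_ex GL.
  exists (1 *: G + u), (1 *: Y + v); split; first exact: Lhat_comb.
  have /LhatP[_ YE] := GY.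
  have mG := measurable_Lspace G.
  have mrH := mres h0 (mH n).
  (* The coefficient 0 turns linearity into invariance under the change of representative from
     [res h (H n)] to [G]. *)
  have BG : {ae lp, forall eta, B G eta = 0 * B (res h (H n)) eta + B (res h (H n)) eta}.
    apply: signed_op_linear => //.
    - by apply: le_lt_trans (N_card_C2 mrH) (resfin n).
    - by apply: le_lt_trans (N_card_C2 mrH) (resfin n).
    - exact: card_fin.
    - by apply: filterS GE => eta ->; rewrite mul0r add0r.
  have E : 1 *: G + u - h *: (1 *: Y + v) = (-h) *: Y + G + (u - h *: v).
    by lmod_with R constr:(Lc d C : normedModType R) ltac:(ring).
  rewrite E.
  have c1 := combE 1 (- h *: Y + G) (u - h *: v); have c2 := combE (- h) Y G.
  have H1 := ae_and c1 c2.
  have H2 := ae_and GE YE.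
  have H3 := ae_and BG uvE.
  apply: filterS3 H1 H2 H3 => eta [p1 p2] [p3 p4] [p5 p6].
  rewrite scale1r in p1; rewrite p1 p2 p6 p4 /Lf p5 p3 mul0r add0r /= -/(H n) /K.
  rewrite mul1r -{1}(@divfK _ (1 + h * card eta) _ (H n eta)) ?gt_eqF ?res_den//.
  by rewrite -/(res h (H n) eta); ring.
exists u, v; split=> //.
have uvF : `|u - h *: v - F| < e / 2.
  rewrite -lte_fin (@normE _ (fun eta => - H n eta)); last 2 first.
  - exact: measurableT_comp.
  - apply: filterS2 (subE (u - h *: v) F) uvE => eta -> ->.
    by rewrite addrAC subrr sub0r.
  have -> : N C (fun eta => - H n eta) = N C (H n).
    by apply: eq_integral => eta _; rewrite normrN.
  apply: le_lt_trans (N_res h0 (mH n)) _.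
  have -> : (e / 2)%:E = ((1 + h)%:E * del%:E)%E.
    by rewrite -EFinM /del; congr _%:E; field; rewrite gt_eqF// addr_gt0.
  by rewrite lte_pmul2l// lte_fin addr_gt0.
rewrite -(subrKA F) (le_lt_trans (ler_normD _ _))// (splitr e) ltrD//.
by rewrite distrC.
Qed.

Lemma Lhat_generator : closable A /\ exists T : R -> X -> X,
  is_C0_contraction_semigroup T /\ generator T = closure A.
Proof.
split.
  exact: (is_linear_operator_closure Lhat_zero Lhat_comb Lhat_dissipative Lhat_dense).
exact: (hille_yosida Lhat_zero Lhat_comb Lhat_dissipative Lhat_dense Lhat_range
  (@L1_complete _ _ _ (lw C))).
Qed.

End GlauberOperator.

(** * Independence of the value of the potential at the origin *)

Section PotentialAtOrigin.
Context (R : realType) (d : nat).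
Hypothesis d_gt0 : (0 < d)%N.
Local Notation rV := 'rV[R]_d.
Local Notation leb := (@lebesgue_rV R d).
Local Notation G0 := (Gamma0 R d).

Lemma measurable_fun_setC0 (f : rV -> R) :
  measurable_fun [set~ (0 : rV)] f -> measurable_fun setT f.
Proof.
move=> mf; have m0 := @measurable_set1_rV R d 0.
rewrite -(setUv [set (0 : rV)]); apply/measurable_funU => //.
  exact: measurableC.
by split=> //; exact: measurable_fun_set1.
Qed.

(** For [y] outside [eta] all differences [y - a] are nonzero. Since [eta] is finite, the excluded
    [y] form a null set, so the integrals do not see the value at the origin. *)
Lemma Lhat_integrand_eq (phi psi : rV -> R) (G : G0 -> R) (eta xi : G0) (y : rV) :
  (forall x, x != 0 -> phi x = psi x) -> (xi `<=` eta)%fset -> y \notin eta ->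
  Lhat_integrand phi G eta xi y = Lhat_integrand psi G eta xi y.
Proof.
move=> pp /fsubsetP xe ye.
have E a : a \in eta -> phi (y - a) = psi (y - a).
  by move=> ae; apply: pp; rewrite subr_eq0; apply: contraNneq ye => ->.
rewrite /Lhat_integrand /Ephi /e_lambda; congr (expR (- _) * _ * _).
  by apply: eq_big_seq => a /xe/E.
by apply: eq_big_seq => a; rewrite inE => /andP[_ /E ->].
Qed.

Lemma sub_Lhat (phi psi : rV -> R) (z : R) (C : {posnum R}) :
  measurable_fun setT phi -> measurable_fun setT psi ->
  (forall x, x != 0 -> phi x = psi x) -> Lhat phi z C `<=` Lhat psi z C.
Proof.
move=> mphi mpsi pp [G F]; case=> GL GF; split; first exact: GL.
apply: filterS GF => eta [Gi FE].
have mG := measurable_Lspace G; have [me e0] := seq_null d_gt0 eta.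
have aeE (xi : G0) : (xi `<=` eta)%fset ->
    {ae leb, forall y, Lhat_integrand phi G eta xi y = Lhat_integrand psi G eta xi y}.
  move=> xe; exists [set y | y \in (eta : seq rV)]; split=> // y /=.
  by apply: contra_notP => ye; apply: Lhat_integrand_eq => //; exact/negP.
have mI (f : rV -> R) (xi : G0) : measurable_fun setT f ->
    measurable_fun setT (fun y => (Lhat_integrand f G eta xi y)%:E).
  by move=> mf; apply/measurable_EFinP; exact: measurable_Lhat_integrand.
split.
  move=> xi xe; have /integrableP[_ ioo] := Gi xi xe; apply/integrableP; split; first exact: mI.
  apply: le_lt_trans ioo; apply: ae_ge0_le_integral => //.
  - by apply: measurableT_comp => //; exact: mI.
  - by apply: measurableT_comp => //; exact: mI.
  - by apply: filterS (aeE xi xe) => y ->.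
rewrite FE /Lhat_formula; congr (_ + _ * _); rewrite [LHS]big_seq [RHS]big_seq.
apply: eq_bigr => xi; rewrite fpowersetE => xe; rewrite /Rintegral; congr fine.
apply: ae_eq_integral => //; try exact: mI.
by apply: filterS (aeE xi xe) => y ->.
Qed.

Lemma Lhat_eq_away0 (phi psi : rV -> R) (z : R) (C : {posnum R}) :
  measurable_fun setT phi -> measurable_fun setT psi ->
  (forall x, x != 0 -> phi x = psi x) -> Lhat phi z C = Lhat psi z C.
Proof.
move=> mphi mpsi pp; apply/seteqP; split; apply: sub_Lhat => // x x0.
by rewrite pp.
Qed.

Lemma Cphi_eq_away0 (phi psi : rV -> R) :
  measurable_fun setT phi -> measurable_fun setT psi ->
  (forall x, x != 0 -> phi x = psi x) -> Cphi phi = Cphi psi.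
Proof.
have mE (f : rV -> R) : measurable_fun setT f ->
    measurable_fun setT (fun x : rV => (1 - expR (- f x))%:E).
  move=> mf; apply/measurable_EFinP; apply: measurable_funB => //.
  by apply: measurableT_comp => //; exact: measurableT_comp.
move=> mphi mpsi pp; apply: ae_eq_integral => //; try exact: mE.
exists [set (0 : rV)]; split; [exact: measurable_set1_rV|exact: lebesgue_rV_set1|].
by move=> x /=; apply: contra_notP => /eqP x0 _; rewrite pp.
Qed.

End PotentialAtOrigin.

Theorem theorem4p8 (R : realType) (d : nat) (phi : 'rV[R]_d -> R)
    (C : {posnum R}) (z : R)
    (d_gt0 : (0 < d)%N)
    (mphi : measurable_fun [set~ (0 : 'rV[R]_d)] phi)
    (phi_ge0 : forall x : 'rV[R]_d, x != 0 -> 0 <= phi x)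
    (phi_even : forall x : 'rV[R]_d, x != 0 -> phi (- x) = phi x)
    (Cphi_fin : (Cphi phi < +oo)%E)
    (z_gt0 : 0 < z)
    (z_le : z <= Num.min
       (C%:num * expR (- (C%:num * fine (Cphi phi))))
       (2 * C%:num * expR (- (2 * C%:num * fine (Cphi phi))))) :
  [/\ is_linear_operator (Lhat phi z C),
      operator_domain (Lhat phi z C) = L2C d C,
      closable (Lhat phi z C)
    & exists T : R -> Lc d C -> Lc d C,
        is_C0_contraction_semigroup T /\
        generator T = closure (Lhat phi z C)].
Proof.
(* Extension by 0 gives nonnegativity and evenness at the origin as well, so the results for
   potentials on all of [R^d] apply to [psi]; [Lhat] and [Cphi] stay the same. *)
pose psi (x : 'rV[R]_d) := if x == 0 then 0 else phi x.
have mphiT := measurable_fun_setC0 mphi.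
have pp x : x != 0 -> phi x = psi x by rewrite /psi => /negbTE ->.
have mpsi : measurable_fun setT psi.
  apply: measurable_fun_setC0; apply: eq_measurable_fun mphi => x.
  by rewrite inE /= => /eqP; exact: pp.
have psi_ge0 x : 0 <= psi x.
  by rewrite /psi; case: ifPn => // x0; exact: phi_ge0.
have psi_even x : psi (- x) = psi x.
  by rewrite /psi oppr_eq0; case: ifPn => // x0; exact: phi_even.
have psiM : (\int[lebesgue_rV]_x (1 - expR (- psi x))%:E)%E = (fine (Cphi phi))%:E.
  rewrite fineK ?(Cphi_eq_away0 d_gt0 mphiT mpsi pp)// ge0_fin_numE -?(Cphi_eq_away0 d_gt0 mphiT mpsi pp)//.
  rewrite (Cphi_eq_away0 d_gt0 mphiT mpsi pp); apply: integral_ge0 => x _.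
  by rewrite lee_fin subr_ge0 -expR0 ler_expR oppr_le0.
move: z_le; rewrite le_min => /andP[zC zC2].
(* Both bounds in the minimum have the form [c * expR (- (c * M))], with [c = C] and [c = 2C]; each
   says that the relative bound in weight [c] is at most 1. *)
have small (c : R) : 0 < c -> z <= c * expR (- (c * fine (Cphi phi))) ->
    z * (expR (c * fine (Cphi phi)) / c) <= 1.
  move=> c0; rewrite expRN mulrCA mulrA => zc.
  rewrite ler_pdivrMr// mul1r mulrC.
  by move: zc; rewrite ler_pdivlMr ?expR_gt0.
rewrite (Lhat_eq_away0 d_gt0 z C mphiT mpsi pp).
have C0 : 0 < C%:num by []. have C20 : 0 < 2 * C%:num by rewrite mulr_gt0.
have zC' := small _ C0 zC; have zC2' := small _ C20 zC2.
have [cl gen] := Lhat_generator d_gt0 mpsi psi_ge0 psi_even psiM z_gt0 zC' zC2'.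
split; [| |exact: cl|exact: gen].
- exact: (Lhat_linear d_gt0 mpsi psi_ge0 psi_even psiM z_gt0 zC').
- exact: (Lhat_domain d_gt0 mpsi psi_ge0 psi_even psiM z_gt0 zC').
Qed.
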